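(* Let $k$ be a field of characteristic $\ell>0$, $q$ a prime power and $n$ a natural number; consider $S_k(PG(n-1,q))$-modules. (1) If $\ell=p$ and $q=p^s$ ($p$ prime), then $\Delta_{\{0\},k}=L_{\{0\},k}$, and for any subspace $V\ne\{0\}$ of $\mathbb F_q^n$ the Jantzen filtration on $\Delta_{V,k}$ is given by $$(\Delta_{V,k})^i=\bigoplus_{\substack{V\subseteq W\\ s(\dim V)(\dim W/V)\ge i}}\Delta^W_{V,k}.$$ In particular, $L_{V,k}\cong\Delta^V_{V,k}$ is one-dimensional for each $V\neq\{0\}$. (2) If $\ell$ does not divide $q$, then for subspaces $V\subseteq W$ of $\mathbb F_q^n$ and $i\geq 0$, the $W$-weight space of the $i$th successive quotient $(\Delta_{V,k})^i/(\Delta_{V,k})^{i+1}$ of the Jantzen filtration of $\Delta_{V,k}$ is isomorphic as a $GL(W/V)$-module to the successive quotient $M(\kappa-i)$ of Gow's Jantzen filtration of $\mathrm{St}^k(W/V)$, where $\kappa$ is the $\ell$-adic valuation of the number of full flags in $W/V$. In particular, the $W$-weight space of the simple module $L_{V,k}=(\Delta_{V,k})^0/(\Delta_{V,k})^1$ is isomorphic to the socle $\mathrm{soc}(\mathrm{St}^k(W/V))$ of $\mathrm{St}^k(W/V)$.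
   Context: Algebra. For subspaces of $\mathbb{F}_q^n$ write $V\lessdot W$ (or $W\gtrdot V$) if $V\subset W$ and $\dim W=\dim V+1$. A flag path is a finite nonempty sequence $(V_1,\dots,V_l)$ of subspaces such that for each $i<l$ either $V_i\lessdot V_{i+1}$ or $V_i\gtrdot V_{i+1}$. The free $\mathbb{Z}$-module on flag paths is an algebra under concatenation ($(K_1,\dots,K_l)\cdot(L_1,\dots,L_{l'})=(K_1,\dots,K_l=L_1,L_2,\dots,L_{l'})$ if $K_l=L_1$, else $0$). $S(PG(n-1,q))$ is its quotient by the two-sided ideal generated by: (FS) for $V\subset W$ with $\dim W=\dim V+2$: $\sum_X (V\lessdot X\lessdot W)=0=\sum_X (W\gtrdot X\gtrdot V)$, sums over $X$ with $V\lessdot X\lessdot W$; ($\bigwedge$) for $V\lessdot W\gtrdot V'$: $(V\lessdot W\gtrdot V')=q^{\dim V}(V)$ if $V=V'$, and $=-(V\gtrdot V\cap V'\lessdot V')$ if $V\ne V'$. $S_k=S\otimes_{\mathbb Z}k$; the $W$-weight space of a left module $X$ is $X^W=(W)X$. Standard modules. $\Delta_V$ is the left module $S(PG(n-1,q))\cdot(V)$ modulo the $\mathbb Z$-span of the images of all flag paths that end at $V$ and pass through some subspace not containing $V$; it is spanned by classes of flags $(V_m\gtrdot\dots\gtrdot V_1\gtrdot V)$ and is isomorphic to the free $\mathbb Z$-module on such flags modulo (FS). Its symmetric form $\langle\,,\rangle_V$ is defined on flags $V_\bullet=(V_l\gtrdot\dots\gtrdot V_1\gtrdot V)$, $W_\bullet=(W_m\gtrdot\dots\gtrdot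 W_1\gtrdot V)$ by $\langle V_\bullet,W_\bullet\rangle_V\,(V)=(V,W_1,\dots,W_m)\cdot(V_l,\dots,V_1,V)$ in $S(PG(n-1,q))$ (always an integer multiple of $(V)$). Put $\Delta_V^i=\{x\in\Delta_V:\langle x,v\rangle_V\in\ell^i\mathbb Z\ \forall v\in\Delta_V\}$, $\Delta_{V,k}=\Delta_V\otimes k$, and let the Jantzen filtration term $(\Delta_{V,k})^i$ be the image of $\Delta_V^i\otimes k$ in $\Delta_{V,k}$; $(\Delta_{V,k})^1$ is the radical of the induced form over $k$ and $L_{V,k}=\Delta_{V,k}/(\Delta_{V,k})^1$. $GL(W/V)$ acts on $\Delta_{V,k}^W$ by permuting the flags $(W\gtrdot\dots\gtrdot V)$ from $W$ down to $V$. Steinberg module and Gow's filtration. For $G=GL_m(\mathbb F_q)$, $B$ upper triangular matrices, $U$ upper unitriangular matrices, $\mathfrak S_m\subset G$ permutation matrices, $\mathfrak e=(\sum_{\sigma\in\mathfrak S_m}\mathrm{sgn}(\sigma)\sigma)\sum_{b\in B}b$. For a commutative ring $R$, $\mathrm{St}^R(\mathbb F_q^m)=RG\,\mathfrak e$, with $R$-basis $\{u\mathfrak e\}_{u\in U}$. Let $f$ be the symmetric $\mathbb Z$-bilinear form on $\mathrm{St}^{\mathbb Z}(\mathbb F_q^m)$ with $f(u_1\mathfrak e,u_2\mathfrak e)=|\{w\in\mathfrak S_m:wu_1^{-1}u_2w^{-1}\in U\}|$. $I(i)\subseteq\mathrm{St}^k(\mathbb F_q^m)$ is the image of $\{x\in\mathrm{St}^{\mathbb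 Z}(\mathbb F_q^m):f(x,y)\in\ell^i\mathbb Z\ \forall y\}\otimes k$, and $M(i)=I(i)/I(i+1)$ (with $M(i)=0$ for $i<0$). For an $m$-dimensional space such as $W/V$, these are transported via a choice of isomorphism with $\mathbb F_q^m$. *)

(* Defs.v *)
From HB Require Import structures.
From mathcomp Require Import all_boot all_order all_algebra all_fingroup.
From mathcomp Require Import generic_quotient ring_quotient.
From mathcomp Require Import boolp classical_sets functions.
From mathcomp.multinomials Require Import freeg.

Set Implicit Arguments.
Unset Strict Implicit.
Unset Printing Implicit Defensive.

Import GRing.Theory.

Local Open Scope classical_set_scope.
Local Open Scope ring_scope.
Local Open Scope quotient_scope.

(* Spans are inductive sets, turned into boolean predicates by classical logic
   so that they can be fed to MathComp's quotient and closed-predicate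
   structures. *)
Inductive zspan_set (M : zmodType) (A : set M) : set M :=
| zspan_set0 : zspan_set A 0
| zspan_set_add x y : A x -> zspan_set A y -> zspan_set A (x + y)
| zspan_set_sub x y : A x -> zspan_set A y -> zspan_set A (y - x).

Definition zspan (M : zmodType) (A : set M) : {pred M} :=
  fun x => `[< zspan_set A x >].

Inductive span_set (R : pzRingType) (M : lmodType R) (A : set M) : set M :=
| span_set0 : span_set A 0
| span_set_add a x y : A x -> span_set A y -> span_set A (a *: x + y).

Definition span (R : pzRingType) (M : lmodType R) (A : set M) : {pred M} :=
  fun x => `[< span_set A x >].

Lemma zspan_closed (M : zmodType) (A : set M) : zmod_closed (zspan A).
Proof.
split=> [|x y]; first by apply/asboolP; constructor.
move=> /asboolP Ax /asboolP Ay; apply/asboolP.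
elim: Ay => {y} [|y z Ay _ IH|y z Ay _ IH]; first by rewrite subr0.
  by rewrite opprD addrCA addrC; apply: zspan_set_sub.
by rewrite opprB addrCA; apply: zspan_set_add.
Qed.
HB.instance Definition _ (M : zmodType) (A : set M) :=
  GRing.isZmodClosed.Build M (zspan A) (zspan_closed A).

Lemma span_closed (R : pzRingType) (M : lmodType R) (A : set M) :
  submod_closed (span A).
Proof.
split=> [|a x y]; first by apply/asboolP; constructor.
move=> /asboolP Ax /asboolP Ay; apply/asboolP.
elim: Ax => {x} [|b x z Ax _ IH]; first by rewrite scaler0 add0r.
by rewrite scalerDr scalerA -addrA; apply: span_set_add.
Qed.
HB.instance Definition _ (R : pzRingType) (M : lmodType R) (A : set M) :=
  GRing.isSubmodClosed.Build R M (span A) (span_closed A).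

Section QuotientModule.
Variables (R : pzRingType) (M : lmodType R) (N : submodClosed M).

Definition submod_pred : {pred M} := N.
HB.instance Definition _ := GRing.isZmodClosed.Build M submod_pred
  (GRing.submod_closedB (GRing.submodClosedP N)).

Definition quotmod := Quotient.quot submod_pred.
HB.instance Definition _ := GRing.Zmodule.on quotmod.

Definition qclass (x : M) : quotmod := \pi x.

Lemma qclass_eq x y : (qclass x == qclass y) = (x - y \in N).
Proof. exact: esym (Quotient.idealrBE submod_pred x y). Qed.

Lemma qclassB x y : qclass (x - y) = qclass x - qclass y.
Proof. by rewrite /qclass !piE. Qed.

Lemma qclassD x y : qclass (x + y) = qclass x + qclass y.
Proof. by rewrite /qclass !piE. Qed.

Lemma qclassP (u : quotmod) : exists x, u = qclass x.
Proof. by exists (repr u); rewrite /qclass reprK. Qed.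

Definition qscale (a : R) (u : quotmod) : quotmod := qclass (a *: repr u).

Lemma qscaleE a x : qscale a (qclass x) = qclass (a *: x).
Proof.
apply/eqP; rewrite qclass_eq -scalerBr rpredZ // -qclass_eq.
by rewrite /qclass reprK.
Qed.

Fact qscaleA a b u : qscale a (qscale b u) = qscale (a * b) u.
Proof. by case: (qclassP u) => x ->; rewrite !qscaleE scalerA. Qed.
Fact qscale1 : left_id 1 qscale.
Proof. by move=> u; case: (qclassP u) => x ->; rewrite qscaleE scale1r. Qed.
Fact qscaleDr : right_distributive qscale +%R.
Proof.
move=> a u v; case: (qclassP u) => x ->; case: (qclassP v) => y ->.
by rewrite -qclassD !qscaleE scalerDr qclassD.
Qed.
Fact qscaleDl u : {morph qscale^~ u : a b / a + b}.
Proof.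
by move=> a b; case: (qclassP u) => x ->; rewrite !qscaleE scalerDl qclassD.
Qed.
HB.instance Definition _ := GRing.Zmodule_isLmodule.Build R quotmod
  qscaleA qscale1 qscaleDr qscaleDl.

Fact qclass_linear : linear qclass.
Proof. by move=> a x y; rewrite qclassD -qscaleE. Qed.
HB.instance Definition _ :=
  GRing.isLinear.Build R M quotmod *:%R qclass qclass_linear.

End QuotientModule.

Section QuotientRing.
Variables (A : pzRingType) (rel : set A).

Definition ideal_gen : {pred A} :=
  zspan [set x | exists a r b, rel r /\ x = a * r * b].
HB.instance Definition _ := GRing.ZmodClosed.on ideal_gen.

Fact ideal_genMl a x : x \in ideal_gen -> a * x \in ideal_gen.
Proof.
move=> /asboolP Ix; apply/asboolP.
elim: Ix => [|y z [b [r [c [rr ->]]]] _ IH|y z [b [r [c [rr ->]]]] _ IH].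
- by rewrite mulr0; constructor.
- by rewrite mulrDr !mulrA; apply: zspan_set_add => //; exists (a * b), r, c.
- by rewrite mulrBr !mulrA; apply: zspan_set_sub => //; exists (a * b), r, c.
Qed.

Fact ideal_genMr a x : x \in ideal_gen -> x * a \in ideal_gen.
Proof.
move=> /asboolP Ix; apply/asboolP.
elim: Ix => [|y z [b [r [c [rr ->]]]] _ IH|y z [b [r [c [rr ->]]]] _ IH].
- by rewrite mul0r; constructor.
- rewrite mulrDl; apply: zspan_set_add => //.
  by exists b, r, (c * a); rewrite !mulrA.
- rewrite mulrBl; apply: zspan_set_sub => //.
  by exists b, r, (c * a); rewrite !mulrA.
Qed.

Definition quotring := Quotient.quot ideal_gen.
HB.instance Definition _ := GRing.Zmodule.on quotring.

Definition rclass (x : A) : quotring := \pi x.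

Lemma rclass_eq x y : (rclass x == rclass y) = (x - y \in ideal_gen).
Proof. exact: esym (Quotient.idealrBE ideal_gen x y). Qed.

Fact rclass_additive : zmod_morphism rclass.
Proof. by move=> x y; rewrite /rclass !piE. Qed.
HB.instance Definition _ :=
  GRing.isZmodMorphism.Build A quotring rclass rclass_additive.

Lemma rclassP (u : quotring) : exists x, u = rclass x.
Proof. by exists (repr u); rewrite /rclass reprK. Qed.

Definition rmul (u v : quotring) : quotring := rclass (repr u * repr v).

Lemma rmulE x y : rmul (rclass x) (rclass y) = rclass (x * y).
Proof.
apply/eqP; rewrite rclass_eq; set x' := repr _; set y' := repr _.
have Ix : x' - x \in ideal_gen by rewrite -rclass_eq /rclass reprK.
have Iy : y' - y \in ideal_gen by rewrite -rclass_eq /rclass reprK.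
have -> : x' * y' - x * y = (x' - x) * y' + x * (y' - y).
  by rewrite mulrBl mulrBr addrA subrK.
by apply: rpredD; [apply: ideal_genMr | apply: ideal_genMl].
Qed.

Fact rmulA : associative rmul.
Proof.
move=> u v w; case: (rclassP u) => x ->; case: (rclassP v) => y ->.
by case: (rclassP w) => z ->; rewrite !rmulE mulrA.
Qed.
Fact rmul1 : left_id (rclass 1) rmul.
Proof. by move=> u; case: (rclassP u) => x ->; rewrite rmulE mul1r. Qed.
Fact rmulr1 : right_id (rclass 1) rmul.
Proof. by move=> u; case: (rclassP u) => x ->; rewrite rmulE mulr1. Qed.
Fact rmulDl : left_distributive rmul +%R.
Proof.
move=> u v w; case: (rclassP u) => x ->; case: (rclassP v) => y ->.
by case: (rclassP w) => z ->; rewrite -raddfD !rmulE mulrDl raddfD.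
Qed.
Fact rmulDr : right_distributive rmul +%R.
Proof.
move=> u v w; case: (rclassP u) => x ->; case: (rclassP v) => y ->.
by case: (rclassP w) => z ->; rewrite -raddfD !rmulE mulrDr raddfD.
Qed.
HB.instance Definition _ := GRing.Zmodule_isPzRing.Build quotring
  rmulA rmul1 rmulr1 rmulDl rmulDr.

Fact rclass_monoid : monoid_morphism rclass.
Proof. by split=> [|x y]; rewrite -?rmulE. Qed.
HB.instance Definition _ :=
  GRing.isMonoidMorphism.Build A quotring rclass rclass_monoid.

End QuotientRing.

Section FreeModule.
Variables (R : nzRingType) (K : choiceType) (M : lmodType R).
Implicit Types (f g : K -> M) (x y : {freeg K / R}).

HB.instance Definition _ f :=
  GRing.isZmodMorphism.Build _ _ (fglift f) (lift_is_additive f).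

Lemma fglift_sum f x : fglift f x = \sum_(z <- dom x) coeff z x *: f z.
Proof.
rewrite -{1}(freeg_sumE x) raddf_sum.
by apply: eq_bigr => z _; exact: liftU.
Qed.

Fact fglift_scalable f : scalable (fglift f).
Proof.
move=> a x; rewrite (fglift_sum f x) scaler_sumr.
rewrite -[a *: x]/(\sum_(z <- dom x) << a * coeff z x *g z >>) raddf_sum.
by apply: eq_bigr => z _; rewrite /= liftU scalerA.
Qed.
HB.instance Definition _ f :=
  GRing.isScalable.Build R _ M *:%R (fglift f) (fglift_scalable f).

End FreeModule.

Section FlagPathAlgebra.
Variables (F : finFieldType) (n : nat).

Definition subsp := {vspace 'cV[F]_n}.
HB.instance Definition _ := Choice.on subsp.
Let subspK : cancel
    (@VectorInternalTheory.vs2mx F 'cV[F]_n : subsp -> 'M[F]_(dim 'cV[F]_n))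
    (@VectorInternalTheory.mx2vs _ _ _) :=
  @VectorInternalTheory.vs2mxK F 'cV[F]_n.
HB.instance Definition _ : isCountable subsp := CanIsCountable subspK.
HB.instance Definition _ : isFinite subsp := CanIsFinite subspK.

Definition lessdot (V W : subsp) := (V <= W)%VS && (\dim W == (\dim V).+1).
Definition gtrdot (V W : subsp) := lessdot W V.

Definition is_flagpath (s : seq subsp) :=
  if s is X :: t then path (fun U V => lessdot U V || gtrdot U V) X t
  else false.

Record flagpath :=
  FlagPath { flagpath_seq :> seq subsp; _ : is_flagpath flagpath_seq }.
HB.instance Definition _ := [isSub for flagpath_seq].
HB.instance Definition _ := [Choice of flagpath by <:].

Definition path_alg := {freeg flagpath / int}.
HB.instance Definition _ := GRing.Lmodule.on path_alg.

(* The basis element of the flag path s; it is 0 if s is not a flag path. *)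
Definition bpath (s : seq subsp) : path_alg :=
  if insub s is Some p then << 1 *g p >> else 0.

Definition concat (p q : seq subsp) : path_alg :=
  if last 0%VS p == head 0%VS q then bpath (p ++ behead q) else 0.

Definition path_mul (x y : path_alg) : path_alg :=
  fglift (fun p : flagpath => fglift (fun q : flagpath => concat p q) y) x.

Definition path_one : path_alg := \sum_(X : subsp) bpath [:: X].

Lemma path_alg_ind (P : path_alg -> Prop) :
    P 0 -> (forall x y, P x -> P y -> P (x - y)) ->
    (forall p : flagpath, P (bpath p)) ->
  forall x, P x.
Proof.
move=> P0 PB Pb x.
have PN y : P y -> P (- y) by move=> Py; rewrite -sub0r; apply: PB.
have PD y z : P y -> P z -> P (y + z).
  by move=> Py Pz; rewrite -[z]opprK; apply: PB => //; apply: PN.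
rewrite -(freeg_sumE x); apply: (big_ind P) => // p _.
have {Pb} : P << 1 *g p >> by have := Pb p; rewrite /bpath valK.
rewrite -[coeff p x]intz -freegU_mulz => Pp.
have Pn m : P (<< 1 *g p >> *+ m).
  by elim: m => [|m IH]; rewrite ?mulr0n // mulrS; apply: PD.
by case: (coeff p x) => m; rewrite ?NegzE ?mulrNz -pmulrn //; apply: PN.
Qed.

Lemma bpath0 s : ~~ is_flagpath s -> bpath s = 0.
Proof. by move=> hs; rewrite /bpath insubN. Qed.

Lemma path_mulBl x y z : path_mul (x - y) z = path_mul x z - path_mul y z.
Proof. exact: raddfB. Qed.

Lemma path_mulBr x y z : path_mul x (y - z) = path_mul x y - path_mul x z.
Proof.
rewrite /path_mul !fglift_sum -sumrB; apply: eq_bigr => p _.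
by rewrite raddfB scalerBr.
Qed.

Lemma path_mul0l y : path_mul 0 y = 0.
Proof. exact: raddf0. Qed.

Lemma path_mul0r x : path_mul x 0 = 0.
Proof. by have := path_mulBr x 0 0; rewrite subr0 subrr. Qed.

Fact path_mulDl : left_distributive path_mul +%R.
Proof. by move=> x y z; apply: raddfD. Qed.

Fact path_mulDr : right_distributive path_mul +%R.
Proof.
move=> x y z.
have mulN u : path_mul x (- u) = - path_mul x u.
  by rewrite -[in LHS]sub0r path_mulBr path_mul0r sub0r.
by rewrite -[in LHS](opprK z) path_mulBr mulN opprK.
Qed.

Lemma path_mul_basis (p q : seq subsp) : is_flagpath p -> is_flagpath q ->
  path_mul (bpath p) (bpath q) = concat p q.
Proof.
move=> hp hq; rewrite {1 2}/bpath !insubT /=.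
by rewrite /path_mul !liftU !scale1r.
Qed.

Lemma concat_path (p q : seq subsp) :
    is_flagpath p -> is_flagpath q -> last 0%VS p == head 0%VS q ->
  [/\ is_flagpath (p ++ behead q), head 0%VS (p ++ behead q) = head 0%VS p
    & last 0%VS (p ++ behead q) = last 0%VS q].
Proof.
case: p q => [|X p] [|Y q] //= hp hq /eqP eY; rewrite -eY in hq *.
by rewrite cat_path hp last_cat.
Qed.

Fact path_mulA : associative path_mul.
Proof.
move=> x y z; elim/path_alg_ind: x => [|x x' IH IH'|p].
- by rewrite !path_mul0l.
- by rewrite !path_mulBl IH IH'.
elim/path_alg_ind: y => [|x x' IH IH'|q].
- by rewrite path_mul0l !path_mul0r path_mul0l.
- by rewrite !path_mulBl !path_mulBr path_mulBl IH IH'.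
elim/path_alg_ind: z => [|x x' IH IH'|r].
- by rewrite !path_mul0r.
- by rewrite !path_mulBr IH IH'.
case: p q r => [p hp] [q hq] [r hr] /=; rewrite !path_mul_basis // /concat.
case: (boolP (last 0%VS q == head 0%VS r)) => [qr|nqr]; last first.
  rewrite path_mul0r; case: ifP => [pq|]; last by rewrite path_mul0l.
  have [pq_path _ pq_last] := concat_path hp hq pq.
  by rewrite path_mul_basis // /concat pq_last (negPf nqr).
have [qr_path qr_head _] := concat_path hq hr qr.
rewrite path_mul_basis // /concat qr_head.
case: ifP => [pq|]; last by rewrite path_mul0l.
have [pq_path _ pq_last] := concat_path hp hq pq.
rewrite path_mul_basis // /concat pq_last qr.
by case: q hq {pq pq_path pq_last qr qr_path qr_head} => //= X q _; rewrite catA.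
Qed.

Fact path_mul1l : left_id path_one path_mul.
Proof.
elim/path_alg_ind => [|x y IH IH'|[p hp] /=].
- exact: path_mul0r.
- by rewrite path_mulBr IH IH'.
rewrite /path_one /path_mul raddf_sum (bigD1 (head 0%VS p : subsp)) //=.
rewrite big1 ?addr0 => [|X neX].
  rewrite -/(path_mul _ _) path_mul_basis // /concat eqxx.
  by case: p hp.
by rewrite -/(path_mul _ _) path_mul_basis // /concat (negPf neX).
Qed.

Fact path_mul1r : right_id path_one path_mul.
Proof.
elim/path_alg_ind => [|x y IH IH'|[p hp] /=].
- exact: path_mul0l.
- by rewrite path_mulBl IH IH'.
have mul_sum (I : finType) (G : I -> path_alg) :
    path_mul (bpath p) (\sum_i G i) = \sum_i path_mul (bpath p) (G i).
  by apply: (big_morph _ (path_mulDr _) (path_mul0r _)).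
rewrite /path_one mul_sum (bigD1 (last 0%VS p : subsp)) //=.
rewrite big1 ?addr0 => [|X neX].
  by rewrite path_mul_basis // /concat eqxx /= cats0.
by rewrite path_mul_basis // /concat eq_sym (negPf neX).
Qed.

HB.instance Definition _ := GRing.Zmodule_isPzRing.Build path_alg
  path_mulA path_mul1l path_mul1r path_mulDl path_mulDr.

Inductive PG_rel : path_alg -> Prop :=
| FS_up (V W : subsp) : (V <= W)%VS -> \dim W = (\dim V).+2 ->
    PG_rel (\sum_(X | lessdot V X && lessdot X W) bpath [:: V; X; W])
| FS_down (V W : subsp) : (V <= W)%VS -> \dim W = (\dim V).+2 ->
    PG_rel (\sum_(X | lessdot V X && lessdot X W) bpath [:: W; X; V])
| wedge_eq (V W : subsp) : lessdot V W ->
    PG_rel (bpath [:: V; W; V] - bpath [:: V] *+ (#|F| ^ \dim V))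
| wedge_neq (V W V' : subsp) : lessdot V W -> gtrdot W V' -> V != V' ->
    PG_rel (bpath [:: V; W; V'] + bpath [:: V; (V :&: V')%VS : subsp; V']).

(* The ring S(PG(n-1,q)), where F = F_q. *)
Definition PGalg := quotring PG_rel.
HB.instance Definition _ := GRing.PzRing.on PGalg.

Definition spath (s : seq subsp) : PGalg := rclass PG_rel (bpath s).

End FlagPathAlgebra.

Section BaseChange.
Variable k : comNzRingType.

(* M (x)_Z k, presented as the free k-module on the symbols x (x) 1 (x in M)
   modulo additivity. *)
Definition tens_rel (M : zmodType) : set {freeg M / k} :=
  [set z | exists x y, z = << 1 *g x + y >> - << 1 *g x >> - << 1 *g y >>].

Definition basechange (M : zmodType) := quotmod (span (@tens_rel M)).
HB.instance Definition _ (M : zmodType) := GRing.Lmodule.on (basechange M).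

Definition tens (M : zmodType) (x : M) : basechange M :=
  qclass (span (@tens_rel M)) << 1 *g x >>.

Fact tens_additive (M : zmodType) : zmod_morphism (@tens M).
Proof.
have tensD x y : tens (x + y) = tens x + tens y :> basechange M.
  apply/eqP; rewrite -qclassD qclass_eq; apply/asboolP.
  rewrite opprD addrA -[X in span_set _ X]addr0 -[X in X + 0]scale1r.
  by apply: span_set_add; [exists x, y | apply: span_set0].
by move=> x y; have := tensD (x - y) y; rewrite subrK => ->; rewrite addrK.
Qed.
HB.instance Definition _ (M : zmodType) :=
  GRing.isZmodMorphism.Build M (basechange M) (@tens M) (@tens_additive M).

Section Functor.
Variables (M N : zmodType) (f : {additive M -> N}).

Definition bcmap_free : {freeg M / k} -> basechange N :=
  fglift (fun x => tens (f x)).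

Definition bcmap (u : basechange M) : basechange N := bcmap_free (repr u).

Lemma bcmap_qclass z : bcmap (qclass _ z) = bcmap_free z.
Proof.
apply/eqP; rewrite -subr_eq0 -raddfB /=.
have : repr (qclass (span (@tens_rel M)) z) - z \in span (@tens_rel M).
  by rewrite -qclass_eq /qclass reprK.
move=> /asboolP; elim=> [|a _ y [x [x' ->]] _ /eqP IH]; first by rewrite raddf0.
rewrite raddfD /= IH addr0 linearZ /= !raddfB /= !liftU !scale1r.
by rewrite (raddfD f) (raddfD (@tens N)) scalerDr addrAC addrK subrr.
Qed.

Lemma bcmap_tens x : bcmap (tens x) = tens (f x).
Proof. by rewrite bcmap_qclass /bcmap_free liftU scale1r. Qed.

Fact bcmap_linear : linear bcmap.
Proof.
move=> a u v; case: (qclassP u) => x ->; case: (qclassP v) => y ->.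
by rewrite -linearP /= !bcmap_qclass /bcmap_free linearP.
Qed.
HB.instance Definition _ :=
  GRing.isLinear.Build k (basechange M) (basechange N) *:%R bcmap bcmap_linear.
End Functor.
End BaseChange.

Section StandardModule.
Variables (F : finFieldType) (n : nat) (V : subsp F n).
Local Notation S := (PGalg F n).

(* S.(V) *)
Definition left_ideal : {pred S^o} :=
  fun x => `[< exists s : S, x = s * spath [:: V] >].

Fact left_ideal_closed : submod_closed left_ideal.
Proof.
split=> [|a x y]; first by apply/asboolP; exists 0; rewrite mul0r.
move=> /asboolP [s ->] /asboolP [t ->]; apply/asboolP; exists (a * s + t).
by rewrite mulrDl -mulrA.
Qed.
HB.instance Definition _ :=
  GRing.isSubmodClosed.Build S S^o left_ideal left_ideal_closed.

Record projmod := ProjMod { pm_val :> S^o; pm_valP : pm_val \in left_ideal }.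
HB.instance Definition _ := [isSub for pm_val].
HB.instance Definition _ := [Choice of projmod by <:].
HB.instance Definition _ := [SubChoice_isSubLmodule of projmod by <:].

Fact pm_of_subproof (x : S) : x * spath [:: V] \in left_ideal.
Proof. by apply/asboolP; exists x. Qed.
Definition pm_of (x : S) : projmod := ProjMod (pm_of_subproof x).

(* Delta is S.(V) modulo the Z-span of bad_paths; the span is an S-submodule. *)
Definition bad_paths : set projmod :=
  [set x | exists s, [/\ is_flagpath s, last 0%VS s = V,
     has (fun U : subsp F n => ~~ (V <= U)%VS) s & pm_val x = spath s]].

Definition bad_span : {pred projmod} := zspan bad_paths.

Fact bad_span_closed : submod_closed bad_span.
Proof.
have [b0 bB] := zspan_closed bad_paths; split=> // a x y bx b_y.
suff bax : a *: x \in bad_span.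
  rewrite -[y]opprK; apply: (bB) => //.
  by rewrite -[- y]sub0r; apply: (bB).
have badS u : bad_paths u -> a *: u \in bad_span.
  case=> s [hs lsV /hasP [U Us nVU] us].
  case: (rclassP a) => b ->; elim/path_alg_ind: b => [|b c IHb IHc|[p hp]].
  - by rewrite raddf0 scale0r.
  - by rewrite raddfB scalerBl; apply: (bB).
  case: (boolP (last 0%VS p == head 0%VS s)) => [ps|nps]; last first.
    suff -> : rclass (@PG_rel F n) (bpath p) *: u = 0 by [].
    apply/val_inj; rewrite linearZ /= us.
    apply: etrans (esym (rmorphM (rclass (@PG_rel F n)) (bpath p) (bpath s))) _.
    rewrite [_ * _]path_mul_basis // /concat (negPf nps); exact: raddf0.
  have [ps_path _ ps_last] := concat_path hp hs ps.
  apply/asboolP; rewrite -[_ *: _]addr0; apply: zspan_set_add; last by constructor.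
  exists (p ++ behead s); split=> //; first by rewrite ps_last.
    apply/hasP; exists U => //; rewrite mem_cat.
    move: hs ps Us {lsV us ps_path ps_last}; case: s => //= X s _ /eqP psX.
    rewrite inE => /orP [/eqP ->|->]; last by rewrite orbT.
    by rewrite -psX; case: p hp {psX} => //= Y p _; rewrite mem_last.
  rewrite -[pm_val _]/(val _) linearZ /= us.
  apply: etrans (esym (rmorphM (rclass (@PG_rel F n)) (bpath p) (bpath s))) _.
  by rewrite [_ * _]path_mul_basis // /concat ps.
move: bx => /asboolP; elim=> {x} [|u v bu _ IH|u v bu _ IH].
- by rewrite scaler0.
- have bvN : - (a *: v) \in bad_span by rewrite -sub0r; apply: (bB).
  by rewrite scalerDr -[a *: v]opprK; apply: (bB) => //; apply: badS.
- by rewrite scalerBr; apply: (bB) => //; apply: badS.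
Qed.
HB.instance Definition _ :=
  GRing.isSubmodClosed.Build S projmod bad_span bad_span_closed.

Definition Delta := quotmod bad_span.
HB.instance Definition _ := GRing.Lmodule.on Delta.

(* The class of a path s ending at V; multiplying by (V) does not change such an
   s, it only makes the membership in S.(V) manifest. *)
Definition dpath (s : seq (subsp F n)) : Delta :=
  qclass bad_span (pm_of (spath s)).

Definition is_flag_to (s : seq (subsp F n)) :=
  if s is X :: t then path (@gtrdot F n) X t && (last X t == V) else false.

Definition is_flag_from_to (W : subsp F n) (s : seq (subsp F n)) :=
  is_flag_to s && (head 0%VS s == W).

(* The integer c with (V, W_1, ..., W_m).(V_l, ..., V_1, V) = c (V) in S, for
   the flags K = (V_l, ..., V_1, V) and L = (W_m, ..., W_1, V). *)
Definition flag_form (K L : seq (subsp F n)) : int :=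
  xget 0 [set c : int | spath (rev L) * spath K = spath [:: V] *~ c].

(* Some expression of x as an integral combination of flags ending at V. *)
Definition flag_coord (x : Delta) : seq (int * seq (subsp F n)) :=
  xget [::] [set c | all (fun t => is_flag_to t.2) c
                     /\ x = \sum_(t <- c) dpath t.2 *~ t.1].

Definition std_form (x y : Delta) : int :=
  \sum_(s <- flag_coord x) \sum_(t <- flag_coord y)
    s.1 * t.1 * flag_form s.2 t.2.

Definition Delta_fil (l i : nat) : set Delta :=
  [set x | forall v, ((l ^ i)%:Z %| std_form x v)%Z].

Section OverField.
Variables (k : fieldType) (l : nat).

Definition Deltak := basechange k Delta.
HB.instance Definition _ := GRing.Lmodule.on Deltak.

Definition Jantzen (i : nat) : submodClosed Deltak :=
  span (@tens k Delta @` Delta_fil l i).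

Definition Lk := quotmod (Jantzen 1).
HB.instance Definition _ := GRing.Lmodule.on Lk.

Definition to_Lk : Deltak -> Lk := qclass (Jantzen 1).

(* A module over S_k = S (x) k is a k-space with a k-linear action of S; this is
   the action of (W) on Deltak. *)
Definition wt_proj (W : subsp F n) : Deltak -> Deltak :=
  bcmap ( *:%R (spath [:: W] : S) : {additive Delta -> Delta}).

Definition wt (W : subsp F n) : set Deltak := [set wt_proj W x | x in setT].

(* A/B, for B contained in A, sits inside the quotient of the whole module by
   B; this is the W-weight space (W).(A/B). *)
Definition wt_quot (W : subsp F n) (A : set Deltak) (B : submodClosed Deltak) :
  set (quotmod B) := [set qclass B (wt_proj W x) | x in A].

Definition flag_comb (c : seq (k * seq (subsp F n))) : Deltak :=
  \sum_(t <- c) t.1 *: tens k (dpath t.2).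

End OverField.
End StandardModule.

Section Steinberg.
Variables (F : finFieldType) (m : nat).

(* {'GL_m[F]} is not used because it is GL_1 for m = 0. *)
Record GLmat := MkGL { GLval :> 'M[F]_m; GLvalP : GLval \in unitmx }.
HB.instance Definition _ := [isSub for GLval].
HB.instance Definition _ := [Finite of GLmat by <:].

Definition GL1 := MkGL (unitmx1 F m).
Fact GLmul_subproof (g h : GLmat) : GLval g *m GLval h \in unitmx.
Proof. by rewrite unitmx_mul !GLvalP. Qed.
Definition GLmul g h := MkGL (GLmul_subproof g h).
Fact GLinv_subproof (g : GLmat) : invmx (GLval g) \in unitmx.
Proof. by rewrite unitmx_inv GLvalP. Qed.
Definition GLinv g := MkGL (GLinv_subproof g).
Fact GLmulA : associative GLmul.
Proof. by move=> f g h; apply/val_inj/mulmxA. Qed.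
Fact GLmul1 : left_id GL1 GLmul.
Proof. by move=> g; apply/val_inj/mul1mx. Qed.
Fact GLmulV : left_inverse GL1 GLinv GLmul.
Proof. by move=> g; apply/val_inj/mulVmx/GLvalP. Qed.
HB.instance Definition _ := Finite_isGroup.Build GLmat GLmulA GLmul1 GLmulV.

Definition GLperm (s : 'S_m) : GLmat := MkGL (unitmx_perm F s).

Definition in_B (g : GLmat) :=
  [forall i : 'I_m, forall j : 'I_m, (j < i)%N ==> (GLval g i j == 0)].
Definition in_U (g : GLmat) := in_B g && [forall i : 'I_m, GLval g i i == 1].

Section GroupAlgebra.
Variable R : comNzRingType.

(* The group algebra RG, with convolution as product. *)
Definition grp_alg := {ffun GLmat -> R^o}.
HB.instance Definition _ := GRing.Lmodule.on grp_alg.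

Definition gelt (g : GLmat) : grp_alg := [ffun h => (h == g)%:R].
Definition gmul (x y : grp_alg) : grp_alg :=
  [ffun g => \sum_h x h * y (h^-1 * g)%g].

Definition St_e : grp_alg :=
  gmul (\sum_(s : 'S_m) (-1) ^+ s *: gelt (GLperm s)) (\sum_(b | in_B b) gelt b).

Definition St : set grp_alg := [set gmul x St_e | x in setT].

Definition GL_stable (X : set grp_alg) :=
  forall g x, X x -> X (gmul (gelt g) x).
Definition GL_submod (X : set grp_alg) :=
  [/\ X 0, forall a x y, X x -> X y -> X (a *: x + y) & GL_stable X].
Definition GL_simple (X : set grp_alg) :=
  [/\ GL_submod X, X <> [set 0]
    & forall Y, GL_submod Y -> Y `<=` X -> Y = [set 0] \/ Y = X].
Definition soc (X : set grp_alg) : {pred grp_alg} :=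
  span [set x | exists Y, [/\ GL_simple Y, Y `<=` X & Y x]].
End GroupAlgebra.

Definition Gow_form_basis (u v : GLmat) : int :=
  #|[pred w : 'S_m | in_U (GLperm w * u^-1 * v * (GLperm w)^-1)%g]|%:Z.

(* The coordinates of x in the basis u.e of St over Z. *)
Definition St_coord (x : grp_alg int) : {ffun GLmat -> int} :=
  xget [ffun=> 0] [set a : {ffun GLmat -> int} |
    x = \sum_(u | in_U u) a u *: gmul (gelt int u) (St_e int)].

Definition Gow_form (x y : grp_alg int) : int :=
  \sum_(u | in_U u) \sum_(v | in_U v)
    St_coord x u * St_coord y v * Gow_form_basis u v.

Definition Gow_Z (l i : nat) : set (grp_alg int) :=
  [set x | St x
           /\ forall y, St y -> ((l ^ i)%:Z %| Gow_form x y)%Z].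

Section OverField.
Variables (k : fieldType) (l : nat).

Definition St_red (x : grp_alg int) : grp_alg k := [ffun g => (x g)%:~R].

Definition Gow (i : nat) : submodClosed (grp_alg k) :=
  span (St_red @` Gow_Z l i).

(* M(j) = Gow_num j / Gow_den j, which is zero for j < 0. *)
Definition Gow_num (j : int) : submodClosed (grp_alg k) :=
  if j is Posz i then Gow i else span set0.
Definition Gow_den (j : int) : submodClosed (grp_alg k) :=
  if j is Posz i then Gow i.+1 else span set0.
Definition Gow_quot (j : int) : set (quotmod (Gow_den j)) :=
  [set qclass (Gow_den j) x | x in [set` Gow_num j]].

(* The graph of the action of g on M(j) induced by that on St. *)
Definition Gow_quot_act (j : int) (g : GLmat) :
    quotmod (Gow_den j) -> quotmod (Gow_den j) -> Prop :=
  fun u v => exists z, [/\ z \in Gow_num j, u = qclass _ z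
                         & v = qclass _ (gmul (gelt k g) z)].

Definition St_act (g : GLmat) : grp_alg k -> grp_alg k -> Prop :=
  fun x y => y = gmul (gelt k g) x.
End OverField.
End Steinberg.

Section Quotients.
Variables (F : finFieldType) (n m : nat).
Implicit Types (V W X : subsp F n) (phi : 'Hom('cV[F]_n, 'cV[F]_m)).

(* phi restricted to W induces an isomorphism of W/V with F^m. *)
Definition quot_iso V W phi :=
  (phi @: W)%VS = fullv /\ (lker phi :&: W)%VS = V.

(* The action of g in GL_m(F), identified with GL(W/V), on the subspaces X with V <= X <= W. *)
Definition sub_act W phi (g : GLmat F m) X : subsp F n :=
  (W :&: phi @^-1: (linfun (mulmx (GLval g)) @: (phi @: X)))%VS.

(* The graph of the action of g on the W-weight space of A/B induced by its
   permutation action on the flags from W down to V. *)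
Definition flag_act V W phi (k : fieldType) (A : set (Deltak V k))
    (B : submodClosed (Deltak V k)) (g : GLmat F m) :
    quotmod B -> quotmod B -> Prop :=
  fun u v => exists c : seq (k * seq (subsp F n)),
    [/\ all (fun t => is_flag_from_to V W t.2) c, A (flag_comb V c),
      u = qclass B (flag_comb V c)
    & v = qclass B (flag_comb V [seq (t.1, map (sub_act W phi g) t.2) | t <- c])].
End Quotients.

Definition nb_full_flags (F : finFieldType) n (V W : subsp F n) :=
  #|[pred t : (\dim W - \dim V).+1.-tuple (subsp F n)
     | is_flag_from_to V W t]|.

Definition internal_direct_sum (k : fieldType) (M : lmodType k) (I : finType)
    (P : pred I) (X : I -> set M) (A : set M) :=
  (forall x, A x <-> exists2 y : I -> M, (forall i, P i -> X i (y i))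
                                         & x = \sum_(i | P i) y i)
  /\ (forall y : I -> M, (forall i, P i -> X i (y i)) ->
        \sum_(i | P i) y i = 0 -> forall i, P i -> y i = 0).

Definition one_dimensional (k : fieldType) (M : lmodType k) (X : set M) :=
  exists v, [/\ X v, v != 0 & forall x, X x -> exists a, x = a *: v].

(* X and Y are subspaces of M and N on which G acts linearly; the actions are
   given by their graphs aM and aN.  That these graphs are single-valued and
   preserve X and Y is part of the definition. *)
Definition rep_iso (k : fieldType) (G : Type) (M N : lmodType k)
    (X : set M) (aM : G -> M -> M -> Prop)
    (Y : set N) (aN : G -> N -> N -> Prop) :=
  exists f : M -> N,
    [/\ forall a x y, X x -> X y -> f (a *: x + y) = a *: f x + f y,
        set_bij X Y f
      & forall g x, X x -> exists x',
          [/\ X x', aM g x = [set x'] & aN g (f x) = [set f x']]].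

Arguments wt_quot {F n V k} W A B _.
Arguments flag_act {F n m V} W phi {k} A B g _ _.
Arguments wt {F n} V k W _.
Arguments to_Lk {F n} V k l _.
Arguments St F m R _ : clear implicits.
Arguments Gow_quot F m k l j _ : clear implicits.
Arguments Gow_quot_act F m k l j g _ _ : clear implicits.
Arguments St_act F m k g _ _ : clear implicits.

(* Main.v *)
Require Import Defs.
From HB Require Import structures.
From mathcomp Require Import all_boot all_order all_algebra all_fingroup.
From mathcomp Require Import generic_quotient ring_quotient.
From mathcomp Require Import boolp classical_sets functions.
From mathcomp.multinomials Require Import freeg.

Set Implicit Arguments.
Unset Strict Implicit.
Unset Printing Implicit Defensive.

Import GRing.Theory Num.Theory.
Local Open Scope classical_set_scope.
Local Open Scope ring_scope.

(* A functional on Delta_V is a function on the flags ending at V that satisfies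
   (FS); the wedge relations push up-steps through a flag and so define a right
   action of S(PG(n-1,q)) on such functions, which computes the standard form.
   The flags from W to V are the cosets gB of GL_m, m = dim W/V, and by the Bruhat
   decomposition the big cell, indexed by U, gives a basis of Delta_V^W.  Its dual
   basis consists of signed apartments, which also form a basis of St(W/V), and
   Gow's form on St is the dot product of functions on flags.  Summing over
   hyperplanes gives sum_L <K, L> [L] = q^(m dim V) [m]_q! [K], hence the Gram
   matrices A of the standard form and G of Gow's form satisfy
   A G = q^(m dim V) [m]_q!, where [m]_q! is the number of full flags in W/V.
   If l does not divide q, the Smith normal form of A matches degree i of the first
   filtration with degree kappa - i of the second; for i = 0 the image in St is the
   socle, since every nonzero submodule contains the unique U-invariant line.
   If q = l^s, then [m]_q! is prime to l and q^(m dim V) divides A, so A is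
   q^(m dim V) times a matrix that is invertible at l. *)

(** [Delta V] is a quotient inside a ring given by generators and relations: spanning statements are
    easy there, independence is not. Everything is therefore detected by functionals, and the
    obstacle is to show that the straightening of up-steps is compatible with (FS), for up-steps
    ([up_up]) and for down-steps ([fs_up]). In the critical case this is a count: of the q + 1
    members of an interval of length two, one contributes q^(d+1) and each of the q others -q^d. The
    complementary degrees i and kappa - i come from A G = c: in Smith bases A is diagonal with
    entries d_t, and G becomes diagonal with entries c/d_t. The same identity makes A equivariant,
    because G is visibly invariant under translation of functions on the group. The natural map x
    |-> xA / l^i lives on lattices. Over k it is replaced by its diagonal part in the Smith bases,
    which is linear on the whole module but commutes with GL only modulo the next step of Gow's
    filtration. This suffices for the graded pieces; in degree 0 there is no error term. *)

Local Notation GLval := Defs.GLval.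

(** * Intervals of length two *)

Section Geometry.
Variables (F : finFieldType) (n : nat).
Implicit Types U V W X Y Z : subsp F n.

Lemma memv_addr U V v : v \in V -> v \in (U + V)%VS.
Proof. exact: (subvP (addvSr _ _)). Qed.

Lemma lessdotP V W : reflect ((V <= W)%VS /\ \dim W = (\dim V).+1) (lessdot V W).
Proof. by apply: (iffP andP) => -[VW /eqP]. Qed.

Lemma lessdot_sub V W : lessdot V W -> (V <= W)%VS.
Proof. by case/lessdotP. Qed.

Lemma lessdot_dim V W : lessdot V W -> \dim W = (\dim V).+1.
Proof. by case/lessdotP. Qed.

Lemma lessdot_neq V W : lessdot V W -> V != W.
Proof. by move=> /lessdot_dim h; apply/eqP => e; move: h; rewrite e => /n_Sn. Qed.

Lemma lessdot_eq V V' W : lessdot V W -> lessdot V' W -> (V <= V')%VS -> V = V'.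
Proof.
move=> /lessdot_dim h /lessdot_dim h' s; apply/eqP; rewrite eqEdim s /=.
by rewrite -ltnS -h -h'.
Qed.

Lemma lessdot_eqr V W W' : lessdot V W -> lessdot V W' -> (W <= W')%VS -> W = W'.
Proof.
move=> /lessdot_dim h /lessdot_dim h' s; apply/eqP; rewrite eqEdim s /=.
by rewrite h h'.
Qed.

Lemma lessdot_add X Z Y : lessdot X Y -> lessdot Z Y -> X != Z -> (X + Z)%VS = Y.
Proof.
move=> hX hZ nXZ; apply/eqP; rewrite eqEdim subv_add !lessdot_sub //=.
have : (X <= X + Z)%VS by apply: addvSl.
rewrite (lessdot_dim hX) => /dimvS.
rewrite leq_eqVlt => /orP [/eqP e|//].
case/eqP: nXZ; apply/esym/(lessdot_eq hZ hX).
have /eqP -> : X == (X + Z)%VS by rewrite eqEdim addvSl e leqnn.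
exact: addvSr.
Qed.

Lemma lessdot_cap X Z Y : lessdot X Y -> lessdot Z Y -> X != Z ->
  lessdot (X :&: Z)%VS Z.
Proof.
move=> hX hZ nXZ; apply/lessdotP; split; first exact: capvSr.
have := dimv_sum_cap X Z.
rewrite (lessdot_add hX hZ nXZ) (lessdot_dim hX).
by rewrite addSn -addnS => /eqP; rewrite eqn_add2l => /eqP <-.
Qed.

Lemma lessdot_capl X Z Y : lessdot X Y -> lessdot Z Y -> X != Z ->
  lessdot (X :&: Z)%VS X.
Proof. by rewrite eq_sym capvC => *; apply: (@lessdot_cap _ _ Y). Qed.

Lemma lessdot_meet X Z Y : lessdot Y X -> lessdot Y Z -> X != Z -> (X :&: Z)%VS = Y.
Proof.
move=> hX hZ nXZ; apply/eqP; rewrite eq_sym eqEdim subv_cap !lessdot_sub //=.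
rewrite -ltnS -(lessdot_dim hX) ltnNge; apply: contra nXZ => h.
have /eqP e : (X :&: Z)%VS == X by rewrite eqEdim capvSl.
by apply/eqP/(lessdot_eqr hX hZ); rewrite -e capvSr.
Qed.

Lemma lessdot_sum X Z Y : lessdot Y X -> lessdot Y Z -> X != Z ->
  lessdot X (X + Z)%VS.
Proof.
move=> hX hZ nXZ; apply/lessdotP; split; first exact: addvSl.
have := dimv_sum_cap X Z; rewrite (lessdot_meet hX hZ nXZ) (lessdot_dim hZ) addnS -addSn => /eqP.
by rewrite eqn_add2r => /eqP.
Qed.

Definition between U W X := lessdot U X && lessdot X W.

Lemma between_line U (a : 'cV[F]_n) : a \notin U -> lessdot U (U + <[a]>)%VS.
Proof.
move=> aU; apply/lessdotP; split; first exact: addvSl.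
have a0 : a != 0 by apply: contraNneq aU => ->; rewrite mem0v.
have e0 : (U :&: <[a]>)%VS = 0%VS.
  apply/eqP; rewrite -subv0; apply/subvP => v; rewrite memv_cap.
  move=> /andP [vU /vlineP [c vc]]; rewrite memv0 vc.
  case: (eqVneq c 0) => [->|c0]; first by rewrite scale0r.
  case/negP: aU; rewrite -[a]scale1r -(mulVf c0) -scalerA -vc.
  exact: memvZ.
by have := dimv_sum_cap U <[a]>; rewrite e0 dimv0 addn0 dim_vline a0 addn1.
Qed.

Lemma lessdot_lineE U X (a : 'cV[F]_n) : lessdot U X -> a \in X -> a \notin U ->
  X = (U + <[a]>)%VS.
Proof.
move=> hX aX aU; apply/esym/(lessdot_eqr (between_line aU) hX).
by rewrite subv_add lessdot_sub //= -memvE.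
Qed.

Lemma lessdot_vec U X : lessdot U X -> exists2 a, a \in X & a \notin U.
Proof.
move=> hX; have /subvPn [a aX aU] : ~~ (X <= U)%VS; last by exists a.
by apply/negP => /dimvS; rewrite (lessdot_dim hX) ltnn.
Qed.

(* The q + 1 points of the projective line W/U, listed by affine coordinate with
   respect to two points a, b; the point at infinity U + <a> comes separately. *)
Lemma big_between (M : zmodType) (f : subsp F n -> M) U W (a b : 'cV[F]_n) :
    lessdot U (U + <[a]>)%VS -> lessdot (U + <[a]>)%VS W -> b \in W ->
    b \notin (U + <[a]>)%VS ->
  \sum_(X | between U W X) f X =
  f (U + <[a]>)%VS + \sum_(c : F) f (U + <[b + c *: a]>)%VS.
Proof.
move=> hUa haW bW bUa; rewrite /between (bigD1 ((U + <[a]>)%VS : subsp F n)) ?hUa //=; congr (_ + _).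
have aU : a \notin U.
  apply/negP => aU; move/lessdot_neq/eqP: hUa; apply.
  by apply/esym/eqP; rewrite eqEsubv addvSl subv_add subvv -memvE aU.
have aW : a \in W by apply: (subvP (lessdot_sub haW)); rewrite memv_addr // memv_line.
have bcNUa c : b + c *: a \notin (U + <[a]>)%VS.
  apply: contra bUa => h; rewrite -[b](addrK (c *: a)) rpredB //.
  by rewrite memvZ // memv_addr // memv_line.
have bcNU c : b + c *: a \notin U.
  by apply: contra (bcNUa c); apply: (subvP (addvSl _ _)).
have bcW c : b + c *: a \in W by rewrite rpredD // memvZ.
pose h c : subsp F n := (U + <[b + c *: a]>)%VS.
have hm c : b + c *: a \in h c by rewrite memv_addr // memv_line.
have hinj : injective h.
  move=> c c' e; apply/eqP; rewrite -subr_eq0; apply: contraNT aU => nz.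
  have : (b + c *: a) - (b + c' *: a) \in (h c :&: (U + <[a]>))%VS.
    rewrite memv_cap; apply/andP; split.
      by rewrite rpredB ?hm // e hm.
    rewrite opprD addrACA subrr add0r -scalerBl memvZ //.
    by rewrite memv_addr // memv_line.
  have nh : h c != (U + <[a]>)%VS by apply: contraNneq (bcNUa c) => <-.
  rewrite (lessdot_meet (between_line (bcNU c)) hUa nh).
  rewrite opprD addrACA subrr add0r -scalerBl => /(memvZ ((c - c')^-1)).
  by rewrite scalerA mulVf // scale1r.
transitivity (\sum_(X in h @: [set: F]%SET) f X); last first.
  by rewrite big_imset /=; [apply: eq_bigl => c; rewrite inE | move=> c c' _ _; apply: hinj].
apply: eq_bigl => X; apply/idP/imsetP => [/andP [/andP [hUX hXW] nXa]|[c _ ->]].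
  have [x xX xU] := lessdot_vec hUX.
  have XE := lessdot_lineE hUX xX xU.
  have : b \in (X + (U + <[a]>))%VS by rewrite (lessdot_add hXW haW nXa).
  rewrite XE -addvA (addvA _ U) (addvC _ U) addvA addvA addvv -addvA.
  move=> /memv_addP [u uU [y /memv_addP [x' /vlineP [s ->] [a' /vlineP [t ->] ->]] e]].
  have s0 : s != 0.
    apply: contraNneq bUa => s0; rewrite e s0 scale0r add0r memv_add //.
    by rewrite memvZ // memv_line.
  exists (- t) => //; rewrite /h -XE; apply: (lessdot_lineE hUX); last exact: bcNU.
  rewrite e scaleNr -addrA -addrA subrr addr0 rpredD ?memvZ //.
  exact: (subvP (lessdot_sub hUX)).
rewrite between_line ?bcNU //=; apply/andP; split; last first.
  by apply: contraNneq (bcNUa c) => <-; rewrite memv_addr // memv_line.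
apply/lessdotP; split.
  rewrite subv_add -memvE bcW andbT; apply: subv_trans (lessdot_sub haW).
  exact: addvSl.
by rewrite (lessdot_dim haW) (lessdot_dim hUa) (lessdot_dim (between_line (bcNU c))).
Qed.

Lemma between_vecs U W : (U <= W)%VS -> \dim W = (\dim U).+2 ->
  exists a b : 'cV[F]_n, [/\ lessdot U (U + <[a]>)%VS, lessdot (U + <[a]>)%VS W,
    b \in W & b \notin (U + <[a]>)%VS].
Proof.
move=> UW dW.
have /subvPn [a aW aU] : ~~ (W <= U)%VS.
  by apply/negP => /dimvS; rewrite dW ltnNge leqnSn.
have hUa := between_line aU.
have UaW : (U + <[a]> <= W)%VS by rewrite subv_add UW -memvE.
have /subvPn [b bW bUa] : ~~ (W <= U + <[a]>)%VS.
  by apply/negP => /dimvS; rewrite dW (lessdot_dim hUa) ltnn.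
by exists a, b; split=> //; apply/lessdotP; rewrite dW (lessdot_dim hUa).
Qed.

Lemma card_between U W : (U <= W)%VS -> \dim W = (\dim U).+2 ->
  #|[pred X | between U W X]| = #|F|.+1.
Proof.
move=> UW dW; have [a [b [h1 h2 h3 h4]]] := between_vecs UW dW.
have := @big_between int (fun=> 1) U W a b h1 h2 h3 h4.
have -> : \sum_(X | between U W X) 1 = #|[pred X | between U W X]|%:R :> int.
  by rewrite -sum1_card natr_sum; apply: eq_bigl => X; rewrite inE.
rewrite sumr_const => /eqP.
by rewrite -[X in X + _]/(1%:R) -natrD eqr_nat add1n => /eqP.
Qed.

Lemma card_between_neq U W H : between U W H -> 
  #|[pred X | between U W X && (X != H)]| = #|F|.
Proof.
move=> bH; have [h1 h2] := andP bH.
have := @card_between U W; rewrite (cardD1 H) !inE bH.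
rewrite (subv_trans (lessdot_sub h1)) ?lessdot_sub // (lessdot_dim h2) (lessdot_dim h1).
move=> /(_ erefl erefl) [<-]; apply: eq_card => X; rewrite !inE; exact: andbC.
Qed.

Lemma lessdot_trace U W H : (U <= W)%VS -> lessdot H W -> ~~ (U <= H)%VS ->
  lessdot (U :&: H)%VS U.
Proof.
move=> UW hH nUH; apply/lessdotP; split; first exact: capvSl.
have e : (U + H)%VS = W.
  apply/eqP; rewrite eqEdim subv_add UW lessdot_sub //=.
  rewrite (lessdot_dim hH) ltnNge; apply: contra nUH => h.
  have /eqP -> : H == (U + H)%VS by rewrite eqEdim addvSr h.
  exact: addvSl.
have := dimv_sum_cap U H; rewrite e (lessdot_dim hH) addSn => /eqP.
by rewrite -addnS addnC eqn_add2r => /eqP.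
Qed.

(* H' is a hyperplane of W not containing U: the planes X through U correspond to
   their traces on H'. *)
Lemma big_trace (M : zmodType) (f : subsp F n -> M) U W H' :
    (U <= W)%VS -> \dim W = (\dim U).+2 -> lessdot H' W -> ~~ (U <= H')%VS ->
  \sum_(Y | between (U :&: H')%VS H' Y) f Y =
  \sum_(X | between U W X) f (X :&: H')%VS.
Proof.
move=> UW dW hH nUH.
have hcapU := lessdot_trace UW hH nUH; have dUH := lessdot_dim hcapU.
have dH : \dim H' = (\dim (U :&: H')).+2.
  by move: dW; rewrite (lessdot_dim hH) dUH => -[].
have nXH X : between U W X -> X != H'.
  by move=> /andP [h _]; apply: contraNneq nUH => <-; apply: lessdot_sub.
have bX X : between U W X -> between (U :&: H')%VS H' (X :&: H')%VS.
  move=> hX; have [h1 h2] := andP hX; apply/andP; split; last first.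
    exact: (lessdot_cap h2 hH (nXH _ hX)).
  apply/lessdotP; split; first by rewrite capvS // lessdot_sub.
  have := lessdot_dim (lessdot_cap h2 hH (nXH _ hX)); rewrite dH => -[<-] //.
have bY Y : between (U :&: H')%VS H' Y -> between U W (Y + U)%VS.
  move=> /andP [h1 h2].
  have nYU : U != Y by apply: contraNneq nUH => ->; apply: lessdot_sub.
  rewrite /between addvC (lessdot_sum hcapU h1 nYU); apply/lessdotP; split.
    rewrite subv_add UW; apply: subv_trans (lessdot_sub h2) (lessdot_sub hH).
  by rewrite dW (lessdot_dim (lessdot_sum hcapU h1 nYU)).
have capK Y : between (U :&: H')%VS H' Y -> ((Y + U) :&: H')%VS = Y.
  move=> hY; have [h1 h2] := andP hY; have [h3 h4] := andP (bY _ hY).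
  apply/esym/(lessdot_eq h2); first exact: (lessdot_cap h4 hH (nXH _ (bY _ hY))).
  by rewrite subv_cap addvSl lessdot_sub.
have addK X : between U W X -> (X :&: H' + U)%VS = X.
  move=> hX; have [h1 h2] := andP hX; have [h3 h4] := andP (bY _ (bX _ hX)).
  by apply/(lessdot_eqr h3 h1); rewrite subv_add capvSl lessdot_sub.
rewrite [RHS](reindex_onto (fun Y : subsp F n => (Y + U)%VS : subsp F n)
  (fun X : subsp F n => (X :&: H')%VS : subsp F n)) /=; last exact: addK.
apply: eq_big => [Y|Y hY]; last by rewrite capK.
apply/idP/andP => [hY|[hY /eqP <-]]; last exact: bX.
by rewrite bY // capK.
Qed.

End Geometry.

(** * Functionals on the standard modules *)

Section Transport.
Variables (F : finFieldType) (n : nat) (V : subsp F n).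
Implicit Types U W X Y Z : subsp F n.
Implicit Types K L s : seq (subsp F n).
Implicit Types f g : seq (subsp F n) -> int.

(* The value of f on the product (X < Y)K, Y = head K: the wedge relations move the
   up-step to the right until it cancels. *)
Fixpoint up K X f : int :=
  match K with
  | Y :: ((Z :: K2) as K') =>
      if lessdot X Y && lessdot Z Y then
        if Z == X then (#|F| ^ \dim X)%:Z * f (X :: K2)
        else - up K' (X :&: Z)%VS (fun L => f (X :: L))
      else 0
  | _ => 0
  end.

Lemma up_cons Y Z K X f : up (Y :: Z :: K) X f =
  if lessdot X Y && lessdot Z Y then
    if Z == X then (#|F| ^ \dim X)%:Z * f (X :: K)
    else - up (Z :: K) (X :&: Z)%VS (fun L => f (X :: L))
  else 0.
Proof. by []. Qed.

Arguments up : simpl never.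

Lemma up_ext K X f g : (forall L, f (X :: L) = g (X :: L)) -> up K X f = up K X g.
Proof.
elim: K X f g => [|Y [|Z K] IH] X f g e //; rewrite !up_cons.
case: ifP => // _; case: ifP => _; first by rewrite e.
by congr (- _); apply: IH => L; apply: e.
Qed.

Lemma up_sum (I : Type) (r : seq I) (P : pred I) (f : I -> seq (subsp F n) -> int) K X :
  up K X (fun L => \sum_(i <- r | P i) f i L) = \sum_(i <- r | P i) up K X (f i).
Proof.
elim: K X f => [|Y [|Z K] IH] X f; [by rewrite big1|by rewrite big1|].
rewrite up_cons; under [RHS]eq_bigr do rewrite up_cons.
case: ifP => _; last by rewrite big1.
by case: ifP => _; [rewrite mulr_sumr | rewrite IH sumrN].
Qed.

Lemma up_scale c K X f : up K X (fun L => c * f L) = c * up K X f.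
Proof.
elim: K X f => [|Y [|Z K] IH] X f; [by rewrite mulr0|by rewrite mulr0|].
rewrite !up_cons; case: ifP => _; last by rewrite mulr0.
by case: ifP => _; [rewrite mulrCA | rewrite IH mulrN].
Qed.

Lemma up0 K X : up K X (fun=> 0) = 0.
Proof. by have := up_scale 0 K X (fun=> 0); rewrite !mul0r. Qed.

Lemma capv_trace U X H : between U H X -> forall H', lessdot H' H -> (U <= H')%VS ->
  X != H' -> (X :&: H')%VS = U.
Proof.
move=> /andP [h1 h2] H' hH UH nXH; apply: (lessdot_meet h1 _ nXH).
apply/lessdotP; split=> //.
by have := lessdot_dim h2; rewrite (lessdot_dim hH) (lessdot_dim h1) => -[].
Qed.

Lemma between_mem U W H : (U <= W)%VS -> \dim W = (\dim U).+2 -> lessdot H W ->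
  (U <= H)%VS -> between U W H.
Proof.
move=> UW dW hH UH; rewrite /between hH andbT; apply/lessdotP; split=> //.
by move: (lessdot_dim hH); rewrite dW => -[].
Qed.

(** (FS) for up-steps. If the next member H of the flag contains U, then H is itself one of the X:
    its term carries q^(dim U + 1), and each of the q others carries -q^(dim U). Otherwise X |-> X
    :&: H identifies the interval with [U :&: H, H], and the sum reappears one step further down. *)
Lemma up_up U W K f : (U <= W)%VS -> \dim W = (\dim U).+2 ->
  \sum_(X | between U W X) up (W :: K) X (fun L => up L U f) = 0.
Proof.
elim: K U W f => [|H K IH] U W f UW dW; first by rewrite big1.
have [hH|nH] := boolP (lessdot H W); last first.
  by rewrite big1 // => X _; rewrite up_cons (negPf nH) andbF.
have [UH|nUH] := boolP (U <= H)%VS.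
  have bH := between_mem UW dW hH UH.
  rewrite (bigD1 H) //= up_cons hH eqxx /=.
  rewrite (eq_bigr (fun=> - ((#|F| ^ \dim U)%:Z * up (H :: K) U f))).
    rewrite sumr_const card_between_neq // mulNrn (lessdot_dim (proj1 (andP bH))).
    by rewrite expnSr PoszM -mulrA mulrCA -mulr_natl natz subrr.
  move=> X /andP [bX nXH]; have [h1 h2] := andP bX.
  rewrite up_cons h2 hH eq_sym (negPf nXH) (capv_trace bX hH UH nXH) -up_scale.
  by congr (- _); apply: up_ext => L; rewrite up_cons h1 eqxx.
have nXH X : between U W X -> (H == X) = false.
  by move=> /andP [h _]; apply: contraNF nUH => /eqP ->; apply: lessdot_sub.
have key X : between U W X -> 
    up (W :: H :: K) X (fun L => up L U f)
  = up (H :: K) (X :&: H)%VS (fun L => up L (U :&: H)%VS (fun L => f (U :: L))).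
  move=> bX; have [h1 h2] := andP bX; rewrite up_cons h2 hH nXH //=.
  rewrite -mulN1r -up_scale; apply: up_ext => L; rewrite up_cons h1.
  have -> : lessdot (X :&: H)%VS X by apply: (lessdot_capl h2 hH); rewrite eq_sym nXH.
  rewrite ifN; last by apply: contraNneq nUH => <-; apply: capvSr.
  by rewrite mulN1r opprK capvA (capv_idPl (lessdot_sub h1)).
have H' := big_trace (fun Y => up (H :: K) Y (fun L => up L (U :&: H)%VS (fun L => f (U :: L)))) UW dW hH nUH.
rewrite (eq_bigr _ key) -H' IH ?capvSr //.
move: dW; rewrite (lessdot_dim hH) (lessdot_dim (lessdot_trace UW hH nUH)).
by case.
Qed.

Definition flag_supp f := forall K, f K != 0 -> is_flag_to V K.

Definition fs_fun (M : zmodType) (f : seq (subsp F n) -> M) :=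
  forall s1 Y U s2, (U <= Y)%VS -> \dim Y = (\dim U).+2 ->
  \sum_(X | between U Y X) f (s1 ++ Y :: X :: U :: s2) = 0.

Definition good f := flag_supp f /\ fs_fun f.

Lemma flag_cons X Y K :
  is_flag_to V (X :: Y :: K) = lessdot Y X && is_flag_to V (Y :: K).
Proof. by rewrite /= andbA. Qed.

Lemma flag_supp_up K X f : (forall L, f (X :: L) != 0 -> is_flag_to V (X :: L)) ->
  up K X f != 0 -> is_flag_to V K.
Proof.
elim: K X f => [|Y [|Z K] IH] X f hf; [by rewrite eqxx|by rewrite eqxx|].
rewrite up_cons flag_cons.
case: ifP => [/andP [hXY hZY]|_]; last by rewrite eqxx.
rewrite hZY /=; case: (eqVneq Z X) => [->|nZX] h.
  by apply: (hf K); apply: contraNneq h => ->; rewrite mulr0.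
apply: (IH (X :&: Z)%VS (fun L => f (X :: L))); last by rewrite -oppr_eq0.
by move=> L /hf; rewrite flag_cons => /andP [].
Qed.

(** The essential case is the arrival of the up-step at Y. If X contains U, then X is one of the Z
    and the count of [up_up] recurs; otherwise the traces Z :&: X turn the sum into an instance of
    (FS) for f on [U :&: X, X]. *)
Lemma fs_up K0 Y U s2 X f : fs_fun f -> (U <= Y)%VS -> \dim Y = (\dim U).+2 ->
  \sum_(Z | between U Y Z) up (K0 ++ Y :: Z :: U :: s2) X f = 0.
Proof.
move=> hf UY dY; elim: K0 X f hf => [|a [|b K0] IH] X f hf /=.
- have [hX|nX] := boolP (lessdot X Y); last first.
    by rewrite big1 // => Z _; rewrite up_cons (negPf nX).
  have [UX|nUX] := boolP (U <= X)%VS.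
    have bX := between_mem UY dY hX UX; have [b1 b2] := andP bX.
    rewrite (bigD1 X) //= up_cons hX eqxx /=.
    rewrite (eq_bigr (fun=> - ((#|F| ^ \dim U)%:Z * f (X :: U :: s2)))).
      rewrite sumr_const card_between_neq // mulNrn (lessdot_dim b1).
      by rewrite expnSr PoszM -mulrA mulrCA -mulr_natl natz subrr.
    move=> Z /andP [bZ nZX]; have [h1 h2] := andP bZ.
    rewrite up_cons hX h2 (negPf nZX) up_cons /=; congr (- _).
    have -> : (X :&: Z)%VS = U by rewrite capvC (capv_trace bZ hX UX nZX).
    by rewrite h1 eqxx.
  have key Z : between U Y Z -> up [:: Y, Z, U & s2] X f =
      up (U :: s2) (U :&: X)%VS (fun L => f (X :: (Z :&: X)%VS :: L)).
    move=> bZ; have [h1 h2] := andP bZ.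
    have nZX : Z != X by apply: contraNneq nUX => <-; apply: lessdot_sub.
    rewrite up_cons hX h2 (negPf nZX) /= up_cons h1 (capvC X Z).
    rewrite (lessdot_capl h2 hX nZX) /=.
    rewrite ifN; last by apply: contraNneq nUX => ->; apply: capvSr.
    by rewrite opprK -capvA (capvC X U) capvA (capvC Z U) (capv_idPl (lessdot_sub h1)).
  rewrite (eq_bigr _ key) -up_sum -[RHS](up0 (U :: s2) (U :&: X)%VS).
  apply: up_ext => L.
  have := big_trace (fun Y' => f (X :: Y' :: (U :&: X)%VS :: L)) UY dY hX nUX.
  move=> <-; apply: (hf [::]); first exact: capvSr.
  move: dY; rewrite (lessdot_dim hX) (lessdot_dim (lessdot_trace UY hX nUX)).
  by case.
- case hc: (lessdot X a && lessdot Y a); last by rewrite big1 // => Z _; rewrite up_cons hc.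
  case: (eqVneq Y X) => [e|nYX].
    rewrite (eq_bigr (fun Z => (#|F| ^ \dim X)%:Z * f (X :: Z :: U :: s2))).
      by rewrite -mulr_sumr -e (hf [::] Y U s2) // mulr0.
    by move=> Z _; rewrite up_cons hc e eqxx.
  rewrite (eq_bigr (fun Z => - up [:: Y, Z, U & s2] (X :&: Y)%VS (fun L => f (X :: L)))).
    by rewrite sumrN (IH _ (fun L => f (X :: L))) ?oppr0 // => s1; apply: (hf (X :: s1)).
  by move=> Z _; rewrite up_cons hc (negPf nYX).
- case hc: (lessdot X a && lessdot b a); last by rewrite big1 // => Z _; rewrite up_cons hc.
  case: (eqVneq b X) => [e|nbX].
    rewrite (eq_bigr (fun Z => (#|F| ^ \dim X)%:Z * f (X :: K0 ++ [:: Y, Z, U & s2]))).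
      by rewrite -mulr_sumr (hf (X :: K0) Y U s2) // mulr0.
    by move=> Z _; rewrite up_cons hc e eqxx.
  rewrite (eq_bigr (fun Z => - up (b :: K0 ++ [:: Y, Z, U & s2]) (X :&: b)%VS (fun L => f (X :: L)))).
    rewrite sumrN; have := IH (X :&: b)%VS (fun L => f (X :: L)).
    by move=> /= ->; rewrite ?oppr0 // => s1; apply: (hf (X :: s1)).
  by move=> Z _; rewrite up_cons hc (negPf nbX).
Qed.

(** The right action of a single step: K goes to f((X, Y)K), where a down-step is prepended to K and
    an up-step is pushed through K. *)
Definition op X Y f K : int :=
  if K is Z :: _ then
    if Z == Y then
      if lessdot Y X then f (X :: K) else if lessdot X Y then up K X f else 0
    else 0
  else 0.

Arguments op : simpl never.

Lemma good_op X Y f : good f -> good (op X Y f).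
Proof.
move=> [hs hf]; split=> [[|Z K]|s1 Y' U s2 UY dY]; rewrite /op ?eqxx //.
  case: ifP => [_|_]; last by rewrite eqxx.
  case: ifP => [h|_]; first by move=> /hs; rewrite flag_cons => /andP [].
  case: ifP => [_|_]; last by rewrite eqxx.
  by apply: flag_supp_up => L; apply: hs.
have key (g : seq (subsp F n) -> int) :
    (forall s1, \sum_(Z | between U Y' Z) g (s1 ++ Y' :: Z :: U :: s2) = 0) ->
    \sum_(Z | between U Y' Z)
      match s1 ++ Y' :: Z :: U :: s2 with
      | [::] => 0
      | Z0 :: _ => if Z0 == Y then g (s1 ++ Y' :: Z :: U :: s2) else 0
      end = 0.
  move=> hg; case: s1 => [|a s1] /=.
    by case: (Y' == Y); [apply: (hg [::]) | rewrite big1].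
  by case: (a == Y); [apply: (hg (a :: s1)) | rewrite big1].
apply: (key (fun K => if lessdot Y X then f (X :: K) else if lessdot X Y then up K X f else 0)).
move=> s; case: (lessdot Y X); first exact: (hf (X :: s)).
by case: (lessdot X Y); [apply: fs_up | rewrite big1].
Qed.

Definition restr X f K : int :=
  if K is Z :: _ then if Z == X then f K else 0 else 0.

Lemma good_restr X f : good f -> good (restr X f).
Proof.
move=> [hs hf]; split=> [[|Z K]|s1 Y' U s2 UY dY]; rewrite /restr ?eqxx //.
  by case: ifP => [_|_]; [apply: hs | rewrite eqxx].
case: s1 => [|a s1] /=.
  by case: (Y' == X); [apply: (hf [::]) | rewrite big1].
by case: (a == X); [apply: (hf (a :: s1)) | rewrite big1].
Qed.

Fixpoint rstep X t f := if t is Y :: t' then rstep Y t' (op X Y f) else f.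

(** This is K |-> f(sK). The initial [restr] is the idempotent at the head of s, so that one-term
    paths act correctly too. *)
Definition pact s f K : int := if s is X :: t then rstep X t (restr X f) K else 0.

Lemma good_rstep X t f : good f -> good (rstep X t f).
Proof. by elim: t X f => //= Y t IH X f hf; apply/IH/good_op. Qed.

Lemma good_pact s f : good f -> good (pact s f).
Proof.
case: s => [|X t] hf; last exact/good_rstep/good_restr.
by split=> [K|s1 Y U s2 _ _]; rewrite /pact ?eqxx // big1.
Qed.

End Transport.

Arguments up : simpl never.
Arguments op : simpl never.

(** * The action of paths and the functionals it defines *)

Section Functional.
Variables (F : finFieldType) (n : nat) (V : subsp F n).
Implicit Types U W X Y Z : subsp F n.
Implicit Types K L s p q t : seq (subsp F n).
Implicit Types f g : seq (subsp F n) -> int.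

Lemma lessdot_asym X Y : lessdot X Y -> lessdot Y X = false.
Proof.
move=> h; apply/negP => h'; have := lessdot_dim h; rewrite (lessdot_dim h').
by move/eqP; rewrite -addn2 -[X in X == _]addn0 eqn_add2l.
Qed.

Lemma op_up X Y g K : lessdot X Y -> op X Y g (Y :: K) = up (Y :: K) X g.
Proof. by move=> h; rewrite /op eqxx (lessdot_asym h) h. Qed.

Lemma op_down X Y g K : lessdot Y X -> op X Y g (Y :: K) = g (X :: Y :: K).
Proof. by move=> h; rewrite /op eqxx h. Qed.

Lemma op_sum (I : Type) (r : seq I) (P : pred I) (f : I -> seq (subsp F n) -> int) X Y :
  op X Y (fun L => \sum_(i <- r | P i) f i L) =
  (fun L => \sum_(i <- r | P i) op X Y (f i) L).
Proof.
apply: funext => -[|Z K]; rewrite /op; first by rewrite big1.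
case: (Z == Y); last by rewrite big1.
case: (lessdot Y X) => //.
by case: (lessdot X Y); [rewrite up_sum | rewrite big1].
Qed.

Lemma rstep_sum (I : Type) (r : seq I) (P : pred I) (f : I -> seq (subsp F n) -> int) X t :
  rstep X t (fun L => \sum_(i <- r | P i) f i L) =
  (fun L => \sum_(i <- r | P i) rstep X t (f i) L).
Proof. by elim: t X f => //= Y t IH X f; rewrite op_sum IH. Qed.

Lemma pact_sum (I : Type) (r : seq I) (P : pred I) (f : I -> seq (subsp F n) -> int) s :
  pact s (fun L => \sum_(i <- r | P i) f i L) =
  (fun L => \sum_(i <- r | P i) pact s (f i) L).
Proof.
apply: funext => K; rewrite /pact; case: s => [|X t]; first by rewrite big1.
have -> : restr X (fun L => \sum_(i <- r | P i) f i L) =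
    (fun L => \sum_(i <- r | P i) restr X (f i) L).
  apply: funext => -[|Z L]; rewrite /restr; first by rewrite big1.
  by case: (Z == X); rewrite // big1.
by rewrite rstep_sum.
Qed.

Lemma pact_scale c f s : pact s (fun L => c * f L) = (fun L => c * pact s f L).
Proof.
have op_sc X Y g : op X Y (fun L => c * g L) = (fun L => c * op X Y g L).
  apply: funext => -[|Z K]; rewrite /op ?mulr0 //.
  by case: ifP => _; rewrite ?mulr0 //; do 2?case: ifP => _; rewrite ?mulr0 ?up_scale.
have rs X t g : rstep X t (fun L => c * g L) = (fun L => c * rstep X t g L).
  by elim: t X g => //= Y t IH X g; rewrite op_sc IH.
apply: funext => K; rewrite /pact; case: s => [|X t]; rewrite ?mulr0 //.
rewrite -[RHS]/((fun K => c * rstep X t (restr X f) K) K) -rs.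
congr (rstep _ _ _ _); apply: funext => -[|Z L]; rewrite /restr ?mulr0 //.
by case: ifP; rewrite ?mulr0.
Qed.

Lemma rstep0 X t : rstep X t (fun=> 0 : int) = (fun=> 0).
Proof.
elim: t X => //= Y t IH X; rewrite (_ : op X Y _ = fun=> 0) //.
apply: funext => -[|Z K] //; rewrite /op up0.
by case: (Z == Y); case: (lessdot Y X); case: (lessdot X Y).
Qed.

Lemma restr0 X : restr X (fun=> 0 : int) = (fun=> 0).
Proof. by apply: funext => -[|Z L] //=; case: (Z == X). Qed.

Lemma pact0 s : pact s (fun=> 0 : int) = (fun=> 0).
Proof. by apply: funext => K; case: s => // X t; rewrite /pact restr0 rstep0. Qed.

Lemma rstep_cat X t1 t2 f : rstep X (t1 ++ t2) f = rstep (last X t1) t2 (rstep X t1 f).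
Proof. by elim: t1 X f => //=. Qed.

Lemma restr_id X f : restr X (restr X f) = restr X f.
Proof. by apply: funext => -[|Z L] //=; case: (Z == _). Qed.

Lemma restr_op X Y f : restr Y (op X Y f) = op X Y f.
Proof. by apply: funext => -[|Z L] //=; rewrite /op; case: (Z == _). Qed.

Lemma restr_rstep X t f : restr X f = f -> restr (last X t) (rstep X t f) = rstep X t f.
Proof. by elim: t X f => //= Y t IH X f h; apply: IH; apply: restr_op. Qed.

Lemma restr_neq X Y f : restr X f = f -> X != Y -> restr Y f = (fun=> 0).
Proof.
move=> <- nXY; apply: funext => -[|Z L] //=; case: (eqVneq Z Y) => // ->.
by rewrite eq_sym (negPf nXY).
Qed.

Lemma restr_pact s f : is_flagpath s -> restr (last 0%VS s) (pact s f) = pact s f.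
Proof.
case: s => // X t _; rewrite /pact /=; apply: restr_rstep; exact: restr_id.
Qed.

Lemma pact_concat p q f : is_flagpath p -> is_flagpath q ->
  pact q (pact p f) =
  if last 0%VS p == head 0%VS q then pact (p ++ behead q) f else (fun=> 0).
Proof.
case: q => // Y t hp _ /=; have hr := restr_pact f hp.
case: eqP => [e|/eqP ne].
  move: hr; rewrite e; case: p hp e => // X s _ /= e hr.
  by apply: funext => K; rewrite /pact /= rstep_cat e -[in LHS]/(pact (X :: s) f) hr.
apply: funext => K.
by rewrite -[LHS]/(rstep Y t (restr Y (pact p f)) K) (restr_neq hr ne) rstep0.
Qed.

(* Lam, LamS and lam are the functional with values f on flags, successively on path
   algebra elements, on S and on Delta_V. *)
Definition Lam f (x : path_alg F n) : int^o :=
  fglift (fun p : flagpath F n => pact p f [:: V] : int^o) x.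

Lemma LamB f x y : Lam f (x - y) = Lam f x - Lam f y.
Proof. exact: raddfB. Qed.

Lemma LamD f x y : Lam f (x + y) = Lam f x + Lam f y.
Proof. exact: raddfD. Qed.

Lemma Lam0 f : Lam f 0 = 0.
Proof. exact: raddf0. Qed.

Lemma Lam_sum f (I : finType) (P : pred I) (g : I -> path_alg F n) :
  Lam f (\sum_(i | P i) g i) = \sum_(i | P i) Lam f (g i).
Proof. exact: raddf_sum. Qed.

Lemma Lam_bpath f s : is_flagpath s -> Lam f (bpath s) = pact s f [:: V].
Proof. by move=> hs; rewrite /Lam /bpath insubT /= liftU scale1r. Qed.

Lemma Lam_mul f p x : is_flagpath p -> Lam f (bpath p * x) = Lam (pact p f) x.
Proof.
move=> hp; elim/path_alg_ind: x => [|x y IH IH'|[q hq]].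
- by rewrite mulr0 !Lam0.
- by rewrite mulrBr !LamB IH IH'.
rewrite [_ * _]path_mul_basis // Lam_bpath // pact_concat // /concat.
case: ifP => pq; last by rewrite Lam0.
by have [h _ _] := concat_path hp hq pq; rewrite Lam_bpath.
Qed.

Lemma path3 X Y Z : lessdot X Y || gtrdot X Y -> lessdot Y Z || gtrdot Y Z ->
  is_flagpath [:: X; Y; Z].
Proof. by move=> h1 h2; rewrite /= h1 h2. Qed.

Lemma pact3_up U X W g K : lessdot U X -> lessdot X W ->
  pact [:: U; X; W] g (W :: K) = up (W :: K) X (fun L => up L U g).
Proof.
move=> h1 h2; rewrite /pact /= op_up //; apply: up_ext => L.
by rewrite op_up //; apply: up_ext => L'; rewrite /restr eqxx.
Qed.

Lemma pact_head s g Y Z K : is_flagpath s -> last 0%VS s = Z -> Y != Z ->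
  pact s g (Y :: K) = 0.
Proof.
by move=> hs hl nYZ; rewrite -(restr_pact g hs) hl /= (negPf nYZ).
Qed.

Lemma pact_nil s g : is_flagpath s -> pact s g [::] = 0.
Proof. by move=> hs; rewrite -(restr_pact g hs). Qed.

(** The factor q acts after the relation, so it suffices that r sends g to the zero function. For
    the two (FS) relations this is [up_up] and the second half of [good]; the wedge relations are
    the two branches in the definition of [up]. *)
Lemma rel_kill g (r : path_alg F n) q : good V g -> PG_rel r -> is_flagpath q ->
  Lam g (r * bpath q) = 0.
Proof.
move=> hg; case=> {r} [U W UW dW|U W UW dW|U W hUW|U W U' hUW hWU' nUU'] hq.
- rewrite mulr_suml Lam_sum (eq_bigr (fun X => pact q (pact [:: U; X; W] g) [:: V])).
    rewrite -[LHS]/((fun L => \sum_(X | between U W X) pact q (pact [:: U; X; W] g) L) [:: V]).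
    rewrite -pact_sum (_ : (fun L => _) = (fun=> 0)) ?pact0 //.
    apply: funext => -[|Y K].
      by rewrite big1 // => X /andP [h1 h2]; rewrite pact_nil // path3 ?h1 ?h2.
    case: (eqVneq Y W) => [->|nYW]; last first.
      rewrite big1 // => X /andP [h1 h2].
      by apply: pact_head nYW; rewrite ?path3 ?h1 ?h2.
    rewrite -[RHS](up_up K g UW dW); apply: eq_bigr => X /andP [h1 h2].
    exact: pact3_up.
  move=> X /andP [h1 h2].
  have h : is_flagpath [:: U; X; W] by rewrite path3 ?h1 ?h2.
  by rewrite Lam_mul // Lam_bpath.
- rewrite mulr_suml Lam_sum (eq_bigr (fun X => pact q (pact [:: W; X; U] g) [:: V])).
    rewrite -[LHS]/((fun L => \sum_(X | between U W X) pact q (pact [:: W; X; U] g) L) [:: V]).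
    rewrite -pact_sum (_ : (fun L => _) = (fun=> 0)) ?pact0 //.
    apply: funext => -[|Y K].
      by rewrite big1.
    case: (eqVneq Y U) => [->|nYW]; last first.
      rewrite big1 // => X /andP [h1 h2].
      by apply: pact_head nYW; rewrite ?path3 /gtrdot ?h1 ?h2 ?orbT.
    rewrite -[RHS](hg.2 [::] W U K UW dW); apply: eq_bigr => X /andP [h1 h2].
    by rewrite /pact /= !op_down //= eqxx.
  move=> X /andP [h1 h2].
  have h : is_flagpath [:: W; X; U] by rewrite path3 /gtrdot ?h1 ?h2 ?orbT.
  by rewrite Lam_mul // Lam_bpath.
- have h : is_flagpath [:: U; W; U] by rewrite path3 /gtrdot ?hUW ?orbT.
  rewrite mulrBl mulrnAl LamB.
  have -> : Lam g (bpath [:: U] * bpath q *+ (#|F| ^ \dim U)) =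
      Lam g (bpath [:: U] * bpath q) *+ (#|F| ^ \dim U) by exact: raddfMn.
  rewrite !Lam_mul // !Lam_bpath //.
  have -> : pact [:: U; W; U] g = (fun L => (#|F| ^ \dim U)%:Z * pact [:: U] g L).
    apply: funext => -[|Y K]; first by rewrite !pact_nil // mulr0.
    case: (eqVneq Y U) => [->|nYU]; last first.
      by rewrite !(@pact_head _ _ _ U) // mulr0.
    by rewrite /pact /= op_down // op_up // up_cons hUW eqxx /= eqxx.
  by rewrite (pact_scale _ (pact [:: U] g)) -mulr_natl natz subrr.
- have hWU : lessdot U' W := hWU'.
  have h1 : lessdot (U :&: U')%VS U by apply: (lessdot_capl hUW hWU').
  have h2 : lessdot (U :&: U')%VS U' by apply: (lessdot_cap hUW hWU').
  have hp1 : is_flagpath [:: U; W; U'] by rewrite path3 /gtrdot ?hUW ?hWU ?orbT.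
  have hp2 : is_flagpath [:: U; (U :&: U')%VS : subsp F n; U'].
    by rewrite path3 /gtrdot ?h1 ?h2 ?orbT.
  rewrite mulrDl LamD !Lam_mul // !Lam_bpath //.
  have -> : pact [:: U; W; U'] g =
      (fun L => -1 * pact [:: U; (U :&: U')%VS : subsp F n; U'] g L).
    apply: funext => -[|Y K]; first by rewrite !pact_nil // mulr0.
    case: (eqVneq Y U') => [->|nYU]; last first.
      by rewrite !(@pact_head _ _ _ U') // mulr0.
    rewrite /pact /= op_down // [in RHS]op_up // op_up // up_cons hUW hWU.
    rewrite eq_sym (negPf nUU') mulN1r /=; congr (- _); apply: up_ext => L.
    by rewrite op_down.
  by rewrite (pact_scale _ (pact [:: U; _; U'] g)) mulN1r addNr.
Qed.

Lemma Lam_rel f (a r b : path_alg F n) : good V f -> PG_rel r -> Lam f (a * r * b) = 0.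
Proof.
move=> hf hr; elim/path_alg_ind: a => [|x y IH IH'|[p hp]].
- by rewrite !mul0r Lam0.
- by rewrite !mulrBl LamB IH IH' subrr.
rewrite -mulrA Lam_mul //.
elim/path_alg_ind: b => [|x y IH IH'|[q hq]].
- by rewrite mulr0 Lam0.
- by rewrite !mulrBr LamB IH IH' subrr.
by apply: rel_kill => //; apply: good_pact.
Qed.

Lemma Lam_ideal f x : good V f -> x \in ideal_gen (@PG_rel F n) -> Lam f x = 0.
Proof.
move=> hf /asboolP; elim=> [|y z [a [r [b [hr ->]]]] _ IH|y z [a [r [b [hr ->]]]] _ IH].
- exact: Lam0.
- by rewrite LamD IH Lam_rel // addr0.
- by rewrite LamB IH Lam_rel // subr0.
Qed.

Definition LamS f (s : PGalg F n) : int^o := Lam f (repr s).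

Lemma LamS_class f x : good V f -> LamS f (rclass (@PG_rel F n) x) = Lam f x.
Proof.
move=> hf; apply/eqP; rewrite -subr_eq0 -LamB; apply/eqP/Lam_ideal => //.
by rewrite -rclass_eq /rclass reprK.
Qed.

Lemma LamSB f (a b : PGalg F n) : good V f -> LamS f (a - b) = LamS f a - LamS f b.
Proof.
move=> hf; case: (rclassP a) => x ->; case: (rclassP b) => y ->.
by rewrite -raddfB !LamS_class // LamB.
Qed.

Lemma LamS0 f : good V f -> LamS f 0 = 0.
Proof. by move=> hf; rewrite -[0](subrr 0) LamSB // subrr. Qed.

Lemma LamS_spath f s : good V f -> is_flagpath s -> LamS f (spath s) = pact s f [:: V].
Proof. by move=> hf hs; rewrite LamS_class // Lam_bpath. Qed.

Lemma flag_sub U K : is_flag_to V (U :: K) -> (V <= U)%VS.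
Proof.
elim: K U => [|Y K IH] U; first by move=> /= /eqP ->.
by rewrite flag_cons => /andP [/lessdot_sub h /IH]; move/subv_trans; apply.
Qed.

(** Once the path has reached U, the function is supported on flags from U down to V, and these
    exist only if U contains V. *)
Lemma pact_bad f s : good V f -> is_flagpath s ->
  has (fun U => ~~ (V <= U)%VS) s -> pact s f = (fun=> 0).
Proof.
move=> hf hs /hasP [U Us nVU]; case: s Us hs => // X t.
rewrite inE => /orP [/eqP e|]; move=> hs.
  rewrite -e in hs *; apply: funext => K; rewrite /pact.
  have -> : restr U f = (fun=> 0); last by rewrite rstep0.
  have [h _] := good_restr U hf.
  apply: funext => L; apply/eqP/negP => /negP nz; have := h _ nz.
  move: nz; case: L => [|Z L] /=; rewrite ?eqxx //.
  by case: (eqVneq Z U) => [-> _ /flag_sub|]; rewrite ?eqxx // (negPf nVU).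
case/splitPr: hs => t1 t2 hs; apply: funext => K; rewrite /pact -cat_rcons rstep_cat.
rewrite last_rcons (_ : rstep X (rcons t1 U) _ = fun=> 0) ?rstep0 //.
have [h _] := good_rstep X (rcons t1 U) (good_restr X hf).
have hr : restr U (rstep X (rcons t1 U) (restr X f)) = rstep X (rcons t1 U) (restr X f).
  by have := @restr_rstep X (rcons t1 U) (restr X f); rewrite last_rcons; apply; apply: restr_id.
apply: funext => L; apply/eqP/negP => /negP nz; have := h _ nz.
move: nz; rewrite -hr; case: L => [|Z L] /=; rewrite ?eqxx //.
by case: (eqVneq Z U) => [-> _ /flag_sub|]; rewrite ?eqxx // (negPf nVU).
Qed.

Definition lam f (x : Delta V) : int := LamS f (pm_val (repr x)).

Lemma LamS_bad f (u : projmod V) : good V f -> u \in @bad_span F n V -> LamS f (pm_val u) = 0.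
Proof.
move=> hf /asboolP; elim=> {u} [|u v [s [hs _ hb us]] _ IH|u v [s [hs _ hb us]] _ IH].
- exact: LamS0.
- have -> : pm_val (u + v) = spath s - (0 - pm_val v).
    by rewrite -us opprB subr0; exact: (raddfD (val : projmod V -> _)).
  by rewrite !LamSB // LamS0 // IH LamS_spath // pact_bad // subr0 subr0.
- have -> : pm_val (v - u) = pm_val v - spath s.
    by rewrite -us; exact: (raddfB (val : projmod V -> _)).
  by rewrite !LamSB // IH LamS_spath // pact_bad // subr0.
Qed.

Lemma lam_class f u : good V f -> lam f (qclass (@bad_span F n V) u) = LamS f (pm_val u).
Proof.
move=> hf; apply/eqP; rewrite -subr_eq0 /lam -LamSB //.
rewrite -(raddfB (val : projmod V -> _)); apply/eqP/LamS_bad => //.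
by rewrite -qclass_eq /qclass reprK.
Qed.

Lemma lamB f x y : good V f -> lam f (x - y) = lam f x - lam f y.
Proof.
move=> hf; case: (qclassP x) => a ->; case: (qclassP y) => b ->.
rewrite -raddfB !lam_class // -LamSB //; congr LamS.
Qed.

Lemma is_flag_path K : is_flag_to V K -> is_flagpath K.
Proof.
elim: K => // X [|Y K] IH //; rewrite flag_cons => /andP [h /IH] /= ->.
by rewrite /gtrdot h orbT.
Qed.

Lemma is_flag_last K : is_flag_to V K -> last 0%VS K = V.
Proof. by case: K => //= X K /andP [_ /eqP]. Qed.

Lemma pact_flag K f : is_flag_to V K -> pact K f [:: V] = f K.
Proof.
case: K => // X t; rewrite /pact; suff rs g : is_flag_to V (X :: t) ->
    rstep X t g [:: V] = g (X :: t).
  by move=> h; rewrite rs //= eqxx.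
elim: t X g => [|Y t IH] X g; first by move=> /= /eqP ->.
by rewrite flag_cons => /andP [h hK]; rewrite /= IH // op_down.
Qed.

Lemma spath_mul1 K : is_flag_to V K -> spath K * spath [:: V] = spath K.
Proof.
move=> hK; rewrite /spath -rmorphM [_ * _]path_mul_basis ?(is_flag_path hK) //.
by rewrite /concat (is_flag_last hK) eqxx /= cats0.
Qed.

(** Every good function is thus realised by a functional on [Delta V]: this is the independence half
    of the description of [Delta V] as flags modulo (FS). *)
Lemma lam_dpath f K : good V f -> is_flag_to V K -> lam f (dpath V K) = f K.
Proof.
move=> hf hK; rewrite lam_class // /pm_of /= spath_mul1 // LamS_spath //.
  exact: pact_flag.
exact: is_flag_path.
Qed.

End Functional.

(** * Relations in S(PG(n-1,q)) and the standard form *)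

Section PathRelations.
Variables (F : finFieldType) (n : nat).
Implicit Types U W X Y Z : subsp F n.
Implicit Types K L s p q t : seq (subsp F n).
Local Notation S := (PGalg F n).

Lemma spathM p q : is_flagpath p -> is_flagpath q ->
  spath p * spath q = if last 0%VS p == head 0%VS q then spath (p ++ behead q) else 0 :> S.
Proof.
move=> hp hq; rewrite /spath -rmorphM [_ * _]path_mul_basis // /concat.
by case: ifP => // _; exact: raddf0.
Qed.

Lemma spath0 s : ~~ is_flagpath s -> spath s = 0 :> S.
Proof. by move=> hs; rewrite /spath bpath0 // raddf0. Qed.

Lemma flagpath_split s x t :
  is_flagpath (s ++ x :: t) = is_flagpath (rcons s x) && is_flagpath (x :: t).
Proof.
case: s => [|a s] //=.
by rewrite -cats1 !cat_path /= andbT andbA.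
Qed.

Lemma spath_split s x t : spath (s ++ x :: t) = spath (rcons s x) * spath (x :: t) :> S.
Proof.
have := flagpath_split s x t.
have [h1|h1] := boolP (is_flagpath (rcons s x)); last first.
  by move=> h; rewrite (spath0 h1) mul0r spath0 // h.
have [h2 h|h2 h] := boolP (is_flagpath (x :: t)); last first.
  by rewrite (spath0 h2) mulr0 spath0 // h.
by rewrite spathM // last_rcons eqxx /= cat_rcons.
Qed.

Lemma rel_class (r : path_alg F n) : PG_rel r -> rclass (@PG_rel F n) r = 0.
Proof.
move=> hr; apply/eqP; rewrite -(raddf0 (rclass (@PG_rel F n))) rclass_eq subr0.
apply/asboolP; rewrite -[r]addr0; apply: zspan_set_add; last by constructor.
by exists 1, r, 1; rewrite mul1r mulr1.
Qed.

Lemma spath3 s1 X Y Z s2 :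
  spath (s1 ++ X :: Y :: Z :: s2) = spath (rcons s1 X) * (spath [:: X; Y; Z] * spath (Z :: s2)) :> S.
Proof.
rewrite (spath_split s1); congr (_ * _); exact: (spath_split [:: X; Y]).
Qed.

Lemma spath_wedge_eq s1 U W s2 : lessdot U W ->
  spath (s1 ++ U :: W :: U :: s2) = spath (s1 ++ U :: s2) *+ (#|F| ^ \dim U) :> S.
Proof.
move=> h; rewrite spath3 spath_split.
have -> : spath [:: U; W; U] = spath [:: U] *+ (#|F| ^ \dim U) :> S.
  apply/eqP; rewrite -subr_eq0 /spath -raddfMn -raddfB; apply/eqP/rel_class.
  exact: wedge_eq.
rewrite mulrnAl mulrnAr; congr (_ * _ *+ _).
exact/esym/(spath_split [::]).
Qed.

Lemma spath_wedge_neq s1 U W U' s2 : lessdot U W -> lessdot U' W -> U != U' ->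
  spath (s1 ++ U :: W :: U' :: s2) =
  - spath (s1 ++ U :: (U :&: U')%VS :: U' :: s2) :> S.
Proof.
move=> h h' nU; rewrite !spath3.
have -> : spath [:: U; W; U'] = - spath [:: U; (U :&: U')%VS : subsp F n; U'] :> S.
  apply/eqP; rewrite -addr_eq0 /spath -raddfD; apply/eqP/rel_class.
  exact: wedge_neq.
by rewrite mulNr mulrN.
Qed.

Lemma spath_fs_up s1 U W s2 : (U <= W)%VS -> \dim W = (\dim U).+2 ->
  \sum_(X | between U W X) spath (s1 ++ U :: X :: W :: s2) = 0 :> S.
Proof.
move=> UW dW; under eq_bigr do rewrite spath3.
rewrite -mulr_sumr -mulr_suml.
by rewrite [X in _ * (X * _)](etrans (esym (raddf_sum (rclass (@PG_rel F n)) _ _ _)) (rel_class (FS_up UW dW))) mul0r mulr0.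
Qed.

Lemma spath_fs_down s1 U W s2 : (U <= W)%VS -> \dim W = (\dim U).+2 ->
  \sum_(X | between U W X) spath (s1 ++ W :: X :: U :: s2) = 0 :> S.
Proof.
move=> UW dW; under eq_bigr do rewrite spath3.
rewrite -mulr_sumr -mulr_suml.
by rewrite [X in _ * (X * _)](etrans (esym (raddf_sum (rclass (@PG_rel F n)) _ _ _)) (rel_class (FS_down UW dW))) mul0r mulr0.
Qed.

Variable V : subsp F n.

Lemma is_flag_from_toP W K : is_flag_from_to V W K -> exists t, K = W :: t.
Proof. by case: K => // X t /andP [_ /eqP /= ->]; exists t. Qed.

Lemma flag_from_cons W H K : is_flag_from_to V W (W :: H :: K) =
  lessdot H W && is_flag_from_to V H (H :: K).
Proof. by rewrite /is_flag_from_to /= !eqxx !andbT andbA. Qed.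

Lemma flag_from_V K : is_flag_from_to V V K -> K = [:: V].
Proof.
move=> h; have [[|H t] e] := is_flag_from_toP h; first by [].
move: h; rewrite e flag_from_cons => /andP [h /andP [/flag_sub h' _]].
by have := dimvS h'; rewrite (lessdot_dim h) ltnn.
Qed.

Lemma flag_from_self K : is_flag_to V K -> is_flag_from_to V (head 0%VS K) K.
Proof. by move=> h; rewrite /is_flag_from_to h eqxx. Qed.

(* Pushing the up-step X < Y through the flag K by the wedge relations. *)
Lemma spath_reduce X Y K : is_flag_from_to V Y K -> lessdot X Y -> (V <= X)%VS ->
  exists c K', is_flag_from_to V X K' /\
    spath (X :: K) = spath K' *~ ((#|F| ^ \dim V)%:Z * c) :> S.
Proof.
move=> hK; have [t e] := is_flag_from_toP hK; move: hK; rewrite {}e => {K}.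
elim: t X Y => [|Z t IH] X Y hK hXY VX.
  case/andP: hK => /= /eqP e _; have := dimvS VX.
  by rewrite -e (lessdot_dim hXY) ltnn.
move: hK; rewrite flag_from_cons => /andP [hZY hZ].
case: (eqVneq X Z) => [e|nXZ].
  exists (#|F| ^ (\dim X - \dim V))%:Z, (X :: t); split; first by rewrite e.
  rewrite -e (spath_wedge_eq [::] t hXY) pmulrn; congr (_ *~ _).
  by rewrite -PoszM -expnD subnKC // dimvS.
have VZ : (V <= Z)%VS by case/andP: hZ => /flag_sub.
have h1 := lessdot_capl hXY hZY nXZ; have h2 := lessdot_cap hXY hZY nXZ.
have [|c [K' [hK' e]]] := IH (X :&: Z)%VS Z hZ h2; first by rewrite subv_cap VX.
exists (- c), (X :: K'); split.
  by have [t' e'] := is_flag_from_toP hK'; move: hK'; rewrite e' flag_from_cons h1.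
rewrite (spath_wedge_neq [::] t hXY hZY nXZ) /=.
rewrite (spath_split [:: X]) e mulrN mulrNz; congr (- _).
rewrite -mulrzr mulrA mulrzr; congr (_ *~ _).
by case: (is_flag_from_toP hK') => t' ->; rewrite -(spath_split [:: X]).
Qed.

Lemma rev_flagpath s : is_flagpath s -> is_flagpath (rev s).
Proof.
case: s => // X t; rewrite /= -(rev_path _ X t) /=.
case/lastP: t => [|t Y] //=; rewrite belast_rcons last_rcons rev_cons -rcons_cons rev_rcons /=.
by rewrite rev_cons => h; rewrite (eq_path (e' := fun U V0 => lessdot V0 U || gtrdot V0 U)) // => A B; rewrite /gtrdot orbC.
Qed.

(** Each of the [(size L).-1] up-steps of [rev L] contributes a factor q^(dim V) by [spath_reduce].
    In the defining characteristic this is the lower bound for the elementary divisors of the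
    form. *)
Lemma spath_form W K L : is_flag_from_to V W K -> is_flag_from_to V W L ->
  exists c, spath (rev L) * spath K =
    spath [:: V] *~ ((#|F| ^ (\dim V * (size L).-1))%:Z * c) :> S.
Proof.
move=> hK hL; have [t e] := is_flag_from_toP hL; move: hL; rewrite {}e => {L}.
elim: t W K hK => [|H t IH] W K hK.
  move=> /andP [/= /eqP e _]; rewrite e in hK *.
  rewrite (flag_from_V hK) spathM //= eqxx /=; exists 1.
  by rewrite muln0 expn0 mulr1.
rewrite flag_from_cons => /andP [hHW hH].
have VH : (V <= H)%VS by case/andP: hH => /flag_sub.
have [c [K' [hK' e]]] := spath_reduce hK hHW VH.
have [c' e'] := IH H K' hK' hH.
exists (c' * c); rewrite rev_cons rev_cons -cats1 cat_rcons spath_split -mulrA.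
rewrite -rev_cons.
have -> : spath [:: H; W] * spath K = spath (H :: K) :> S.
  by case: (is_flag_from_toP hK) => t' ->; rewrite -(spath_split [:: H]).
rewrite e mulrzAr e' -mulrzA; congr (_ *~ _).
by rewrite /= mulnS addnC expnD PoszM; rewrite -!mulrA; congr (_ * _); rewrite mulrCA.
Qed.

Lemma spath_form0 K L : is_flag_to V K -> is_flag_to V L -> head 0%VS K != head 0%VS L ->
  spath (rev L) * spath K = 0 :> S.
Proof.
move=> hK hL ne; rewrite spathM ?rev_flagpath ?(is_flag_path hL) ?(is_flag_path hK) //.
rewrite ifN //; case: L hL ne => // Y L _ ne.
by rewrite rev_cons last_rcons eq_sym.
Qed.

Definition point_V K : int := (K == [:: V])%:R.

Lemma good_point_V : good V point_V.
Proof.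
split=> [K|s1 Y U s2 _ _]; rewrite /point_V.
  by case: (eqVneq K [:: V]) => [->|_]; rewrite /= ?eqxx.
rewrite big1 // => X _; suff -> : (s1 ++ [:: Y, X, U & s2] == [:: V]) = false by [].
by apply/eqP => /(congr1 size); rewrite size_cat /= !addnS.
Qed.

(* The coefficient of (V) in the product (rev L)K. *)
Definition pairing L : seq (subsp F n) -> int := pact (rev L) point_V.

Lemma good_pairing L : good V (pairing L).
Proof. exact/good_pact/good_point_V. Qed.

Lemma LamS_pairing L K : is_flagpath L -> is_flag_to V K ->
  LamS V point_V (spath (rev L) * spath K) = pairing L K.
Proof.
move=> hL hK; rewrite /spath -rmorphM LamS_class; last exact: good_point_V.
rewrite Lam_mul ?rev_flagpath // Lam_bpath ?(is_flag_path hK) // pact_flag //.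
Qed.

(** In particular (V) has infinite order in S, so the integer selected by [flag_form] is unique. *)
Lemma LamS_point_V (c : int) : LamS V point_V (spath [:: V] *~ c) = c.
Proof.
rewrite /spath -raddfMz LamS_class; last exact: good_point_V.
have -> : Lam V point_V (bpath [:: V] *~ c) = Lam V point_V (bpath [:: V]) *~ c by exact: raddfMz.
by rewrite Lam_bpath //= eqxx /point_V eqxx intz.
Qed.

Lemma spath_pairing K L : is_flag_to V K -> is_flag_to V L ->
  spath (rev L) * spath K = spath [:: V] *~ pairing L K :> S.
Proof.
move=> hK hL; case: (eqVneq (head 0%VS K) (head 0%VS L)) => [e|ne].
  have hK' := flag_from_self hK; rewrite e in hK'.
  have [c e'] := spath_form hK' (flag_from_self hL).
  by rewrite -(LamS_pairing (is_flag_path hL) hK) e' LamS_point_V.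
by rewrite -(LamS_pairing (is_flag_path hL) hK) (spath_form0 hK hL ne) (LamS0 good_point_V) mulr0z.
Qed.

Lemma pairing_dvd W K L : is_flag_from_to V W K -> is_flag_from_to V W L ->
  exists c, pairing L K = (#|F| ^ (\dim V * (size L).-1))%:Z * c.
Proof.
move=> hK hL; have [c e] := spath_form hK hL; exists c.
have [hK' _] := andP hK; have [hL' _] := andP hL.
by rewrite -(LamS_pairing (is_flag_path hL') hK') e LamS_point_V.
Qed.

Lemma flag_formE K L : is_flag_to V K -> is_flag_to V L -> flag_form V K L = pairing L K.
Proof.
move=> hK hL; rewrite /flag_form; case: xgetP => [c _ /= hc|h].
  by rewrite -(LamS_pairing (is_flag_path hL) hK) hc LamS_point_V.
by case: (h (pairing L K)); apply: spath_pairing.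
Qed.

End PathRelations.

(** * Spanning by flags; independence of the form from choices *)

Section StandardModuleTheory.
Variables (F : finFieldType) (n : nat) (V : subsp F n).
Implicit Types U W X Y Z H : subsp F n.
Implicit Types K L p q : seq (subsp F n).
Implicit Types x y : Delta V.
Implicit Types f g : seq (subsp F n) -> int.
Local Notation S := (PGalg F n).

Fact pm_of_additive : zmod_morphism (@pm_of F n V).
Proof. by move=> a b; apply/val_inj; rewrite raddfB /= mulrBl. Qed.
HB.instance Definition _ :=
  GRing.isZmodMorphism.Build S (projmod V) (@pm_of F n V) pm_of_additive.

Definition dclass (a : S) : Delta V := qclass (@bad_span F n V) (pm_of V a).
HB.instance Definition _ := GRing.isZmodMorphism.Build S (Delta V) dclass
  (fun a b => etrans (congr1 (qclass _) (pm_of_additive a b)) (qclassB _ _ _)).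

Lemma dclassM (a b : S) : dclass (a * b) = a *: dclass b.
Proof.
rewrite /dclass -linearZ; congr qclass; apply/val_inj.
by rewrite linearZ /= -[RHS]/(a * (b * _)) mulrA.
Qed.

Lemma dpathE s : dpath V s = dclass (spath s).
Proof. by []. Qed.

Lemma dpath_split s X t : dpath V (s ++ X :: t) = spath (rcons s X) *: dpath V (X :: t).
Proof. by rewrite !dpathE spath_split dclassM. Qed.

Lemma dpath_cons X Y t : dpath V (X :: Y :: t) = spath [:: X; Y] *: dpath V (Y :: t).
Proof. exact: (dpath_split [:: X]). Qed.

Lemma dpath_last0 s : is_flagpath s -> last 0%VS s != V -> dpath V s = 0.
Proof.
move=> hs hl; rewrite dpathE /dclass (_ : pm_of V _ = 0) ?raddf0 //.
by apply/val_inj; rewrite /= spathM // (negPf hl).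
Qed.

Lemma dpath_bad s : is_flagpath s -> has (fun U => ~~ (V <= U)%VS) s -> dpath V s = 0.
Proof.
move=> hs hb; case: (eqVneq (last 0%VS s) V) => [hl|hl]; last exact: dpath_last0.
apply/eqP; rewrite -[0](raddf0 (qclass (@bad_span F n V))) qclass_eq subr0.
apply/asboolP; rewrite -[pm_of _ _]addr0; apply: zspan_set_add; last by constructor.
by exists s; split=> //=; rewrite spathM // hl eqxx /= cats0.
Qed.

Lemma fs_dpath : fs_fun (dpath V).
Proof.
move=> s1 Y U s2 UY dY; have := spath_fs_down s1 s2 UY dY.
by move/(congr1 dclass); rewrite raddf0 raddf_sum.
Qed.

Definition flag_span : {pred Delta V} :=
  zspan [set x | exists2 K, is_flag_to V K & x = dpath V K].
HB.instance Definition _ := GRing.ZmodClosed.on flag_span.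

Lemma flag_span_dpath K : is_flag_to V K -> dpath V K \in flag_span.
Proof.
move=> hK; apply/asboolP; rewrite -[dpath V K]addr0; apply: zspan_set_add.
  by exists K.
by constructor.
Qed.

(** A down-step lengthens the flag. An up-step X < Y either starts at an X not containing V, which
    gives zero, or is absorbed by [spath_reduce]. *)
Lemma spath_step_span X Y K : is_flagpath [:: X; Y] -> is_flag_to V K ->
  spath [:: X; Y] *: dpath V K \in flag_span.
Proof.
move=> hXY hK; case: (eqVneq Y (head 0%VS K)) => [e|ne]; last first.
  by rewrite -dclassM spathM ?(is_flag_path hK) //= (negPf ne) raddf0 rpred0.
have hK' := flag_from_self hK; have [t eK] := is_flag_from_toP hK'.
rewrite -e in eK hK'; rewrite eK -dpath_cons.
move: hXY => /=; rewrite andbT => /orP [h|h]; last first.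
  by apply: flag_span_dpath; rewrite flag_cons (h : lessdot Y X) -eK.
have [VX|nVX] := boolP (V <= X)%VS; last first.
  rewrite dpath_bad ?rpred0 //= ?nVX //.
  by have := is_flag_path hK; rewrite eK /= h.
have [c [K' [/andP [hK1 _] e']]] := spath_reduce hK' h VX.
by rewrite dpathE -eK e' raddfMz rpredMz // flag_span_dpath.
Qed.

Lemma flag_spanT x : x \in flag_span.
Proof.
have hpath s : is_flagpath s -> dpath V s \in flag_span.
  elim: s => // X [|Y s] IH hs.
    case: (eqVneq X V) => [->|nX]; last by rewrite dpath_last0 // rpred0.
    by apply: flag_span_dpath; rewrite /= eqxx.
  have /andP [h1 h2] : is_flagpath [:: X; Y] && is_flagpath (Y :: s).
    by have := flagpath_split [:: X] Y s; rewrite /= => <-.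
  rewrite dpath_cons; move: (IH h2) => /asboolP.
  elim=> [|a b [K hK ->] _ IHb|a b [K hK ->] _ IHb].
  - by rewrite scaler0 rpred0.
  - by rewrite scalerDr rpredD // spath_step_span.
  - by rewrite scalerBr rpredB // spath_step_span.
case: (qclassP x) => u ->; have /asboolP [s e] := pm_valP u.
have -> : u = pm_of V s by apply/val_inj.
rewrite -/(dclass s); case: (rclassP s) => a ->.
elim/path_alg_ind: a => [|a b IHa IHb|p].
- by rewrite !raddf0 rpred0.
- by rewrite !raddfB rpredB.
- by apply: hpath; case: p.
Qed.

Lemma Delta_ind (P : Delta V -> Prop) : P 0 -> (forall x y, P x -> P y -> P (x - y)) ->
  (forall K, is_flag_to V K -> P (dpath V K)) -> forall x, P x.
Proof.
move=> h0 hB hK0 x; have /asboolP := flag_spanT x.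
elim=> [//|y z [K hK ->] _ IH|y z [K hK ->] _ IH]; last by apply: hB => //; apply: hK0.
rewrite addrC -[dpath V K]opprK; apply: (hB) => //; rewrite -sub0r; apply: (hB) => //.
exact: hK0.
Qed.

Lemma flag_coordP x : all (fun t => is_flag_to V t.2) (flag_coord x) /\
  x = \sum_(t <- flag_coord x) dpath V t.2 *~ t.1.
Proof.
rewrite /flag_coord; case: xgetP => [c _ //|h].
suff [c hc] : exists c : seq (int * seq (subsp F n)),
    all (fun t => is_flag_to V t.2) c /\ x = \sum_(t <- c) dpath V t.2 *~ t.1.
  by case: (h c).
move: {h} x; apply: Delta_ind => [|x y [c [hc ->]] [d [hd ->]]|K hK].
- by exists [::]; rewrite big_nil.
- exists (c ++ [seq (- t.1, t.2) | t <- d]); split.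
    rewrite all_cat hc all_map; apply: sub_all hd => t; exact.
  rewrite big_cat big_map -sumrN; congr (_ + _); apply: eq_bigr => t _.
  by rewrite /= mulrNz.
- by exists [:: (1, K)]; rewrite /= hK big_seq1.
Qed.

Lemma lam0 f : good V f -> lam f (0 : Delta V) = 0.
Proof. by move=> hf; rewrite -[0](subrr (0 : Delta V)) lamB // subrr. Qed.

Lemma lamD f x y : good V f -> lam f (x + y) = lam f x + lam f y.
Proof.
by move=> hf; rewrite -[y]opprK lamB // -(sub0r (- y)) lamB // lam0 // sub0r.
Qed.

Lemma lamMn f x (k : nat) : good V f -> lam f (x *+ k) = lam f x *+ k.
Proof.
by move=> hf; elim: k => [|k IH]; rewrite ?mulr0n ?lam0 // !mulrS lamD // IH.
Qed.

Lemma lamMz f x (c : int) : good V f -> lam f (x *~ c) = lam f x * c.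
Proof.
move=> hf; rewrite -[RHS]mulrzz; case: c => k; first by rewrite -!pmulrn lamMn.
by rewrite NegzE !mulrNz -!pmulrn -sub0r lamB // lam0 // sub0r lamMn.
Qed.

Lemma lam_sum f (I : Type) (r : seq I) (P : pred I) (G : I -> Delta V) : good V f ->
  lam f (\sum_(i <- r | P i) G i) = \sum_(i <- r | P i) lam f (G i).
Proof.
move=> hf; apply: (big_morph (lam f) (id1 := 0)); last exact: lam0.
by move=> x y; apply: lamD.
Qed.

Lemma lamE f (c : seq (int * seq (subsp F n))) : good V f ->
  all (fun t => is_flag_to V t.2) c ->
  lam f (\sum_(t <- c) dpath V t.2 *~ t.1) = \sum_(t <- c) t.1 * f t.2.
Proof.
move=> hf /allP hc; rewrite lam_sum // big_seq [RHS]big_seq; apply: eq_bigr => t /hc ht.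
by rewrite lamMz // lam_dpath // mulrC.
Qed.

(** The form as a function of its other argument, cut off outside the flags to V so that it has the
    support required by [good]. *)
Definition pairing' K L : int := if is_flag_to V L then pairing V L K else 0.

Lemma flag_between s1 Y X U s2 : between U Y X ->
  is_flag_to V (s1 ++ Y :: X :: U :: s2) =
  (if s1 is a :: s1' then path (@gtrdot F n) a (rcons s1' Y) else true)
  && is_flag_to V (U :: s2).
Proof.
move=> /andP [h1 h2]; case: s1 => [|a s1] /=; first by rewrite /gtrdot h1 h2.
rewrite last_cat -cat_rcons cat_path last_rcons /= /gtrdot h1 h2 /=.
by rewrite -andbA.
Qed.

(** Reversing L turns (FS) for its down-steps into the relation (FS) for up-steps inside [rev L]. *)
Lemma good_pairing' K : is_flag_to V K -> good V (pairing' K).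
Proof.
move=> hK; split=> [L|s1 Y U s2 UY dY]; rewrite /pairing'.
  by case: ifP => // _; rewrite eqxx.
pose b := (if s1 is a :: s1' then path (@gtrdot F n) a (rcons s1' Y) else true)
  && is_flag_to V (U :: s2).
have key X : between U Y X ->
   (if is_flag_to V (s1 ++ [:: Y, X, U & s2]) then pairing V (s1 ++ [:: Y, X, U & s2]) K else 0)
   = if b then LamS V (point_V V) (spath (rev s2 ++ U :: X :: Y :: rev s1) * spath K) else 0.
  move=> hX; have e := flag_between s1 s2 hX; rewrite e -/b; case: ifP => // hb.
  have hL : is_flag_to V (s1 ++ [:: Y, X, U & s2]) by rewrite e.
  rewrite -(LamS_pairing (is_flag_path hL) hK) rev_cat !rev_cons -!cats1 -!catA /=.
  by [].
rewrite (eq_bigr _ key); case: b {key}; last by rewrite big1.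
have sumS (I : finType) (P : pred I) (G : I -> S) :
    \sum_(i | P i) LamS V (point_V V) (G i) = LamS V (point_V V) (\sum_(i | P i) G i).
  apply/esym/(big_morph (LamS V (point_V V))); last exact/LamS0/good_point_V.
  by move=> a c; have := LamSB (a + c) c (good_point_V V); rewrite addrK => ->; rewrite subrK.
by rewrite sumS -mulr_suml spath_fs_up // mul0r LamS0 //; exact: good_point_V.
Qed.

Lemma std_formE x y :
  std_form x y = \sum_(t <- flag_coord y) t.1 * lam (pairing V t.2) x.
Proof.
have [/allP hx ex] := flag_coordP x; have [/allP hy _] := flag_coordP y.
rewrite /std_form exchange_big /= big_seq [RHS]big_seq; apply: eq_bigr => t ht.
rewrite [in RHS]ex lamE; [|exact: good_pairing|exact/allP].
rewrite mulr_sumr big_seq [RHS]big_seq; apply: eq_bigr => s hs.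
by rewrite flag_formE; [rewrite mulrA (mulrC t.1) | exact: hx | exact: hy].
Qed.

(** [std_form] is computed from chosen expressions of both arguments. [good_pairing] removes the
    dependence on the choice for x, and [good_pairing'] the dependence on the choice for the second
    argument. *)
Lemma std_form_flag x L : is_flag_to V L -> std_form x (dpath V L) = lam (pairing V L) x.
Proof.
move=> hL; rewrite std_formE; have [/allP hx ex] := flag_coordP x.
have [/allP hy ey] := flag_coordP (dpath V L).
set cy := flag_coord (dpath V L) in hy ey *.
rewrite [in RHS]ex lamE; [|exact: good_pairing|exact/allP].
transitivity (\sum_(t <- cy) \sum_(s <- flag_coord x) t.1 * (s.1 * pairing V t.2 s.2)).
  apply: eq_bigr => t _; rewrite [in LHS]ex lamE ?mulr_sumr //; [exact: good_pairing|exact/allP].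
rewrite exchange_big /= big_seq [RHS]big_seq; apply: eq_bigr => s hs.
have hs' := hx _ hs.
have := lam_dpath (good_pairing' hs') hL; rewrite {1}ey lamE; [|exact: good_pairing'|exact/allP].
rewrite /pairing' hL => <-; rewrite mulr_sumr [RHS]big_seq big_seq.
by apply: eq_bigr => t ht; rewrite (hy _ ht) mulrCA.
Qed.

Lemma Delta_filP l i x : Delta_fil l i x <->
  forall L, is_flag_to V L -> ((l ^ i)%:Z %| lam (pairing V L) x)%Z.
Proof.
split=> h; first by move=> L hL; rewrite -std_form_flag.
move=> y; rewrite std_formE; have [/allP hy _] := flag_coordP y.
by rewrite big_seq; apply: rpred_sum => t /hy /h ht; rewrite dvdz_mull.
Qed.

Lemma scale_spath1 W K : is_flag_to V K ->
  spath [:: W] *: dpath V K = if head 0%VS K == W then dpath V K else 0.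
Proof.
move=> hK; rewrite -dclassM spathM ?(is_flag_path hK) //=.
case: (eqVneq W (head 0%VS K)) => [->|ne]; last by rewrite raddf0.
by case: K hK.
Qed.

End StandardModuleTheory.

(** * Counting flags *)

Section FullFlags.
Variables (F : finFieldType) (n : nat) (V : subsp F n).
Implicit Types U W X Y Z H : subsp F n.
Implicit Types K L : seq (subsp F n).
Local Notation S := (PGalg F n).
Local Notation q := #|F|.

Definition hyper W H := (V <= H)%VS && lessdot H W.

(** The hyperplanes other than H0 are sorted by their intersection X with H0, which is a hyperplane
    of H0 over V. *)
Lemma big_hyper (M : zmodType) (f : subsp F n -> M) W H0 : hyper W H0 ->
  \sum_(H | hyper W H) f H =
  f H0 + \sum_(X | hyper H0 X) \sum_(H | between X W H && (H != H0)) f H.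
Proof.
move=> hH0; have [VH0 lH0] := andP hH0.
rewrite (bigD1 H0) //=; congr (_ + _).
rewrite (partition_big (fun H => (H :&: H0)%VS : subsp F n) (hyper H0)) /=; last first.
  move=> H /andP [/andP [VH lH] nH]; rewrite /hyper subv_cap VH VH0 /=.
  exact: (lessdot_cap lH lH0 nH).
apply: eq_bigr => X /andP [VX lX]; apply: eq_bigl => H; apply/idP/idP.
  move=> /andP [/andP [/andP [VH lH] nH] /eqP <-].
  by rewrite /between (lessdot_capl lH lH0 nH) lH nH.
move=> /andP [/andP [h1 h2] nH].
rewrite /hyper h2 nH (subv_trans VX (lessdot_sub h1)) /=.
by apply/eqP/lessdot_meet.
Qed.

Lemma hyper_exists m : forall U W, (U <= W)%VS -> \dim W = (\dim U + m.+1)%N ->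
  exists H, (U <= H)%VS && lessdot H W.
Proof.
elim: m => [|m IH] U W UW dW.
  exists U; rewrite subvv; apply/lessdotP; split=> //; by rewrite dW addn1.
have /subvPn [a aW aU] : ~~ (W <= U)%VS.
  by apply/negP => /dimvS; rewrite dW addnS ltnNge leq_addr.
have hUa := between_line aU.
have UaW : (U + <[a]> <= W)%VS by rewrite subv_add UW -memvE.
have [|H /andP [h1 h2]] := IH _ _ UaW; first by rewrite dW (lessdot_dim hUa) addSnnS.
by exists H; rewrite h2 andbT; apply: subv_trans h1; apply: addvSl.
Qed.

(** The q-integer [m]_q = 1 + q + ... + q^(m-1); [qfact m] is then [m]_q!. *)
Fixpoint qnum m := if m is m'.+1 then (1 + q * qnum m')%N else 0%N.
Fixpoint qfact m := if m is m'.+1 then (qnum m * qfact m')%N else 1%N.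

Lemma qnumS m : qnum m.+1 = (q ^ m + qnum m)%N.
Proof.
elim: m => [|m IH] /=; first by rewrite muln0.
by rewrite -[(1 + q * qnum m)%N]/(qnum m.+1) {1}IH mulnDr -expnS addnCA.
Qed.

Lemma hyper_dim m W H : \dim W = (\dim V + m.+1)%N -> hyper W H ->
  \dim H = (\dim V + m)%N.
Proof. by move=> dW /andP [_ /lessdot_dim]; rewrite dW addnS => -[]. Qed.

Lemma hyper0 W H : \dim W = \dim V -> hyper W H = false.
Proof.
move=> dW; apply/negP => /andP [/dimvS VH /lessdot_dim dH].
by rewrite -dW dH ltnn in VH.
Qed.

Lemma card_hyper m : forall W, (V <= W)%VS -> \dim W = (\dim V + m)%N ->
  #|hyper W| = qnum m.
Proof.
elim: m => [|m IH] W VW dW.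
  rewrite addn0 in dW; apply: eq_card0 => H; exact: hyper0.
have [H0 hH0] := hyper_exists VW dW.
have [VH0 lH0] := andP hH0.
have := @big_hyper int (fun=> 1) W H0 hH0.
have -> : \sum_(H | hyper W H) 1 = #|hyper W|%:R :> int by rewrite -sum1_card natr_sum.
rewrite (eq_bigr (fun=> q%:R)) => [|X /andP [_ lX]]; last first.
  rewrite -(@card_between_neq F n X W H0) /between ?lX //.
  by rewrite -sum1_card natr_sum; apply: eq_bigl => H; rewrite !inE.
rewrite sumr_const -(mulr_natr q%:R) -[X in X + _]/(1%:R) -natrM -natrD => /eqP.
by rewrite eqr_nat (IH H0 VH0 (hyper_dim dW hH0)) => /eqP.
Qed.

Fixpoint flagsn m W : seq (seq (subsp F n)) :=
  if m is m'.+1 then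
    [seq W :: K | H <- enum (hyper W), K <- flagsn m' H]
  else if W == V then [:: [:: V]] else [::].

Lemma big_flagsn (M : zmodType) (f : seq (subsp F n) -> M) m W :
  \sum_(K <- flagsn m.+1 W) f K = \sum_(H | hyper W H) \sum_(K <- flagsn m H) f (W :: K).
Proof. by rewrite /= big_allpairs_dep big_enum. Qed.

Lemma size_flag W K : is_flag_from_to V W K -> \dim W = (\dim V + (size K).-1)%N.
Proof.
move=> h; have [t e] := is_flag_from_toP h; move: h; rewrite {K}e.
elim: t W => [|H t IH] W.
  by rewrite /is_flag_from_to /= => /andP [/eqP -> _]; rewrite addn0.
by rewrite flag_from_cons => /andP [/lessdot_dim -> /IH ->]; rewrite /= addnS.
Qed.

Lemma mem_flagsn m W K : (K \in flagsn m W) = is_flag_from_to V W K && (size K == m.+1).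
Proof.
elim: m W K => [|m IH] W K.
  rewrite /=; case: (eqVneq W V) => [->|nW].
    rewrite inE; apply/eqP/andP => [->|[/flag_from_V -> //]].
    by rewrite /is_flag_from_to /= eqxx.
  rewrite in_nil; apply/esym/negP => /andP [h].
  by case: K h => // X [|//] /andP [/= /eqP -> /eqP e]; rewrite e eqxx in nW.
rewrite /=; apply/allpairsPdep/andP => [[H [K' [hH hK' ->]]]|[hK sK]].
  move: hH hK'; rewrite mem_enum => /andP [_ lH].
  rewrite IH => /andP [h /eqP sK']; have [t e] := is_flag_from_toP h.
  by move: h sK'; rewrite e flag_from_cons lH => -> /= ->.
have [[|H t] e] := is_flag_from_toP hK; first by move: sK; rewrite e.
move: hK sK; rewrite e flag_from_cons => /andP [lH hH] sK.
exists H, (H :: t); split=> //; last by rewrite IH hH.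
rewrite mem_enum unfold_in /hyper lH andbT.
by case/andP: hH => /flag_sub.
Qed.

Lemma uniq_flagsn m W : uniq (flagsn m W).
Proof.
elim: m W => [|m IH] W /=; first by case: ifP.
apply: allpairs_uniq_dep.
- exact: enum_uniq.
- by move=> H _.
move=> a b /allpairsPdep [H [K [_ hK ->]]] /allpairsPdep [H' [K' [_ hK' ->]]] /= [e].
move: hK hK'; rewrite !mem_flagsn e => /andP [/andP [_ /eqP <-] _].
by move=> /andP [/andP [_ /eqP <-] _].
Qed.

Lemma size_flagsn m W : (V <= W)%VS -> \dim W = (\dim V + m)%N ->
  size (flagsn m W) = qfact m.
Proof.
elim: m W => [|m IH] W VW dW.
  have e : W == V by rewrite eq_sym eqEdim VW dW addn0 leqnn.
  by rewrite /= e.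
have := @big_flagsn int (fun=> 1) m W.
rewrite [RHS](eq_bigr (fun=> (qfact m)%:R)) => [|H hH]; last first.
  by rewrite big_const_seq count_predT iter_addr_0 IH ?(hyper_dim dW hH) //; case/andP: hH.
rewrite [LHS]big_const_seq count_predT iter_addr_0 sumr_const (card_hyper VW dW).
rewrite -(mulr_natr (qfact m)%:R) -natrM => /eqP.
by rewrite eqr_nat => /eqP ->; rewrite mulnC.
Qed.

Lemma nb_full_flagsE W : (V <= W)%VS -> nb_full_flags V W = qfact (\dim W - \dim V).
Proof.
move=> VW; set m := (_ - _)%N.
have dW : \dim W = (\dim V + m)%N by rewrite subnKC // dimvS.
rewrite -(size_flagsn VW dW) /nb_full_flags cardE -/m.
rewrite -(size_map (fun t : m.+1.-tuple (subsp F n) => t : seq (subsp F n))).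
apply/perm_size/uniq_perm.
- by rewrite map_inj_uniq ?enum_uniq //; apply: val_inj.
- exact: uniq_flagsn.
move=> K; rewrite mem_flagsn; apply/mapP/andP => [[t]|[hK sK]].
  by rewrite mem_enum inE => ht ->; rewrite size_tuple.
by exists (Tuple sK); rewrite // mem_enum inE.
Qed.

(** Let H0 be the second member of K. The term H = H0 is q^(dim H0) times K. For H != H0 and X = H
    :&: H0, the wedge relation replaces H < W > H0 by -(H > X < H0), and for fixed X these terms sum
    by (FS) on [X, W] to the path W > H0 > X < H0. The sum over X is the same problem inside H0. *)
Lemma hyper_sum_dpath m W K : is_flag_from_to V W K -> \dim W = (\dim V + m)%N ->
  \sum_(H | hyper W H) dpath V (W :: H :: K) = dpath V K *+ (q ^ \dim V * qnum m).
Proof.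
elim: m W K => [|m IH] W K hK dW.
  rewrite addn0 in dW; rewrite muln0 mulr0n big_pred0 // => H; exact: hyper0.
have [[|H0 t] eK] := is_flag_from_toP hK.
  move: hK; rewrite eK => /andP [/= /eqP e _]; move/eqP: dW.
  by rewrite e -[X in X == _]addn0 eqn_add2l.
move: hK; rewrite eK flag_from_cons => /andP [lH0 hH0].
have VH0 : (V <= H0)%VS by case/andP: hH0 => /flag_sub.
have hyH0 : hyper W H0 by rewrite /hyper VH0.
have dH0 := hyper_dim dW hyH0.
rewrite (big_hyper _ hyH0) dpathE (spath_wedge_eq [:: W] t lH0).
rewrite (eq_bigr (fun X => dpath V (W :: H0 :: X :: H0 :: t))) => [|X hX]; last first.
  have [VX lX] := andP hX; have bX : between X W H0 by rewrite /between lX.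
  have XW : (X <= W)%VS by apply: subv_trans (lessdot_sub lX) (lessdot_sub lH0).
  have dXW : \dim W = (\dim X).+2 by rewrite (lessdot_dim lH0) (lessdot_dim lX).
  have := @fs_dpath _ _ V [::] W X (H0 :: t) XW dXW; rewrite (bigD1 H0) //=.
  move/eqP; rewrite addr_eq0 => /eqP ->; rewrite -sumrN; apply: eq_bigr => H.
  move=> /andP [/andP [lXH lHW] nH].
  rewrite !dpathE (spath_wedge_neq [:: W] t lHW lH0 nH) (lessdot_meet lXH lX nH) /=.
  by rewrite raddfN.
rewrite (eq_bigr (fun X => spath [:: W; H0] *: dpath V (H0 :: X :: H0 :: t))) => [|X _]; last first.
  exact: dpath_cons.
rewrite -scaler_sumr (IH _ _ hH0 dH0) -scalerMnr -dpath_cons raddfMn /= -dpathE -mulrnDr.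
by rewrite -[(1 + q * qnum m)%N]/(qnum m.+1) qnumS mulnDr -expnD dH0.
Qed.

(** Peeling off the outermost steps, W > H and H < W enclose the same element for H, which acts as a
    scalar on the flags from H; the remaining sum over H is [hyper_sum_dpath]. *)
Lemma flag_sum_spath m W K : is_flag_from_to V W K -> \dim W = (\dim V + m)%N ->
  \sum_(L <- flagsn m W) (spath L * spath (rev L) : S) *: dpath V K =
  dpath V K *+ (q ^ (\dim V * m) * qfact m).
Proof.
elim: m W K => [|m IH] W K hK dW.
  have VW : (V <= W)%VS.
    by have [t e] := is_flag_from_toP hK; move: hK; rewrite e => /andP [/flag_sub].
  have WV : W = V by apply/eqP; rewrite eq_sym eqEdim VW dW addn0 leqnn.
  rewrite WV in hK *; rewrite /= eqxx big_seq1 (flag_from_V hK) /=.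
  by rewrite -dclassM !spathM //= eqxx /= spathM //= eqxx /= muln0 mulr1n.
rewrite big_flagsn.
pose c := (q ^ (\dim V * m) * qfact m)%N.
rewrite (eq_bigr (fun H => dpath V (W :: H :: K) *+ c)) => [|H hH].
  rewrite sumrMnl (hyper_sum_dpath hK dW) -mulrnA; congr (_ *+ _).
  by rewrite /c mulnS expnD /= -!mulnA; congr (_ * _)%N; rewrite mulnCA.
have [VH lH] := andP hH.
(* The induction hypothesis concerns flags from H, so (H < W)K is first written as a multiple of a
   single flag K' from H. *)
have [e0 [K' [hK' e]]] := spath_reduce hK lH VH.
have eHK : spath [:: H; W] * spath K = spath (H :: K) :> S.
  by have [t' ->] := is_flag_from_toP hK; rewrite -(spath_split [:: H]).
have := IH H K' hK' (hyper_dim dW hH).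
set N := (_ * e0) in e => hsum.
transitivity (spath [:: W; H] *: (dpath V (H :: K) *+ c)); last first.
  by rewrite -scalerMnr; have [t' ->] := is_flag_from_toP hK; rewrite -dpath_cons.
have eD : dpath V (H :: K) = dpath V K' *~ N by rewrite dpathE e raddfMz.
rewrite eD [_ *+ c]pmulrn mulrzAC -pmulrn -hsum.
rewrite mulrz_suml scaler_sumr big_seq [RHS]big_seq.
apply: eq_bigr => L; rewrite mem_flagsn => /andP [hL _].
have [t' eL] := is_flag_from_toP hL.
have -> : spath (W :: L) = spath [:: W; H] * spath L :> S.
  by rewrite eL -(spath_split [:: W]).
have -> : spath (rev (W :: L)) = spath (rev L) * spath [:: H; W] :> S.
  by rewrite eL !rev_cons -[rcons (rcons _ _) W]cats1 cat_rcons spath_split.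
transitivity (dclass V (spath [:: W; H] * (spath L * (spath (rev L) * (spath [:: H; W] * spath K))))).
  by rewrite dpathE -dclassM !mulrA.
by rewrite eHK e !mulrzAr raddfMz /= !dclassM -scalerA scalerMzr -dpathE.
Qed.

(** In L(rev L)K the product (rev L)K is already a multiple of (V), so the scalar of
    [flag_sum_spath] becomes a relation between the form and the flags. *)
Lemma omega m W K : is_flag_from_to V W K -> \dim W = (\dim V + m)%N ->
  \sum_(L <- flagsn m W) dpath V L *~ pairing V L K =
  dpath V K *+ (q ^ (\dim V * m) * qfact m).
Proof.
move=> hK dW; rewrite -(flag_sum_spath hK dW) big_seq [RHS]big_seq.
apply: eq_bigr => L; rewrite mem_flagsn => /andP [hL _].
have [hK' _] := andP hK; have [hL' _] := andP hL.
rewrite dpathE -dclassM -mulrA (spath_pairing hK' hL') mulrzAr raddfMz.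
by rewrite (spath_mul1 hL').
Qed.

End FullFlags.

(** * Bruhat decomposition *)

Section Bruhat.
Variables (F : finFieldType) (m : nat).
Local Notation G := (GLmat F m).
Implicit Types (g h u : G) (s t w : 'S_m).
Local Open Scope group_scope.

Lemma GLvalM g h : GLval (g * h) = (GLval g *m GLval h)%R.
Proof. by []. Qed.

Lemma GLvalV g : GLval g^-1 = invmx (GLval g).
Proof. by []. Qed.

Lemma GLpermM s t : GLperm F (s * t) = GLperm F s * GLperm F t.
Proof. by apply/val_inj; rewrite /= perm_mxM. Qed.

Lemma GLperm1 : GLperm F (1 : 'S_m) = 1 :> G.
Proof. by apply/val_inj; rewrite /= perm_mx1. Qed.

Lemma GLpermV s : GLperm F s^-1 = (GLperm F s)^-1.
Proof. by apply/(mulIg (GLperm F s)); rewrite mulVg -GLpermM mulVg GLperm1. Qed.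

Lemma GLperm_mulE s g i j : GLval (GLperm F s * g) i j = GLval g (s i) j.
Proof. by rewrite GLvalM -row_permE mxE. Qed.

Lemma GLmul_permE s g i j : GLval (g * GLperm F s) i j = GLval g i (s^-1 j).
Proof. by rewrite GLvalM -{1}[s]invgK -col_permE mxE. Qed.

Lemma in_BP g : reflect (forall i j : 'I_m, (j < i)%N -> GLval g i j = 0%R) (in_B g).
Proof.
apply: (iffP forallP) => [h i j ji|h i].
  by have /forallP /(_ j) /implyP /(_ ji) /eqP := h i.
by apply/forallP => j; apply/implyP => ji; apply/eqP/h.
Qed.

Lemma in_UP g : reflect (in_B g /\ forall i, GLval g i i = 1%R) (in_U g).
Proof.
apply: (iffP andP) => [[hB /forallP h]|[hB h]]; split=> //.
  by move=> i; apply/eqP.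
by apply/forallP => i; apply/eqP.
Qed.

Definition Bset : {set G} := [set g | in_B g].
Definition Uset : {set G} := [set g | in_U g].

Lemma Bset_group : group_set Bset.
Proof.
apply/group_setP; split=> [|g h]; rewrite !inE.
  apply/in_BP => i j ji; rewrite /= mxE; case: eqP => // e.
  by rewrite e ltnn in ji.
move=> /in_BP hg /in_BP hh; apply/in_BP => i j ji; rewrite GLvalM mxE big1 // => k _.
case: (ltnP k i) => ki; first by rewrite hg // mul0r.
by rewrite hh ?mulr0 // (leq_trans ji).
Qed.
Canonical B_group := Group Bset_group.

Lemma Uset_group : group_set Uset.
Proof.
apply/group_setP; split=> [|g h]; rewrite !inE.
  apply/in_UP; split=> [|i]; last by rewrite /= mxE eqxx.
  by have := group1 B_group; rewrite inE.
move=> /in_UP [hg1 hg2] /in_UP [hh1 hh2]; apply/in_UP; split=> [|i].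
  by have := @groupM _ B_group g h; rewrite !inE; apply.
rewrite GLvalM mxE (bigD1 i) //= hg2 hh2 mul1r big1 ?addr0 // => k ki.
move: ki; rewrite neq_ltn => /orP [ki|ki].
  by rewrite (in_BP _ hg1) // mul0r.
by rewrite (in_BP _ hh1) // mulr0.
Qed.
Canonical U_group := Group Uset_group.

Lemma in_U1 : in_U (1 : G).
Proof. by have := group1 U_group; rewrite inE. Qed.
Lemma in_UM g h : in_U g -> in_U h -> in_U (g * h).
Proof. by have := @groupM _ U_group g h; rewrite !inE; apply. Qed.
Lemma in_UV g : in_U g^-1 = in_U g.
Proof. by have := groupV U_group g; rewrite !inE. Qed.
Lemma xel_subproof (i j : 'I_m) (c : F) : i != j ->
  ((1%:M + c *: delta_mx i j : 'M[F]_m) \in unitmx)%R.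
Proof.
move=> ij; have : ((1%:M + c *: delta_mx i j : 'M[F]_m) *m (1%:M - c *: delta_mx i j) = 1%:M)%R.
  rewrite mulmxBr mulmx1 mulmxDl mul1mx -scalemxAl -scalemxAr mul_delta_mx_0 ?scaler0 1?eq_sym //.
  by rewrite addr0 addrK.
by case/mulmx1_unit.
Qed.

(* The elementary matrix 1 + c E_ij, or 1 if i = j. *)
Definition xel (i j : 'I_m) (c : F) : G :=
  if insub (1%:M + c *: delta_mx i j : 'M[F]_m)%R is Some g then g else 1.

Lemma xelE i j c : i != j -> GLval (xel i j c) = (1%:M + c *: delta_mx i j)%R.
Proof. by move=> ij; rewrite /xel insubT ?xel_subproof. Qed.

Lemma xel_in_U (i j : 'I_m) c : (i < j)%N -> in_U (xel i j c).
Proof.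
move=> ij; have nij : i != j by rewrite neq_ltn ij.
apply/in_UP; split=> [|a]; last first.
  rewrite xelE // !mxE eqxx /=; case: eqP => [->|_]; last by rewrite mulr0 addr0.
  by rewrite (negPf nij) mulr0 addr0.
apply/in_BP => a b ba; rewrite xelE // !mxE.
have -> : (a == b) = false by apply/negP => /eqP e; rewrite e ltnn in ba.
case: eqP => [e|_]; last by rewrite mulr0 addr0.
case: eqP => [e'|_]; last by rewrite mulr0 addr0.
by move: ba; rewrite e e' ltnNge ltnW.
Qed.

Lemma xel_conj s (i j : 'I_m) c : i != j ->
  GLperm F s * xel i j c * GLperm F s^-1 = xel (s^-1 i) (s^-1 j) c.
Proof.
move=> ij; apply/val_inj/matrixP => a b; rewrite /=.
rewrite -[LHS]/(GLval (GLperm F s * xel i j c * GLperm F s^-1) a b).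
rewrite GLmul_permE GLperm_mulE invgK !xelE ?(inj_eq perm_inj) // !mxE (inj_eq perm_inj).
have e x y : (x == s^-1 y) = (s x == y) by rewrite -(inj_eq (@perm_inj _ s)) permKV.
by rewrite !e.
Qed.

Lemma xel_mulE i j c g a b : i != j ->
  GLval (xel i j c * g) a b = (GLval g a b + (a == i)%:R * c * GLval g j b)%R.
Proof.
move=> ij; rewrite GLvalM xelE // mulmxDl mul1mx mxE; congr (_ + _)%R.
rewrite mxE (bigD1 j) //= big1 => [|k kj]; last first.
  by rewrite !mxE (negPf kj) andbF mulr0 mul0r.
by rewrite addr0 !mxE eqxx andbT (mulrC c).
Qed.

Lemma GL_row_neq0 g (i : 'I_m) : exists j, GLval g i j != 0%R.
Proof.
apply/existsP; apply: contraT; rewrite negb_exists => /forallP h.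
have : (GLval g *m invmx (GLval g) = 1%:M)%R by rewrite mulmxV ?(Defs.GLvalP g).
move/matrixP => /(_ i i); rewrite !mxE eqxx big1.
  by move/esym/eqP; rewrite oner_eq0.
by move=> k _; have := h k; rewrite negbK => /eqP ->; rewrite mul0r.
Qed.

Definition lead g (i : 'I_m) : 'I_m :=
  [arg min_(j < xchoose (GL_row_neq0 g i) | GLval g i j != 0%R) j].

Lemma leadP g i : GLval g i (lead g i) != 0%R /\
  (forall j : 'I_m, (j < lead g i)%N -> GLval g i j = 0%R).
Proof.
rewrite /lead; have h0 := xchooseP (GL_row_neq0 g i).
case: (@arg_minnP _ (xchoose (GL_row_neq0 g i)) (fun j => GLval g i j != 0%R) (fun j : 'I_m => j : nat) h0) => j hj hmin.
split=> // k; rewrite ltnNge => kj; by apply/eqP; apply: contraNT kj => /hmin.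
Qed.

Lemma lead_lt g i (c : 'I_m) : (forall j : 'I_m, (j <= c)%N -> GLval g i j = 0%R) ->
  (c < lead g i)%N.
Proof.
by move=> h; rewrite ltnNge; apply/negP => /h e; have [] := leadP g i; rewrite e eqxx.
Qed.

Lemma lead_eq g h i : (forall j, GLval g i j = GLval h i j) -> lead g i = lead h i.
Proof.
move=> e; apply/val_inj/eqP; rewrite eqn_leq /=; apply/andP; split; rewrite leqNgt.
  by apply/negP => /(proj2 (leadP g i)); rewrite e; apply/eqP; case: (leadP h i).
by apply/negP => /(proj2 (leadP h i)); rewrite -e; apply/eqP; case: (leadP g i).
Qed.

(* Choosing u in U so that the leading columns of the rows of u g are as far to the
   right as possible makes these columns pairwise distinct. *)
Lemma bruhat g : exists u w, in_U u /\ in_B ((u * GLperm F w)^-1 * g).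
Proof.
pose v u := (\sum_(i < m) (lead (u * g)%g i : nat))%N.
have [u0 hu0 hmax] : exists2 u, in_U u & forall u', in_U u' -> (v u' <= v u)%N.
  by case: (@arg_maxnP _ 1 (@in_U F m) v in_U1) => u hu hmax; exists u.
set A := u0 * g.
have neq_case (i j : 'I_m) : (i < j)%N -> lead A i = lead A j -> False.
  move=> ij e; have nij : i != j by rewrite neq_ltn ij.
  have [hi hi'] := leadP A i; have [hj hj'] := leadP A j.
  pose c := (- (GLval A i (lead A i) / GLval A j (lead A i)))%R.
  have hu1 : in_U (xel i j c * u0) by rewrite in_UM ?xel_in_U.
  have := hmax _ hu1; rewrite leqNgt => /negP; apply.
  have hA a b : GLval (xel i j c * u0 * g) a b = (GLval A a b + (a == i)%:R * c * GLval A j b)%R.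
    by rewrite -mulgA xel_mulE.
  rewrite /v (bigD1 i) //= [X in (_ < X)%N](bigD1 i) //= -addSn leq_add //.
    apply: lead_lt => k; rewrite hA eqxx mul1r leq_eqVlt => /orP [/eqP/val_inj ->|lk].
      rewrite /c mulNr divfK ?subrr //; by rewrite e.
    by rewrite hi' // hj' ?mulr0 ?addr0 // -e.
  apply: leq_sum => a na; rewrite leq_eqVlt; apply/orP; left; apply/eqP; congr nat_of_ord.
  by apply: lead_eq => b; rewrite hA (negPf na) !mul0r addr0.
have inj_lead : injective (lead A).
  move=> i j e; apply/eqP; apply: contraT; rewrite neq_ltn => /orP [ij|ij].
    by case: (neq_case _ _ ij e).
  by case: (neq_case _ _ ij (esym e)).
pose w := perm inj_lead.
exists u0^-1, w; rewrite in_UV; split=> //.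
have -> : (u0^-1 * GLperm F w)^-1 * g = GLperm F w^-1 * A.
  by rewrite invMg invgK GLpermV mulgA.
apply/in_BP => i j ji; rewrite GLperm_mulE; apply: (proj2 (leadP A _)).
by have := permKV w i; rewrite /w permE => ->.
Qed.

(* The diagonal entries of the unitriangular u force s i <= t i for all i. *)
Lemma bruhat_uniq u s t : in_U u -> in_B (GLperm F s^-1 * u * GLperm F t) -> s = t.
Proof.
move=> /in_UP [_ hu] /in_BP hB; have le i : (s i <= t i)%N.
  rewrite leqNgt; apply/negP => /hB; rewrite GLmul_permE GLperm_mulE !permK hu.
  by move/eqP; rewrite oner_eq0.
have sum_s (r : 'S_m) : (\sum_i (r i : nat) = \sum_(i < m) i)%N.
  by rewrite [RHS](reindex_inj (@perm_inj _ r)).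
have [_] := leqif_sum (fun i (_ : true) => leqif_eq (le i)).
rewrite !sum_s eqxx => /esym /forallP h; apply/permP => i.
by have /implyP /(_ isT) /eqP := h i; apply: val_inj.
Qed.

Lemma rev_permP : injective (@rev_ord m).
Proof. exact: rev_ord_inj. Qed.
Definition w0 : 'S_m := perm rev_permP.

Lemma w0E i : w0 i = rev_ord i.
Proof. by rewrite permE. Qed.

Lemma w0V : w0^-1 = w0.
Proof.
apply/(mulgI w0); rewrite mulgV; apply/permP => i.
by rewrite perm1 permM !w0E rev_ordK.
Qed.

(** Conjugation by w0 reverses rows and columns, so u is lower as well as upper triangular. *)
Lemma bruhat_w0 u : in_U u -> in_B (GLperm F w0^-1 * u * GLperm F w0) -> u = 1.
Proof.
move=> /in_UP [/in_BP h1 h2] /in_BP h3; apply/val_inj/matrixP => i j.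
rewrite /= mxE; case: (eqVneq i j) => [->|nij]; first exact: h2.
move: nij; rewrite neq_ltn => /orP [ij|ji]; last exact: h1.
have := h3 (w0 i) (w0 j); rewrite GLmul_permE GLperm_mulE !permK; apply.
by rewrite !w0E /=; apply: ltn_sub2l; [apply: leq_ltn_trans ij (ltn_ord j) | rewrite ltnS].
Qed.

(** Without ascents w is strictly decreasing; counting from the left gives w i <= m - 1 - i, and
    counting from the right gives the reverse inequality. *)
Lemma w0_max w : (forall i j : 'I_m, j = i.+1 :> nat -> ~~ (w i < w j)%N) -> w = w0.
Proof.
move=> h; have h' (i j : 'I_m) : j = i.+1 :> nat -> (w j < w i)%N.
  move=> e; have := h i j e; rewrite -leqNgt leq_eqVlt => /orP [/eqP /val_inj /perm_inj e'|//].
  by move: e; rewrite e' => /n_Sn.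
have up_ k (i : 'I_m) : i = k :> nat -> (w i + k < m)%N.
  elim: k i => [|k IH] i ik; first by rewrite addn0.
  have km : (k < m)%N by rewrite -ltnS ltnW // ltnS -ik.
  have := IH (Ordinal km) erefl; have := h' (Ordinal km) i ik.
  by move=> h1 h2; apply: leq_ltn_trans h2; rewrite addnS -addSn leq_add2r.
have dn k (i : 'I_m) : (i + k).+1 = m -> (k <= w i)%N.
  elim: k i => [|k IH] i ik //.
  have im : (i.+1 < m)%N by apply: leq_trans (eq_leq ik); rewrite addnS !ltnS leq_addr.
  have := IH (Ordinal im); rewrite /= addSnnS => /(_ ik) h1.
  by apply: leq_ltn_trans h1 (h' i (Ordinal im) erefl).
apply/permP => i; apply/val_inj; rewrite w0E /=; apply/eqP; rewrite eqn_leq.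
have him := ltn_ord i; apply/andP; split.
  by rewrite -(leq_add2r i.+1) subnK // addnS; apply: up_.
by apply: dn; rewrite -addSn subnKC.
Qed.

End Bruhat.

(** * Flags as cosets *)

Section GroupFlags.
Variables (F : finFieldType) (n m : nat) (V W : subsp F n).
Variable phi : 'Hom('cV[F]_n, 'cV[F]_m).
Hypothesis VW : (V <= W)%VS.
Hypothesis hphi : quot_iso V W phi.
Local Notation G := (GLmat F m).
Implicit Types (g h u : G) (X Y U : subsp F n).
Implicit Types K L : seq (subsp F n).

Lemma quot_dim : \dim W = (\dim V + m)%N.
Proof.
have [h1 h2] := hphi; have := limg_ker_dim phi W.
by rewrite capvC h1 h2 dimvf /dim /= muln1.
Qed.

Lemma phi_lift (y : 'cV[F]_m) : exists2 x, x \in W & phi x = y.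
Proof.
have [h1 _] := hphi; have : y \in (phi @: W)%VS by rewrite h1 memvf.
by move=> /memv_imgP [x xW ->]; exists x.
Qed.

Lemma phi_V x : x \in W -> (phi x == 0) = (x \in V).
Proof. by have [_ <-] := hphi; rewrite memv_cap memv_ker => ->; rewrite andbT. Qed.

(** The coordinates of [phi x] with respect to the columns of g, with the first i set to zero. Its
    kernel in W is the preimage of the span of the first i columns, obtained without choosing lifts
    of them. *)
Definition trunc g (i : nat) : 'Hom('cV[F]_n, 'cV[F]_m) :=
  (linfun (mulmx (copid_mx i *m invmx (GLval g))) \o phi)%VF.

Definition gspace g i : subsp F n := (W :&: lker (trunc g i))%VS.

Lemma copidE (i : nat) (y : 'cV[F]_m) r k : (copid_mx i *m y) r k = if (r < i)%N then 0 else y r k.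
Proof.
rewrite /copid_mx mulmxBl mul1mx !mxE (bigD1 r) //= big1 => [|j jr]; last first.
  by rewrite mxE eq_sym (negPf (jr : (j : nat) != r)) mul0r.
by rewrite mxE eqxx /=; case: ifP => _; rewrite ?mul1r ?mul0r addr0 ?subrr ?subr0.
Qed.

Lemma mem_gspace g i x : reflect
  (x \in W /\ exists2 z : 'cV[F]_m, phi x = GLval g *m z & forall r : 'I_m, (i <= r)%N -> z r 0 = 0)
  (x \in gspace g i).
Proof.
rewrite memv_cap memv_ker /trunc comp_lfunE lfunE /= -mulmxA.
apply: (iffP andP) => [[xW /eqP e]|[xW [z e hz]]]; split=> //.
  exists (invmx (GLval g) *m phi x); first by rewrite mulKVmx // GLvalP.
  move=> r ir; move/matrixP: e => /(_ r 0); rewrite copidE.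
  by rewrite [RHS]mxE ltnNge ir.
apply/eqP/matrixP => r k; rewrite e mulKmx ?GLvalP // copidE [RHS]mxE.
by rewrite ord1; case: ltnP => // /hz.
Qed.

Lemma gspace_sub g i j : (i <= j)%N -> (gspace g i <= gspace g j)%VS.
Proof.
move=> ij; apply/subvP => x /mem_gspace [xW [z e hz]]; apply/mem_gspace.
by split=> //; exists z => // r jr; apply: hz; apply: leq_trans jr.
Qed.

Lemma fsub0 g : gspace g 0 = V.
Proof.
apply/vspaceP => x; apply/mem_gspace/idP => [[xW [z e hz]]|xV].
  rewrite -phi_V // e (_ : z = 0) ?mulmx0 //.
  by apply/matrixP => r k; rewrite ord1 mxE hz.
have xW : x \in W by apply: (subvP VW).
split=> //; exists 0; last by move=> r _; rewrite mxE.
by rewrite mulmx0; apply/eqP; rewrite phi_V.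
Qed.

Lemma gspace_m g : gspace g m = W.
Proof.
apply/vspaceP => x; apply/mem_gspace/idP => [[]//|xW]; split=> //.
exists (invmx (GLval g) *m phi x); first by rewrite mulKVmx // GLvalP.
by move=> r; rewrite leqNgt ltn_ord.
Qed.

Lemma gspace_step g i : (i < m)%N -> (\dim (gspace g i.+1) <= (\dim (gspace g i)).+1)%N.
Proof.
move=> im; have [a aW ea] := phi_lift (GLval g *m delta_mx (Ordinal im) 0).
have h : (gspace g i.+1 <= gspace g i + <[a]>)%VS.
  apply/subvP => x /mem_gspace [xW [z e hz]].
  rewrite -[x](subrK (z (Ordinal im) 0 *: a)); apply: memv_add; last first.
    by rewrite memvZ // memv_line.
  apply/mem_gspace; split; first by rewrite rpredB // memvZ.
  exists (z - z (Ordinal im) 0 *: delta_mx (Ordinal im) 0).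
    by rewrite raddfB /= linearZ /= e ea mulmxBr -scalemxAr.
  move=> r ir; rewrite !mxE eqxx andbT; case: eqP => [->|/eqP nr].
    by rewrite mulr1 subrr.
  rewrite mulr0 subr0 hz // ltn_neqAle ir andbT; apply: contra nr => /eqP e'.
  by apply/eqP/val_inj.
apply: leq_trans (dimvS h) _.
have := dimv_sum_cap (gspace g i) <[a]>; rewrite dim_vline => e.
apply: (@leq_trans (\dim (gspace g i + <[a]>) + \dim (gspace g i :&: <[a]>))).
  exact: leq_addr.
by rewrite e; case: (a != 0); rewrite ?addn1 ?addn0.
Qed.

(** The chain climbs from V to W, of relative dimension m, in m steps of at most one dimension each,
    so every step gains exactly one. *)
Lemma dim_gspace g i : (i <= m)%N -> \dim (gspace g i) = (\dim V + i)%N.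
Proof.
have up_ j : (j <= m)%N -> (\dim (gspace g j) <= \dim V + j)%N.
  elim: j => [|j IH] jm; first by rewrite fsub0 addn0.
  by apply: leq_trans (gspace_step g jm) _; rewrite addnS ltnS IH // ltnW.
have dn k : (k <= m)%N -> (\dim V + (m - k) <= \dim (gspace g (m - k)))%N.
  elim: k => [|k IH] km; first by rewrite subn0 gspace_m quot_dim.
  have h := IH (ltnW km); have e : (m - k)%N = (m - k.+1).+1 by rewrite subnSK.
  have h' : (m - k.+1 < m)%N by rewrite -subn_gt0 subKn.
  have := leq_trans h (eq_leq (congr1 (fun j => \dim (gspace g j)) e)).
  by move=> /leq_trans /(_ (gspace_step g h')); rewrite e addnS ltnS.
move=> im; apply/eqP; rewrite eqn_leq up_ //=.
by have := dn (m - i)%N (leq_subr _ _); rewrite subKn.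
Qed.

Lemma lessdot_gspace g i : (i < m)%N -> lessdot (gspace g i) (gspace g i.+1).
Proof.
move=> im; apply/lessdotP; split; first exact: gspace_sub.
by rewrite !dim_gspace // ?addnS // ltnW.
Qed.

Lemma between_gspace g i : (i.+1 < m)%N -> between (gspace g i) (gspace g i.+2) (gspace g i.+1).
Proof. by move=> im; rewrite /between !lessdot_gspace // ltnW. Qed.

Lemma gspace_eq g h i : (i <= m)%N ->
  (forall z : 'cV[F]_m, (forall r : 'I_m, (i <= r)%N -> z r 0 = 0) ->
     forall r : 'I_m, (i <= r)%N -> (GLval h *m z) r 0 = 0) ->
  gspace (g * h)%g i = gspace g i.
Proof.
move=> im hz; apply/eqP; rewrite eqEdim !dim_gspace // leqnn andbT.
apply/subvP => x /mem_gspace [xW [z e sz]]; apply/mem_gspace; split=> //.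
by exists (GLval h *m z); [rewrite e GLvalM mulmxA | apply: hz].
Qed.

Fixpoint gflag_rec g i : seq (subsp F n) := if i is j.+1 then gspace g i :: gflag_rec g j else [:: gspace g 0].
(* The coset gB as a flag: W_i / V is spanned by the first i columns of g. *)
Definition gflag g := gflag_rec g m.

Lemma size_gflag_rec g i : size (gflag_rec g i) = i.+1.
Proof. by elim: i => //= i ->. Qed.

Lemma gflag_rec_head g i : exists t, gflag_rec g i = gspace g i :: t.
Proof. by case: i => [|i]; eexists. Qed.

Lemma gflag_rec_flag g i : (i <= m)%N -> is_flag_to V (gflag_rec g i).
Proof.
elim: i => [|i IH] im; first by rewrite /= fsub0.
have := IH (ltnW im); have [t e] := gflag_rec_head g i.
by rewrite [gflag_rec g i.+1]/= e flag_cons => ->; rewrite lessdot_gspace.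
Qed.

Lemma gflag_flag g : is_flag_from_to V W (gflag g).
Proof.
rewrite /is_flag_from_to /gflag gflag_rec_flag //; have [t ->] := gflag_rec_head g m.
by rewrite /= gspace_m eqxx.
Qed.

Lemma gflag_rec_inj g h i : gflag_rec g i = gflag_rec h i -> forall j, (j <= i)%N -> gspace g j = gspace h j.
Proof.
elim: i => [e j|i IH e j]; have e1 := congr1 (head V) e.
  by rewrite leqn0 => /eqP ->.
have e2 := congr1 behead e.
by rewrite leq_eqVlt => /orP [/eqP -> //|]; rewrite ltnS; apply: IH.
Qed.

Lemma gflag_rec_eq g h i : (forall j, (j <= i)%N -> gspace g j = gspace h j) -> gflag_rec g i = gflag_rec h i.
Proof.
elim: i => [|i IH] e /=; first by rewrite e.
by rewrite e // IH // => j ji; apply: e; apply: leqW.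
Qed.

Lemma gflag_eqP g h : reflect (gflag g = gflag h) (in_B (g^-1 * h)%g).
Proof.
apply: (iffP (in_BP _)) => [hB|e].
  apply: gflag_rec_eq => i im; rewrite -[h in RHS](mulKVg g); apply/esym/gspace_eq => // z hz r ir.
  rewrite mxE big1 // => k _; case: (ltnP k i) => ki; last by rewrite hz ?mulr0.
  by rewrite hB ?mul0r // (leq_trans ki).
move=> i j ji; have [x xW ex] := phi_lift (GLval h *m delta_mx j 0).
have : x \in gspace h j.+1.
  apply/mem_gspace; split=> //; exists (delta_mx j 0) => // r jr.
  by rewrite mxE; case: eqP => [e'|//]; rewrite e' ltnn in jr.
rewrite -(gflag_rec_inj e) => [/mem_gspace [_ [z ez hz]]|]; last exact: ltn_ord.
have -> : GLval (g^-1 * h)%g i j = z i 0; last exact: hz.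
have -> : z = GLval (g^-1 * h)%g *m delta_mx j 0.
  by rewrite GLvalM -mulmxA -ex ez GLvalV mulKmx // GLvalP.
by rewrite -colE [RHS]mxE.
Qed.

Lemma gflag_mul g b : in_B b -> gflag (g * b)%g = gflag g.
Proof. by move=> hb; apply/esym/gflag_eqP; rewrite mulKg. Qed.

(** Vectors chosen in the successive differences of the flag map under phi to the columns of g.
    These columns span because the largest member of the flag is W. *)
Lemma gflag_surj K : is_flag_from_to V W K -> exists g, gflag g = K.
Proof.
move=> hK; have sK : size K = m.+1.
  have := size_flag hK; rewrite quot_dim => /eqP; rewrite eqn_add2l => /eqP e.
  by have [t eK] := is_flag_from_toP hK; rewrite eK /= in e *; rewrite e.
have [t eK] := is_flag_from_toP hK.
have [hp hl] : path (@gtrdot F n) W t /\ last W t = V.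
  by move: hK; rewrite eK => /andP [/andP [h /eqP]].
have st : size t = m by move: sK; rewrite eK => -[].
(* ch i is the i-dimensional member of the flag *)
pose ch i := nth V K (m - i).
have chS i : (i < m)%N -> lessdot (ch i) (ch i.+1).
  move=> im; have hlt : (m - i.+1 < size t)%N by rewrite st -subn_gt0 subKn.
  by have /(pathP V) /(_ _ hlt) := hp; rewrite /ch eK -(subnSK im).
have ch0 : ch 0%N = V by rewrite /ch subn0 eK -st -hl -last_nth.
have chm : ch m = W by rewrite /ch subnn eK.
have ex (i : 'I_m) : exists a, (a \in ch i.+1) && (a \notin ch i).
  by have [a h1 h2] := lessdot_vec (chS i (ltn_ord i)); exists a; rewrite h1.
pose a (i : 'I_m) := xchoose (ex i).
have ha1 i : a i \in ch i.+1 by have /andP [] := xchooseP (ex i).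
have ha2 i : a i \notin ch i by have /andP [] := xchooseP (ex i).
pose A : 'M[F]_m := \matrix_(r, c) phi (a c) r 0.
have chW i : (i <= m)%N -> (ch i <= W)%VS.
  move=> im; rewrite -chm -(subKn im); elim: (m - i)%N (leq_subr i m) => [|k IH] km.
    by rewrite subn0.
  apply: subv_trans (IH (ltnW km)); rewrite -(subnSK km).
  apply: lessdot_sub; apply: chS; by rewrite -subn_gt0 subKn.
have hA i x : (i <= m)%N -> x \in ch i ->
    exists2 z : 'cV[F]_m, phi x = A *m z & forall r : 'I_m, (i <= r)%N -> z r 0 = 0.
  elim: i x => [|i IH] x im xi.
    exists 0; last by move=> r _; rewrite mxE.
    by rewrite mulmx0; apply/eqP; rewrite phi_V // ?(subvP VW) // -ch0.
  pose I := Ordinal im.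
  have := lessdot_lineE (chS i im) (ha1 I) (ha2 I).
  move: xi => /[swap] -> /memv_addP [y yi [_ /vlineP [c ->] ->]].
  have [z e hz] := IH y (ltnW im) yi.
  exists (z + c *: delta_mx I 0).
    rewrite raddfD /= linearZ /= e mulmxDr -scalemxAr -colE; congr (_ + _ *: _).
    by apply/matrixP => r k; rewrite !mxE ord1.
  move=> r ir; rewrite !mxE hz ?(ltnW ir) //.
  case: eqP => [e'|_]; first by rewrite e' ltnn in ir.
  by rewrite mulr0 addr0.
have uA : A \in unitmx.
  have hz (y : 'cV[F]_m) : exists z : 'cV[F]_m, y == A *m z.
    have [x xW <-] := phi_lift y; have [|z -> _] := hA m x (leqnn m); first by rewrite chm.
    by exists z.
  have : A *m (\matrix_(r, c) (xchoose (hz (delta_mx c 0))) r 0) = 1%:M.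
    apply/matrixP => i j; have /eqP := xchooseP (hz (delta_mx j 0)).
    move/matrixP => /(_ i 0); rewrite mxE andbT => e.
    transitivity ((A *m xchoose (hz (delta_mx j 0))) i 0); last by rewrite -e !mxE.
    by rewrite [LHS]mxE [RHS]mxE; apply: eq_bigr => k _; rewrite [X in _ * X = _]mxE.
  by case/mulmx1_unit.
exists (MkGL uA).
have efs i : (i <= m)%N -> gspace (MkGL uA) i = ch i.
  move=> im; apply/esym/eqP; rewrite eqEdim dim_gspace //; apply/andP; split.
    apply/subvP => x xi; apply/mem_gspace; split; first exact: (subvP (chW i im)).
    by have [z e hz] := hA i x im xi; exists z.
  elim: i im => [|i IH] im; first by rewrite addn0 ch0.
  by rewrite (lessdot_dim (chS i im)) addnS ltnS IH // ltnW.
have efl i : (i <= m)%N -> gflag_rec (MkGL uA) i = drop (m - i) K.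
  elim: i => [|i IH] im.
    rewrite /= efs // subn0 [RHS](drop_nth V) ?sK // -[nth _ _ _]/(nth V K m).
    by rewrite drop_oversize ?sK // /ch subn0.
  rewrite [gflag_rec _ i.+1]/= IH ?(ltnW im) // efs // -(subnSK im).
  by rewrite [RHS](drop_nth V) ?sK // ltnS leq_subr.
by rewrite /gflag efl // subnn drop0.
Qed.

End GroupFlags.

(** * Straightening to the big cell, and apartments as the dual basis *)

Section Expansion.
Variables (F : finFieldType) (n m : nat) (V W : subsp F n).
Variable phi : 'Hom('cV[F]_n, 'cV[F]_m).
Hypothesis VW : (V <= W)%VS.
Hypothesis hphi : quot_iso V W phi.
Local Notation G := (GLmat F m).
Implicit Types (g h u : G) (X Y U : subsp F n).
Implicit Types K L : seq (subsp F n).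
Local Notation gspace := (gspace W phi).
Local Notation gflag_rec := (gflag_rec W phi).
Local Notation gflag := (gflag W phi).

Lemma xs_mulE (i j : 'I_m) c (z : 'cV[F]_m) r : i != j ->
  (GLval (xel i j c * GLperm F (tperm i j))%g *m z) r 0 =
  if r == i then z j 0 + c * z i 0 else if r == j then z i 0 else z r 0.
Proof.
move=> ij; rewrite GLvalM xelE // -mulmxA -row_permE mulmxDl mul1mx -scalemxAl !mxE.
rewrite (bigD1 j) //= big1 ?addr0 => [|k kj]; last by rewrite !mxE (negPf kj) andbF mul0r.
rewrite !mxE eqxx andbT tpermR.
case: (eqVneq r i) => [->|ri]; first by rewrite tpermL mul1r.
rewrite mul0r mulr0 addr0; case: (eqVneq r j) => [->|rj]; first by rewrite tpermR.
by rewrite tpermD // eq_sym.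
Qed.

(** The right factor mixes only the coordinates i and i + 1, so it preserves the span of the first k
    coordinates unless k = i + 1. Together with 1, these q elements represent the B-cosets of a
    minimal parabolic subgroup. *)
Lemma gspace_xs g (i j : 'I_m) c k : j = i.+1 :> nat -> (k <= m)%N -> k != j ->
  gspace (g * (xel i j c * GLperm F (tperm i j)))%g k = gspace g k.
Proof.
move=> ji km kj; have ij : (i < j)%N by rewrite ji.
have nij : i != j by rewrite neq_ltn ij.
apply: (gspace_eq VW hphi) => // z hz r kr; rewrite xs_mulE //.
case: eqP => [e|_].
  have ki : (k <= i)%N by rewrite -e.
  have kj' : (k <= j)%N by rewrite ji leqW.
  by rewrite (hz i ki) (hz j kj') mulr0 addr0.
case: eqP => [e|_]; last exact: hz.
by rewrite hz // -ltnS -ji ltn_neqAle kj -e.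
Qed.

Lemma gflag_rec_split g i k : gflag_rec g (i + k) =
  [seq gspace g j | j <- rev (iota i.+1 k)] ++ gflag_rec g i.
Proof.
elim: k => [|k IH]; first by rewrite addn0.
by rewrite addnS -(addn1 k) iotaD rev_cat map_cat /= IH addSn.
Qed.

Lemma gflag_split g i : (i.+1 < m)%N -> gflag g =
  [seq gspace g j | j <- rev (iota i.+3 (m - i.+2))] ++
  gspace g i.+2 :: gspace g i.+1 :: gflag_rec g i.
Proof. by move=> im; have := gflag_rec_split g i.+2 (m - i.+2); rewrite subnKC. Qed.

Lemma gflag_xs g (i j : 'I_m) c : j = i.+1 :> nat ->
  gflag (g * (xel i j c * GLperm F (tperm i j)))%g =
  [seq gspace g j | j <- rev (iota i.+3 (m - i.+2))] ++
  gspace g i.+2 :: gspace (g * (xel i j c * GLperm F (tperm i j)))%g i.+1 :: gflag_rec g i.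
Proof.
move=> ji; have im : (i.+1 < m)%N by rewrite -ji.
rewrite (gflag_split _ im); congr (_ ++ _ :: _ :: _).
- apply/eq_in_map => k; rewrite mem_rev mem_iota => /andP [ik km].
  rewrite gspace_xs //; first by move: km; rewrite addSn subnKC.
  by rewrite ji gtn_eqF // ltnW.
- by rewrite gspace_xs // ji gtn_eqF.
- have le k : (k <= i)%N -> gspace (g * (xel i j c * GLperm F (tperm i j)))%g k = gspace g k.
    move=> ki; rewrite gspace_xs ?ji ?ltn_eqF // ltnW //; apply: leq_ltn_trans ki _.
    by rewrite ltnW.
  exact: gflag_rec_eq.
Qed.

(** (FS) on the interval from [gspace g i] to [gspace g i.+2]. With a and b lifting the columns i
    and j of g, the flag of g goes through the point a at infinity, and the flag indexed by c goes
    through b + c a. *)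
Lemma fs_group (M : zmodType) (f : seq (subsp F n) -> M) g (i j : 'I_m) :
  fs_fun f -> j = i.+1 :> nat ->
  f (gflag g) = - \sum_(c : F) f (gflag (g * (xel i j c * GLperm F (tperm i j)))%g).
Proof.
move=> hf ji; have im : (i.+1 < m)%N by rewrite -ji.
have ij : (i < j)%N by rewrite ji.
have nij : i != j by rewrite neq_ltn ij.
apply/eqP; rewrite -addr_eq0; apply/eqP.
pose s1 := [seq gspace g j | j <- rev (iota i.+3 (m - i.+2))].
have [a aW ea] := phi_lift hphi (GLval g *m delta_mx i 0).
have [b bW eb] := phi_lift hphi (GLval g *m delta_mx j 0).
have bfs := between_gspace VW hphi g im; have [l1 l2] := andP bfs.
have ma : a \in gspace g i.+1.
  apply/mem_gspace; split=> //; exists (delta_mx i 0) => // r ir.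
  by rewrite mxE; case: eqP => [e|//]; rewrite e ltnn in ir.
have na : a \notin gspace g i.
  apply/negP => /mem_gspace [_ [z]]; rewrite ea => /(congr1 (mulmx (invmx (GLval g)))).
  rewrite !mulKmx ?Defs.GLvalP // => <- /(_ i (leqnn _)); rewrite mxE !eqxx.
  by move/eqP; rewrite oner_eq0.
have mb : b \in gspace g i.+2.
  apply/mem_gspace; split=> //; exists (delta_mx j 0) => // r ir.
  by rewrite mxE; case: eqP => [e|//]; rewrite e ji ltnn in ir.
have nb : b \notin gspace g i.+1.
  apply/negP => /mem_gspace [_ [z]]; rewrite eb => /(congr1 (mulmx (invmx (GLval g)))).
  rewrite !mulKmx ?Defs.GLvalP // => <- /(_ j); rewrite ji leqnn => /(_ isT).
  by rewrite mxE !eqxx => /eqP; rewrite oner_eq0.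
have eX : gspace g i.+1 = (gspace g i + <[a]>)%VS := lessdot_lineE l1 ma na.
have eXc c : gspace (g * (xel i j c * GLperm F (tperm i j)))%g i.+1 = (gspace g i + <[b + c *: a]>)%VS.
  apply: lessdot_lineE.
  - have := lessdot_gspace VW hphi (g * (xel i j c * GLperm F (tperm i j)))%g (ltnW im).
    have ni : (i : nat) != j by rewrite ltn_eqF.
    by rewrite (gspace_xs g c ji (ltnW (ltn_ord i)) ni).
  - apply/mem_gspace; split; first by rewrite rpredD // memvZ.
    exists (delta_mx i 0); last first.
      by move=> r ir; rewrite mxE; case: eqP => [e|//]; rewrite e ltnn in ir.
    have -> : phi (b + c *: a) = GLval g *m delta_mx j 0 + c *: (GLval g *m delta_mx i 0).
      by rewrite raddfD /= linearZ /= ea eb.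
    rewrite GLvalM -mulmxA.
    have -> : GLval (xel i j c * GLperm F (tperm i j))%g *m delta_mx i 0 = delta_mx j 0 + c *: delta_mx i 0 :> 'cV[F]_m.
      apply/matrixP => r k; rewrite ord1 xs_mulE // !mxE !eqxx !andbT.
      case: (eqVneq r i) => [->|ri]; first by rewrite (negPf nij) eq_sym (negPf nij) mulr1.
      by rewrite mulr0 addr0; case: (eqVneq r j) => [_|_]; rewrite ?eqxx // ?(negPf ri).
    by rewrite mulmxDr -scalemxAr.
  - apply: contra nb => h; have hc := subvP (lessdot_sub l1) _ h.
    by have := memvB hc (memvZ c ma); rewrite addrK.
have UY : (gspace g i <= gspace g i.+2)%VS by apply: gspace_sub; rewrite ltnW.
have dY : \dim (gspace g i.+2) = (\dim (gspace g i)).+2.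
  exact: etrans (lessdot_dim l2) (congr1 S (lessdot_dim l1)).
have [t et] := gflag_rec_head W phi g i.
have := hf s1 (gspace g i.+2) (gspace g i) t UY dY.
rewrite (big_between _ (a := a) (b := b)) -?eX // => e; rewrite -[RHS]e.
rewrite (gflag_split _ im) -/s1 et; congr (_ + _); apply: eq_bigr => c _.
by rewrite gflag_xs // -/s1 et eXc.
Qed.

(* Descending along s_i lengthens w whenever it has an ascent at i. *)
Lemma fs_group_ind (M : zmodType) (f : seq (subsp F n) -> M) : fs_fun f ->
  (forall u, in_U u -> f (gflag (u * GLperm F (w0 m)))%g = 0) ->
  forall g, f (gflag g) = 0.
Proof.
move=> hf h0 g; have [u [w [hu hB]]] := bruhat g.
have -> : gflag g = gflag (u * GLperm F w)%g by apply/esym/(gflag_eqP VW hphi).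
(* By the rearrangement inequality [mu] drops when two neighbouring values of w^-1 forming an ascent
   are exchanged. *)
move: {hB} u hu; pose mu (w : 'S_m) := (\sum_(a < m) a * (w^-1)%g a)%N.
have [N] := ubnP (mu w); elim: N w => // N IH w hN u hu.
have [/existsP [i /existsP [j /andP [/eqP ji asc]]]|nex] :=
  boolP [exists i : 'I_m, exists j : 'I_m, (j == i.+1 :> nat) && ((w^-1)%g i < (w^-1)%g j)%N].
  have ij : (i < j)%N by rewrite ji.
have nij : i != j by rewrite neq_ltn ij.
  rewrite (fs_group _ hf ji) big1 ?oppr0 // => c _.
  (* Moving the elementary matrix past w turns the index pair (i, j) into (w^-1 i, w^-1 j), which is
     still increasing at an ascent, so the left factor stays in U. *)
  have -> : (u * GLperm F w * (xel i j c * GLperm F (tperm i j)) =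
      (u * xel (w^-1 i) (w^-1 j) c) * GLperm F (w * tperm i j))%g.
    by rewrite -xel_conj // GLpermM GLpermV !mulgA mulgKV.
  apply: IH; last by rewrite in_UM // xel_in_U.
  move: hN; rewrite ltnS; apply: leq_trans; rewrite /mu invMg tpermV.
  rewrite (bigD1 i) //= (bigD1 j) 1?eq_sym //= [X in (_ < X)%N](bigD1 i) //=.
  rewrite [X in (_ < _ + X)%N](bigD1 j) 1?eq_sym //= !permM tpermL tpermR.
  rewrite (eq_bigr (fun a : 'I_m => (a * (w^-1)%g a)%N)) => [|a /andP [ai aj]]; last first.
    by rewrite permM tpermD // eq_sym.
  rewrite !addnA ltn_add2r ji !mulSn.
  rewrite [X in (X < _)%N]addnCA [X in (_ < X)%N]addnCA (addnC (i * (w^-1)%g j)%N).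
  by rewrite ltn_add2r.
suff -> : w = w0 m by apply: h0.
rewrite -[w]invgK -(w0V m); congr (_^-1)%g; apply: w0_max => i j ji.
apply: contra nex => h; apply/existsP; exists i; apply/existsP; exists j.
by rewrite h ji eqxx.
Qed.

(* The apartment of the frame g, as a signed chain of flags. *)
Definition apt g K : int :=
  \sum_(s : 'S_m) if K == gflag (g * GLperm F s)%g then (-1) ^+ s else 0.

Lemma aptE g K :
  apt g K = \sum_(s : 'S_m) if K == gflag (g * GLperm F s)%g then (-1) ^+ s else 0.
Proof. by []. Qed.

Lemma apt_supp g : flag_supp V (apt g).
Proof.
move=> K; apply: contraNT => nK; apply/eqP; rewrite /apt big1 // => s _.
case: eqP => // e; case/negP: nK; rewrite e.
by have /andP [] := gflag_flag VW hphi (g * GLperm F s)%g.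
Qed.

(** The chambers s of the apartment that complete the given partial flag are stable under right
    multiplication by one simple transposition, which reverses the sign. *)
Lemma fs_apt g : fs_fun (apt g).
Proof.
move=> s1 Y U s2 UY dY; rewrite exchange_big /=.
have [/eqP sz|nsz] := boolP ((size s1 + (size s2).+3)%N == m.+1); last first.
  rewrite big1 // => s _; rewrite big1 // => X _; case: eqP => // e.
  by case/eqP: nsz; rewrite -(size_gflag_rec W phi (g * GLperm F s)%g m) -/(gflag _) -e size_cat.
(* The subspace U occupies relative dimension i, so the free member X has relative dimension i + 1
   and the transposition exchanges the 0-based positions i and i + 1. *)
set i := size s2 in sz.
have jm : (i.+1 < m)%N by rewrite -ltnS -sz !addnS !ltnS leq_addl.
pose I := Ordinal (ltnW jm); pose J := Ordinal jm.
have nIJ : I != J by apply/eqP => /(congr1 val) /= /n_Sn.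
pose N (s : 'S_m) := [exists X, between U Y X && (s1 ++ [:: Y, X, U & s2] == gflag (g * GLperm F s)%g)].
have sumN s : \sum_(X | between U Y X)
    (if s1 ++ [:: Y, X, U & s2] == gflag (g * GLperm F s)%g then (-1) ^+ s else 0 : int) =
    if N s then (-1) ^+ s else 0.
  have [/existsP [X0 /andP [b0 /eqP e0]]|nN] := boolP (N s); last first.
    rewrite big1 // => X bX; rewrite ifN //; apply: contra nN => e.
    by apply/existsP; exists X; rewrite bX.
  rewrite (bigD1 X0) //= e0 eqxx big1 ?addr0 // => X /andP [_ nX].
  rewrite ifN // -e0; apply: contra nX => /eqP /(congr1 (drop (size s1))).
  by rewrite !drop_size_cat // => -[->].
have Nt s : N s -> N (s * tperm I J)%g.
  move=> /existsP [X0 /andP [b0 /eqP e0]].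
  have hx := @gflag_xs (g * GLperm F s)%g I J 0 erefl.
  have x0 : xel I J 0 = 1%g :> G.
    by apply/val_inj; rewrite [val _]xelE //= scale0r addr0.
  rewrite x0 mul1g in hx; apply/existsP.
  move: e0; rewrite (gflag_split _ jm).
  move=> /eqP; rewrite eqseq_cat; last first.
    rewrite size_map size_rev size_iota; apply/eqP.
    by rewrite -(eqn_add2r i.+3) sz -[i.+3]addn1 addnA subnK // addn1.
  move=> /andP [/eqP e1 /eqP [e2 e3 e4]].
  have [t et] := gflag_rec_head W phi (g * GLperm F s)%g i.
  rewrite et in e4; case: e4 => e4 e5.
  exists (gspace (g * GLperm F (s * tperm I J))%g i.+1); rewrite GLpermM mulgA.
  rewrite hx et e1 e2 e4 e5 /= eqxx andbT.
  have := between_gspace VW hphi (g * GLperm F s * GLperm F (tperm I J))%g jm.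
  have fx k : (k <= m)%N -> k != J -> gspace (g * GLperm F s * GLperm F (tperm I J))%g k = gspace (g * GLperm F s)%g k.
    by move=> km kJ; have := @gspace_xs (g * GLperm F s)%g I J 0 k erefl km kJ; rewrite x0 mul1g.
  have n1 : i != J by rewrite ltn_eqF.
  have n2 : i.+2 != J by rewrite gtn_eqF.
  by rewrite (fx i _ n1) ?(fx i.+2 _ n2) //; apply/ltnW/ltnW.
(* S = -S gives S = 0 because the values are integers, which have no 2-torsion. *)
set S := \sum_s _; suff : S = - S by move/eqP; rewrite -addr_eq0 -mulr2n mulrn_eq0 => /eqP.
rewrite {1}/S (reindex_inj (mulIg (tperm I J))) /= -sumrN; apply: eq_bigr => s _.
rewrite !sumN odd_permM odd_tperm nIJ /= addbT signrN.
have -> : N (s * tperm I J)%g = N s.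
  apply/idP/idP => [/Nt|/Nt //]; by rewrite -mulgA tperm2 mulg1.
by case: (N s); rewrite ?oppr0.
Qed.

Lemma good_apt g : good V (apt g).
Proof. by split; [apply: apt_supp | apply: fs_apt]. Qed.

(** The flags of the apartment are the cosets u s B. By [bruhat_uniq] such a coset equals v w0 B
    only for s = w0, and then [bruhat_w0] gives u = v. *)
Lemma apt_w0 u v : in_U u -> in_U v ->
  apt u (gflag (v * GLperm F (w0 m)))%g = if u == v then (-1) ^+ w0 m else 0.
Proof.
move=> hu hv; have key s : (gflag (v * GLperm F (w0 m))%g == gflag (u * GLperm F s)%g) =
    (s == w0 m) && (u == v).
  apply/eqP/andP => [/esym/(gflag_eqP VW hphi)|[/eqP -> /eqP -> //]].
  rewrite invMg -GLpermV !mulgA -(mulgA _ _ v) => hB.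
  have hU : in_U (u^-1 * v)%g by rewrite in_UM ?in_UV.
  have e := bruhat_uniq hU hB; rewrite e eqxx in hB *; split=> //.
  by have /(congr1 (mulg u)) := bruhat_w0 hU hB; rewrite mulKVg mulg1 => ->.
rewrite /apt (bigD1 (w0 m)) //= key eqxx /= big1 ?addr0 // => s ns.
by rewrite key (negPf ns).
Qed.

Definition apt' u K : int := (-1) ^+ w0 m * apt u K.

Lemma apt'E u K : apt' u K = (-1) ^+ w0 m * apt u K.
Proof. by []. Qed.

Lemma good_apt' u : good V (apt' u).
Proof.
have [h1 h2] := good_apt u; split=> [K|s1 Y U s2 UY dY]; rewrite /apt'.
  by move=> h; apply: h1; apply: contraNneq h => ->; rewrite mulr0.
by rewrite -mulr_sumr h2 // mulr0.
Qed.

Lemma apt'_w0 u v : in_U u -> in_U v ->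
  apt' u (gflag (v * GLperm F (w0 m)))%g = (u == v)%:R.
Proof.
move=> hu hv; rewrite /apt' apt_w0 //; case: eqP => _; last by rewrite mulr0.
by rewrite -signr_addb addbb.
Qed.

(** The difference of the two sides satisfies (FS) and vanishes on the big cell. Values in an
    arbitrary Z-module allow f to be [dpath V], so that the big cell is seen to span the weight
    space, as well as an integral function, which is seen to be determined by its values there. *)
Lemma flag_expand (M : zmodType) (f : seq (subsp F n) -> M) K : fs_fun f ->
  is_flag_from_to V W K ->
  f K = \sum_(u | in_U u) f (gflag (u * GLperm F (w0 m)))%g *~ apt' u K.
Proof.
move=> hf hK; have [g <-] := gflag_surj VW hphi hK.
pose D K := f K - \sum_(u | in_U u) f (gflag (u * GLperm F (w0 m)))%g *~ apt' u K.
suff : D (gflag g) = 0 by move/eqP; rewrite subr_eq0 => /eqP.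
apply: fs_group_ind => [s1 Y U s2 UY dY|v hv]; rewrite /D.
  rewrite sumrB hf // exchange_big big1 ?subr0 // => u _.
  by rewrite -mulrz_sumr (good_apt' u).2 // mulr0z.
rewrite (bigD1 v) //= apt'_w0 // eqxx mulr1z big1 ?addr0 ?subrr // => u /andP [hu nuv].
by rewrite apt'_w0 // (negPf nuv) mulr0z.
Qed.

Lemma sub_act_gspace g h i : sub_act W phi g (gspace h i) = gspace (g * h)%g i.
Proof.
apply/vspaceP => x; rewrite /sub_act memv_cap -memv_preim.
apply/andP/mem_gspace => [[xW /memv_imgP [y /memv_imgP [x' hx' ->] e]]|[xW [z e hz]]]; split=> //.
  have /mem_gspace [_ [z ez hz]] := hx'; exists z => //.
  by rewrite GLvalM e lfunE /= ez mulmxA.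
apply/memv_imgP; exists (GLval h *m z); last by rewrite e GLvalM lfunE /= mulmxA.
have [x' x'W ex'] := phi_lift hphi (GLval h *m z); rewrite -ex'.
by apply: memv_img; apply/mem_gspace; split=> //; exists z.
Qed.

Lemma sub_act_gflag g h : map (sub_act W phi g) (gflag h) = gflag (g * h)%g.
Proof.
have e i : map (sub_act W phi g) (gflag_rec h i) = gflag_rec (g * h)%g i.
  by elim: i => /= [|k ->]; rewrite sub_act_gspace.
exact: e.
Qed.

End Expansion.

Section CardU.
Variables (F : finFieldType) (m : nat).

Definition upairs : pred ('I_m * 'I_m) := fun ij => (ij.1 < ij.2)%N.

Definition utmx (f : {ffun 'I_m * 'I_m -> F}) : 'M[F]_m :=
  \matrix_(i, j) ((i == j)%:R + (if (i < j)%N then f (i, j) else 0)).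

Lemma utmx_unit f : utmx f \in unitmx.
Proof.
rewrite unitmxE -det_tr det_trig.
  by rewrite big1 ?unitr1 // => i _; rewrite !mxE eqxx ltnn addr0.
apply/is_trig_mxP => i j ij; rewrite !mxE ltnNge (ltnW ij) /=.
case: eqP => [e|_]; last by rewrite addr0.
by rewrite e ltnn in ij.
Qed.

(** The point is that |U| is a power of q, hence invertible in k when l does not divide q; this
    permits averaging over U. *)
Lemma card_in_U : #|[pred u : GLmat F m | in_U u]| = (#|F| ^ #|upairs|)%N.
Proof.
rewrite -(card_pffun_on (0 : F)) -(card_in_imset (f := fun f => MkGL (utmx_unit f))).
  apply: eq_card => u; rewrite inE; apply/idP/imsetP => [/in_UP [/in_BP h1 h2]|[f _ ->]].
    exists [ffun ij : 'I_m * 'I_m => if (ij.1 < ij.2)%N then GLval u ij.1 ij.2 else 0].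
      apply/pfamilyP; split=> //; apply/supportP => ij nij.
      by rewrite ffunE ifN.
    apply/val_inj/matrixP => i j; rewrite /= mxE ffunE /=.
    case: (eqVneq i j) => [->|nij]; first by rewrite ltnn addr0 h2.
    rewrite add0r; case: ltnP => // ji; apply: h1; rewrite ltn_neqAle ji andbT.
    by rewrite eq_sym; exact: nij.
  apply/in_UP; split=> [|i]; last by rewrite /= mxE eqxx ltnn addr0.
  apply/in_BP => i j ji; rewrite /= mxE ltnNge (ltnW ji) /= addr0.
  by case: eqP => // e; rewrite e ltnn in ji.
move=> f g /pfamilyP [/supportP sf _] /pfamilyP [/supportP sg _] /(congr1 (@Defs.GLval F m)) /= /matrixP e.
apply/ffunP => -[i j]; have := e i j; rewrite !mxE => /addrI.
case: ifP => // ij _; have nin : (i, j) \notin upairs by rewrite unfold_in /upairs ij.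
by rewrite sf // sg.
Qed.

End CardU.

(** * The Steinberg module *)

Section SteinbergFunctions.
Variables (F : finFieldType) (n m : nat) (V W : subsp F n).
Variable phi : 'Hom('cV[F]_n, 'cV[F]_m).
Hypothesis VW : (V <= W)%VS.
Hypothesis hphi : quot_iso V W phi.
Local Notation G := (GLmat F m).
Implicit Types (g h u v : G).
Local Notation gflag := (gflag W phi).
Local Notation apt := (apt W phi).
Local Notation apt' := (apt' W phi).
Local Notation w0 := (w0 m).

Section Ring.
Variable R : comNzRingType.
Implicit Types x y z : grp_alg F m R.

Lemma gelt_mulE g x h : gmul (gelt R g) x h = x (g^-1 * h)%g.
Proof.
rewrite ffunE (bigD1 g) //= ffunE eqxx mul1r big1 ?addr0 // => k kg.
by rewrite ffunE (negPf kg) mul0r.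
Qed.

Lemma gmul_gelt g y z : gmul (gelt R g) (gmul y z) = gmul (gmul (gelt R g) y) z.
Proof.
apply/ffunP => h; rewrite gelt_mulE !ffunE [RHS](reindex_inj (mulgI g)) /=.
by apply: eq_bigr => k _; rewrite gelt_mulE mulKg invMg mulgA.
Qed.

Lemma gmulDl x y z : gmul (x + y) z = gmul x z + gmul y z.
Proof.
apply/ffunP => h; rewrite !ffunE -big_split; apply: eq_bigr => g _ /=.
by rewrite ffunE mulrDl.
Qed.

Lemma gmulZl (a : R) x z : gmul (a *: x) z = a *: gmul x z.
Proof.
apply/ffunP => h; rewrite !ffunE /GRing.scale /= mulr_sumr; apply: eq_bigr => g _ /=.
by rewrite ffunE -mulrA.
Qed.

Lemma gmul_linr (a : R) g x y :
  gmul (gelt R g) (a *: x + y) = a *: gmul (gelt R g) x + gmul (gelt R g) y.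
Proof.
apply/ffunP => h; rewrite gelt_mulE [LHS]ffunE [RHS]ffunE gelt_mulE.
by congr (_ + _); rewrite ffunE [RHS]ffunE gelt_mulE.
Qed.

(** As a function on G, the sum over B makes e right B-invariant, hence a function on flags; the
    alternating sum makes it the apartment of the standard frame. *)
Lemma St_eE h : St_e F m R h = (apt 1%g (gflag h))%:~R.
Proof.
rewrite /St_e ffunE /apt rmorph_sum /=.
transitivity (\sum_g \sum_(s : 'S_m) (if g == GLperm F s then (-1) ^+ s * (in_B (g^-1 * h)%g)%:R else 0 : R)).
  apply: eq_bigr => g _; rewrite !sum_ffunE.
  have -> : (\sum_(b | in_B b) gelt R b (g^-1 * h)%g) = (in_B (g^-1 * h)%g)%:R.
    case hb: (in_B _).
      rewrite (bigD1 (g^-1 * h)%g) //= ffunE eqxx big1 ?addr0 // => b /andP [_ nb].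
      by rewrite ffunE eq_sym (negPf nb).
    rewrite big1 // => b hb'; rewrite ffunE; case: eqP => // e.
    by rewrite e hb' in hb.
  rewrite mulr_suml; apply: eq_bigr => s _; rewrite ffunE ffunE /GRing.scale /=.
  by case: ifP => _; rewrite ?mulr1 // mulr0 mul0r.
rewrite exchange_big; apply: eq_bigr => s _ /=.
rewrite -big_mkcond big_pred1_eq mul1g.
have -> : in_B ((GLperm F s)^-1 * h)%g = (gflag h == gflag (GLperm F s)).
  by apply/(gflag_eqP VW hphi)/eqP => ->.
by case: ifP => _; rewrite ?mulr1 ?mulr0 // rmorph_sign.
Qed.

Lemma apt_mul g h : apt 1%g (gflag (g^-1 * h)%g) = apt g (gflag h).
Proof.
apply: eq_bigr => s _; rewrite mul1g.
suff -> : (gflag (g^-1 * h)%g == gflag (GLperm F s)) = (gflag h == gflag (g * GLperm F s)%g) by [].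
apply/eqP/eqP => /(gflag_eqP VW hphi) e; apply/(gflag_eqP VW hphi); move: e.
  by rewrite invMg invgK !mulgA.
by rewrite invMg invgK !mulgA.
Qed.

Lemma St_basisE g h : gmul (gelt R g) (St_e F m R) h = (apt g (gflag h))%:~R.
Proof. by rewrite gelt_mulE St_eE apt_mul. Qed.

Lemma gmul_StE y h : gmul y (St_e F m R) h = \sum_g y g * (apt g (gflag h))%:~R.
Proof. by rewrite ffunE; apply: eq_bigr => g _; rewrite St_eE apt_mul. Qed.

(** Elements of the Steinberg module are combinations of apartments, so as functions on flags they
    satisfy (FS) and [flag_expand] applies. *)
Lemma St_expand x h : St F m R x ->
  x h = \sum_(u | in_U u) x (u * GLperm F w0)%g * (apt' u (gflag h))%:~R.
Proof.
case=> y _ <-; rewrite gmul_StE.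
under [RHS]eq_bigr do rewrite gmul_StE mulr_suml.
rewrite exchange_big; apply: eq_bigr => g _ /=.
rewrite (flag_expand VW hphi (fs_apt VW hphi g) (gflag_flag VW hphi h)).
rewrite rmorph_sum mulr_sumr; apply: eq_bigr => u _ /=.
by rewrite -mulrA -rmorphM mulrzz.
Qed.

Lemma St_fun (a : G -> R) : St F m R [ffun h => \sum_(u | in_U u) a u * (apt' u (gflag h))%:~R].
Proof.
exists [ffun u => if in_U u then (-1) ^+ w0 * a u else 0] => //.
apply/ffunP => h; rewrite gmul_StE ffunE [RHS]big_mkcond; apply: eq_bigr => u _.
rewrite ffunE; case: ifP => _; last by rewrite mul0r.
by rewrite apt'E rmorphM rmorph_sign /= mulrCA mulrA.
Qed.

Lemma St_act_closed g x : St F m R x -> St F m R (gmul (gelt R g) x).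
Proof. by case=> y _ <-; exists (gmul (gelt R g) y); rewrite // gmul_gelt. Qed.

Lemma St_lin (a : R) x y : St F m R x -> St F m R y -> St F m R (a *: x + y).
Proof.
case=> x' _ <- [y' _ <-]; exists (a *: x' + y') => //.
by rewrite gmulDl gmulZl.
Qed.

Lemma St0 : St F m R 0.
Proof.
exists 0 => //; apply/ffunP => h; rewrite !ffunE big1 // => g _.
by rewrite ffunE mul0r.
Qed.

Lemma St_gflag x g h : St F m R x -> gflag g = gflag h -> x g = x h.
Proof. by move=> hx e; rewrite !(St_expand _ hx) e. Qed.

Lemma St_eq x y : St F m R x -> St F m R y ->
  (forall u, in_U u -> x (u * GLperm F w0)%g = y (u * GLperm F w0)%g) -> x = y.
Proof.
move=> hx hy e; apply/ffunP => h; rewrite (St_expand h hx) (St_expand h hy).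
by apply: eq_bigr => u hu; rewrite e.
Qed.

End Ring.

(** Evaluation at u w0 isolates the coefficient of ue up to the sign of w0, so the coordinates on U
    selected by [St_coord] are the only possible ones. *)
Lemma St_coordE x u : St F m int x -> in_U u ->
  St_coord x u = (-1) ^+ w0 * x (u * GLperm F w0)%g.
Proof.
move=> hx hu; rewrite /St_coord; case: xgetP => [a _ /= e|h].
  rewrite e sum_ffunE (bigD1 u hu) /= [X in X + _]ffunE St_basisE (apt_w0 VW hphi) // eqxx.
  rewrite big1 => [|v /andP [hv nv]]; last first.
    by rewrite ffunE St_basisE (apt_w0 VW hphi) // (negPf nv) /GRing.scale /= mulr0.
  by rewrite addr0 intz /GRing.scale /= mulrCA -signr_addb addbb mulr1.
case: (h [ffun u => (-1) ^+ w0 * x (u * GLperm F w0)%g]); apply/ffunP => g.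
rewrite (St_expand g hx) sum_ffunE; apply: eq_bigr => v hv.
by rewrite ffunE St_basisE ffunE apt'E !intz /GRing.scale /= mulrCA mulrA.
Qed.

Definition flag_dot (f f' : seq (subsp F n) -> int) : int :=
  \sum_(K <- flagsn V m W) f K * f' K.

Lemma mem_gflag g : gflag g \in flagsn V m W.
Proof. by rewrite mem_flagsn (gflag_flag VW hphi) size_gflag_rec eqxx. Qed.

(** A flag common to both apartments is u s B = v t B, which forces s = t; the two signs agree, and
    the dot product counts the common flags. *)
Lemma apt_dot u v : in_U u -> in_U v -> flag_dot (apt u) (apt v) = Gow_form_basis u v.
Proof.
move=> hu hv; rewrite /flag_dot /Gow_form_basis.
have sum1 g (c : seq (subsp F n) -> int) : \sum_(K <- flagsn V m W)
    (if K == gflag g then c K else 0) = c (gflag g).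
  by rewrite -big_mkcond -big_filter filter_pred1_uniq ?big_seq1 ?uniq_flagsn ?mem_gflag.
transitivity (\sum_(s : 'S_m) (-1) ^+ s * apt v (gflag (u * GLperm F s)%g)).
  under eq_bigr do rewrite mulr_suml.
  rewrite exchange_big /=; apply: eq_bigr => s _.
  rewrite -(sum1 (u * GLperm F s)%g (fun K => (-1) ^+ s * apt v K)).
  by apply: eq_bigr => K _; case: ifP => _; rewrite ?mul0r.
have key s t : (gflag (u * GLperm F s)%g == gflag (v * GLperm F t)%g) =
    (s == t) && in_B (GLperm F s^-1 * (u^-1 * v) * GLperm F s)%g.
  apply/eqP/andP => [/(gflag_eqP VW hphi)|[/eqP <- hB]].
    rewrite invMg -GLpermV !mulgA -(mulgA _ _ v) => hB.
    have e : s = t by apply: bruhat_uniq hB; rewrite in_UM ?in_UV.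
    by rewrite e eqxx in hB *.
  by apply/(gflag_eqP VW hphi); rewrite invMg -GLpermV !mulgA in hB *.
transitivity (\sum_(s : 'S_m) (in_B (GLperm F s^-1 * (u^-1 * v) * GLperm F s)%g)%:R : int).
  apply: eq_bigr => s _; rewrite aptE (bigD1 s) //= key eqxx /= big1 => [|t nt].
    by rewrite addr0; case: ifP => _; rewrite ?mulr0 // -signr_addb addbb.
  by rewrite key eq_sym (negPf nt).
(* The permutation w in Gow's count is the inverse of s. *)
rewrite (reindex_inj invg_inj) /= -natr_sum -[RHS]natz; congr (_%:R).
rewrite -sum1_card [RHS]big_mkcond; apply: eq_bigr => w _; rewrite inE invgK.
have hU : in_U (u^-1 * v)%g by rewrite in_UM ?in_UV.
(* A permutation conjugate of a unitriangular matrix has ones on the diagonal, so it lies in U as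
   soon as it lies in B. *)
have -> : in_U (GLperm F w * u^-1 * v * (GLperm F w)^-1)%g =
    in_B (GLperm F w * (u^-1 * v) * GLperm F w^-1)%g.
  rewrite GLpermV !mulgA; apply/in_UP/idP => [[]//|hB]; split=> // i.
  have [_ h1] := in_UP _ hU.
  by rewrite -GLpermV GLmul_permE invgK -!mulgA GLperm_mulE h1.
by case: (in_B _).
Qed.

Lemma apt'_dot u v : flag_dot (apt' u) (apt' v) = flag_dot (apt u) (apt v).
Proof.
apply: eq_bigr => K _; rewrite !apt'E mulrACA -signr_addb addbb mul1r //.
Qed.

Lemma Gow_formE x y : St F m int x -> St F m int y ->
  Gow_form x y = \sum_(u | in_U u) \sum_(v | in_U v)
    x (u * GLperm F w0)%g * y (v * GLperm F w0)%g * flag_dot (apt' u) (apt' v).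
Proof.
move=> hx hy; apply: eq_bigr => u hu; apply: eq_bigr => v hv.
rewrite !St_coordE // apt'_dot apt_dot //; congr (_ * _).
by rewrite mulrACA -signr_addb addbb mul1r.
Qed.

End SteinbergFunctions.

(** * Smith normal form *)

Section Smith.
Variables (k : fieldType) (l : nat).
Hypothesis hl : l \in [pchar k].

Let pl : prime l := pcharf_prime hl.

Lemma intr_eq0 (z : int) : ((z%:~R : k) == 0) = (l %| z)%Z.
Proof.
rewrite dvdzE /= (dvdn_pcharf hl); case: z => a //.
by rewrite NegzE mulrNz oppr_eq0 -pmulrn abszN.
Qed.

Lemma map_unitmx_int a (M : 'M[int]_a) : M \in unitmx -> map_mx (intr : int -> k) M \in unitmx.
Proof. by rewrite !unitmxE det_map_mx => h; apply: rmorph_unit. Qed.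

Definition dvdm (d : int) a b (M : 'M[int]_(a, b)) := forall i j, (d %| M i j)%Z.

Lemma dvdm_mull d a b c (M : 'M[int]_(a, b)) (M' : 'M_(b, c)) : dvdm d M -> dvdm d (M *m M').
Proof.
by move=> h i j; rewrite mxE; apply: rpred_sum => s _; rewrite dvdz_mulr.
Qed.

Definition redm a b (M : 'M[int]_(a, b)) : 'M[k]_(a, b) := map_mx intr M.

Lemma redmM a b c (M : 'M[int]_(a, b)) (M' : 'M_(b, c)) : redm (M *m M') = redm M *m redm M'.
Proof. exact: map_mxM. Qed.

Lemma dvd_val (x d : int) i : d != 0 -> (logn l `|d| < i)%N ->
  ((l ^ i)%:Z %| x * d)%Z -> x%:~R = 0 :> k.
Proof.
move=> d0 hv hd; apply/eqP; rewrite intr_eq0 dvdzE /=.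
case: (eqVneq x 0) => [->|x0]; first by rewrite dvdn0.
move: hd; rewrite dvdzE abszM absz_nat pfactor_dvdn ?muln_gt0 ?absz_gt0 ?x0 //.
rewrite lognM ?absz_gt0 // => h.
have : (0 < logn l `|x|)%N by rewrite -(ltn_add2r (logn l `|d|)) add0n; apply: leq_trans h.
by rewrite -pfactor_dvdn ?absz_gt0.
Qed.

Variables (N : nat) (A Fm : 'M[int]_N) (c : nat).
Hypothesis c0 : (0 < c)%N.
Hypothesis hA : A *m Fm = (c%:Z)%:M.
Let kap := logn l c.

(* The conclusion describes, in suitable bases of k^N, the images of the lattices
   {x | l^i divides x A} and {y | l^j divides y Fm}: both are spanned by basis
   vectors, and x |-> (x A) / l^i is diagonal. *)
Lemma smith_bases : exists (P Q : 'M[k]_N) (v : 'I_N -> nat) (un : 'I_N -> k),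
  [/\ P \in unitmx, Q \in unitmx, forall t, (v t <= kap)%N & forall t, un t != 0] /\
  [/\ forall i (x : 'rV[int]_N), dvdm (l ^ i)%:Z (x *m A) -> forall t, (v t < i)%N -> (redm x *m P) 0 t = 0,
      forall i t, (i <= v t)%N -> exists x : 'rV[int]_N,
        dvdm (l ^ i)%:Z (x *m A) /\ redm x *m P = delta_mx 0 t,
      forall j (y : 'rV[int]_N), dvdm (l ^ j)%:Z (y *m Fm) -> forall t, (kap < j + v t)%N -> (redm y *m Q) 0 t = 0,
      forall j t, (j + v t <= kap)%N -> exists y : 'rV[int]_N,
        dvdm (l ^ j)%:Z (y *m Fm) /\ redm y *m Q = delta_mx 0 t
    & forall i (x y : 'rV[int]_N), x *m A = (l ^ i)%:Z *: y -> forall t,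
        (v t = i -> (redm y *m Q) 0 t = un t * (redm x *m P) 0 t) /\
        ((i < v t)%N -> (redm y *m Q) 0 t = 0)].
Proof.
have [L uL [R uR [d _ eA]]] := int_Smith_normal_form A.
set D := \matrix_(i, j) _ in eA.
have cZ0 : c%:Z != 0 by rewrite -lt0n.
(* In the bases that make A the diagonal matrix D, the matrix Fm becomes E = c D^-1. So E is
   diagonal as well, and the valuations of corresponding entries add up to [kap]. *)
pose E := R *m Fm *m L.
have DE : D *m E = (c%:Z)%:M.
  have : invmx L *m (A *m Fm) *m L = (c%:Z)%:M.
    by rewrite hA mul_mx_scalar -scalemxAl mulVmx // scalemx1.
  by rewrite eA /E -!mulmxA mulKmx.
have DEt (s t : 'I_N) : d`_s * E s t = (c%:Z) *+ (s == t).
  have := congr1 (fun M : 'M_N => M s t) DE; rewrite /= [RHS]mxE => <-; rewrite [RHS]mxE.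
  rewrite (bigD1 s) //= big1 ?addr0 => [|j js]; first by rewrite [D s s]mxE eqxx.
  by rewrite [D s j]mxE eq_sym (negPf (js : (j : nat) != s)) mul0r.
have d0 (t : 'I_N) : d`_t != 0.
  by apply/eqP => e; have := DEt t t; rewrite e mul0r eqxx => /esym/eqP; apply/negP.
have e0 (t : 'I_N) : E t t != 0.
  by apply/eqP => e; have := DEt t t; rewrite e mulr0 eqxx => /esym/eqP; apply/negP.
have Eoff (s t : 'I_N) : s != t -> E s t = 0.
  move=> st; have := DEt s t; rewrite (negPf st) => /eqP.
  by rewrite mulf_eq0 (negPf (d0 s)) => /eqP.
pose v (t : 'I_N) := logn l (absz d`_t%R).
have hv t : (v t + logn l `|E t t| = kap)%N.
  by rewrite /v -lognM ?absz_gt0 // -abszM DEt eqxx absz_nat.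
pose du (t : 'I_N) := (d`_t %/ (l ^ v t)%:Z)%Z.
have hdu (t : 'I_N) : d`_t = du t * (l ^ v t)%:Z.
  by rewrite divzK // dvdzE absz_nat pfactor_dvdn ?absz_gt0.
have un0 t : (du t)%:~R != 0 :> k.
  rewrite intr_eq0; apply/negP => /dvdzP [z ez].
  have : (l ^ (v t).+1 %| absz (nth 0%R d t))%N.
    by rewrite hdu ez abszM abszM !absz_nat -mulnA -expnS dvdn_mull.
  by rewrite pfactor_dvdn ?absz_gt0 // ltnn.
have lN0 i : (l ^ i)%:Z != 0 by rewrite -lt0n expn_gt0 prime_gt0.
have uLk : redm L \in unitmx by rewrite map_unitmx_int.
(* From A = L D R: source coordinates are x L, target coordinates are y R^-1, and [un t] is the part
   of d_t prime to l. *)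
exists (redm L), (redm (invmx R)), v, (fun t => (du t)%:~R).
have xAE (x : 'rV[int]_N) : x *m A = (x *m L *m D) *m R by rewrite eA !mulmxA.
have rowD (z : 'rV[int]_N) t : (z *m D) 0 t = z 0 t * d`_t.
  rewrite mxE (bigD1 t) //= big1 ?addr0 => [|j jt]; first by rewrite [D t t]mxE eqxx.
  by rewrite [D j t]mxE (negPf (jt : (j : nat) != t)) mulr0.
have rowE (z : 'rV[int]_N) t : (z *m E) 0 t = z 0 t * E t t.
  by rewrite mxE (bigD1 t) //= big1 ?addr0 // => j jt; rewrite Eoff ?mulr0.
have yFE (y : 'rV[int]_N) : y *m Fm *m L = (y *m invmx R) *m E.
  by rewrite /E !mulmxA mulmxKV.
split; [split|split].
- exact: uLk.
- by rewrite map_unitmx_int // unitmx_inv.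
- by move=> t; rewrite -(hv t) leq_addr.
- exact: un0.
- move=> i x hx t vi; rewrite -redmM mxE; apply: (dvd_val (d0 t) vi).
  rewrite -rowD -[_ *m D](mulmxK uR) -xAE; exact: dvdm_mull.
- move=> i t iv; exists (delta_mx 0 t *m invmx L); split.
    rewrite xAE mulmxKV //; apply: dvdm_mull => a b; rewrite ord1 rowD mxE.
    case: (eqVneq b t) => [->|_]; last by rewrite mul0r dvdz0.
    rewrite mul1r hdu dvdz_mull // dvdzE !absz_nat; exact: dvdn_exp2l.
  by rewrite -redmM mulmxKV // /redm map_delta_mx.
- move=> j y hy t hj; rewrite -redmM mxE; apply: (dvd_val (e0 t)).
    by rewrite -(ltn_add2l (v t)) hv addnC; exact: hj.
  rewrite -rowE -yFE; exact: dvdm_mull.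
- move=> j t hj; exists (delta_mx 0 t *m R); split.
    rewrite -[_ *m Fm](mulmxK uL) yFE mulmxK //; apply: dvdm_mull => a b; rewrite ord1 rowE mxE.
    case: (eqVneq b t) => [->|_]; last by rewrite mul0r dvdz0.
    rewrite mul1r dvdzE absz_nat pfactor_dvdn ?absz_gt0 //.
    by rewrite -(leq_add2l (v t)) hv addnC.
  by rewrite -redmM mulmxK // /redm map_delta_mx.
- move=> i x y exy t.
  have key : (x *m L) 0 t * d`_t = (l ^ i)%:Z * (y *m invmx R) 0 t.
    rewrite -rowD -[x *m L *m D](mulmxK uR) -xAE exy -scalemxAl mxE //.
  split=> [vi|iv]; rewrite -!redmM [LHS]mxE.
    rewrite [X in _ * X]mxE -rmorphM; congr (_%:~R); apply/(mulfI (lN0 i)).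
    by rewrite -key hdu vi mulrA mulrC; congr (_ * _); apply: mulrC.
  apply/eqP; rewrite intr_eq0; apply/dvdzP.
  exists ((x *m L) 0 t * du t * (l ^ (v t - i.+1))%:Z); apply/(mulfI (lN0 i)).
  have e : (l ^ v t)%:Z = (l ^ i)%:Z * (l%:Z * (l ^ (v t - i.+1))%:Z).
    by rewrite -!PoszM -expnS -expnD -addSnnS subnKC.
  rewrite -key hdu e [RHS]mulrC -!mulrA; congr (_ * (_ * _)).
  by rewrite mulrC -mulrA mulrCA.
Qed.

End Smith.

(** * Extension of integral functionals to k *)

Section BaseChangeLift.
Variables (k : fieldType) (M : zmodType).

Definition bclift (f : M -> k) (u : basechange k M) : k :=
  fglift (f : M -> k^o) (repr u).

Lemma bclift_qclass (f : M -> k) (z : {freeg M / k}) : zmod_morphism f ->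
  bclift f (qclass (Defs.span (@tens_rel k M)) z) = fglift (f : M -> k^o) z.
Proof.
move=> hf; have fD x y : f (x + y) = f x + f y.
  by have := hf (x + y) y; rewrite addrK => ->; rewrite subrK.
pose Lf := fglift (f : M -> k^o).
apply/eqP; rewrite -subr_eq0 -[_ - _]/(Lf _ - Lf z) -raddfB /=.
have : repr (qclass (Defs.span (@tens_rel k M)) z) - z \in Defs.span (@tens_rel k M).
  by rewrite -qclass_eq /qclass reprK.
move=> /asboolP; elim=> [|a _ y [x [x' ->]] _ /eqP IH]; first by rewrite raddf0.
rewrite raddfD /= IH addr0 linearZ /= !raddfB /= !liftU !scale1r.
by rewrite fD scalerDr addrAC addrK subrr.
Qed.

Lemma bclift_tens (f : M -> k) x : zmod_morphism f -> bclift f (tens k x) = f x.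
Proof. by move=> hf; rewrite /tens bclift_qclass // liftU scale1r. Qed.

Lemma bclift_linear (f : M -> k) a u w : zmod_morphism f ->
  bclift f (a *: u + w) = a * bclift f u + bclift f w.
Proof.
move=> hf; case: (qclassP u) => x ->; case: (qclassP w) => y ->.
by rewrite -linearP /= !bclift_qclass // linearP.
Qed.

Lemma basechange_ind (P : basechange k M -> Prop) : P 0 ->
  (forall a x u, P u -> P (a *: tens k x + u)) -> forall u, P u.
Proof.
move=> P0 PS u; case: (qclassP u) => z ->.
rewrite -(freeg_sumE z) raddf_sum.
elim: (dom z) => [|x s IH]; first by rewrite big_nil.
rewrite big_cons; have := PS (coeff x z) x _ IH; rewrite /tens -linearZ /=.
suff -> : << coeff x z *g x >> = coeff x z *: << 1 *g x >> :> {freeg M / k} by [].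
by apply/eqP/freeg_eqP => y; rewrite coeffZ !coeffU mulrA mulr1.
Qed.

End BaseChangeLift.

(** Going up the flag by which one came down cancels step by step through the first wedge relation.
    The value is nonzero in k when l does not divide q, which will make the generator of the socle
    nonzero. *)
Lemma pairing_self (F : finFieldType) n (V : subsp F n) K : is_flag_to V K ->
  exists e, pairing V K K = (#|F| ^ e)%:Z.
Proof.
case: K => // W t; elim: t W => [|H t IH] W hK.
  exists 0%N; rewrite /pairing /pact /= /point_V eqxx; move: hK => /= /eqP ->.
  by rewrite eqxx.
have := hK; rewrite flag_cons => /andP [lH hH]; have [e eH] := IH H hH.
exists (\dim H + e)%N; rewrite expnD PoszM -eH.
have hp := rev_flagpath (is_flag_path hH).
have hp2 : is_flagpath [:: H; W] by rewrite /= lH.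
have := pact_concat (point_V V) hp hp2.
rewrite [rev (H :: t)]rev_cons last_rcons eqxx /= cats1 -!rev_cons => e2.
rewrite /pairing -e2 /pact [LHS]/= op_up // up_cons lH eqxx /= eqxx.
by [].
Qed.

(** * Gram matrices *)

Section Coordinates.
Variables (F : finFieldType) (n m : nat) (V W : subsp F n).
Variable phi : 'Hom('cV[F]_n, 'cV[F]_m).
Hypothesis VW : (V <= W)%VS.
Hypothesis hphi : quot_iso V W phi.
Local Notation G := (GLmat F m).
Implicit Types (g h u : G).
Local Notation gflag := (gflag W phi).
Local Notation w0 := (w0 m).
Local Notation q := #|F|.

Definition nU := #|[pred u : G | in_U u]|.
Definition unip (t : 'I_nU) : G := enum_val t.

Lemma utP t : in_U (unip t).
Proof. by have := enum_valP t; rewrite inE. Qed.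

Lemma unip_inj : injective unip.
Proof. exact: enum_val_inj. Qed.

Lemma big_ut (M : nmodType) (f : G -> M) : \sum_(u | in_U u) f u = \sum_t f (unip t).
Proof.
transitivity (\sum_(u in [pred u : G | in_U u]) f u); last exact: big_enum_val.
by apply: eq_bigl => u; rewrite inE.
Qed.

Definition dualf t := apt' W phi (unip t).

Lemma dualfE t K : dualf t K = (-1) ^+ w0 * apt W phi (unip t) K.
Proof. by []. Qed.
Definition basef t := gflag (unip t * GLperm F w0)%g.

Lemma good_dualf t : good V (dualf t).
Proof. exact: good_apt'. Qed.

Lemma dualfD s t : dualf s (basef t) = (s == t)%:R.
Proof. by rewrite /dualf /basef (apt'_w0 VW hphi) ?utP // (inj_eq unip_inj). Qed.

Lemma basef_flag t : is_flag_from_to V W (basef t).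
Proof. exact: gflag_flag. Qed.

Lemma basef_flag_to t : is_flag_to V (basef t).
Proof. by case/andP: (basef_flag t). Qed.

Lemma expand_dualf (M : zmodType) (f : seq (subsp F n) -> M) K : fs_fun f ->
  is_flag_from_to V W K -> f K = \sum_t f (basef t) *~ dualf t K.
Proof.
by move=> hf hK; rewrite [LHS](flag_expand VW hphi hf hK) (big_ut (fun u => f (gflag (u * GLperm F w0))%g *~ apt' W phi u K)).
Qed.

Lemma dualf_head t K : dualf t K != 0 -> head 0%VS K = W.
Proof.
move=> h; suff [g /eqP ->] : exists g, K == gflag g by case/andP: (gflag_flag VW hphi g) => _ /eqP.
apply/existsP; apply: contraT; rewrite negb_exists => /forallP nK; move: h.
by rewrite /dualf /apt' /apt big1 ?mulr0 ?eqxx // => s _; rewrite ifN.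
Qed.

Definition coords (x : Delta V) : 'rV[int]_nU := \row_t lam (dualf t) x.

Lemma coordsB x y : coords (x - y) = coords x - coords y.
Proof. by apply/rowP => t; rewrite !mxE lamB //; exact: good_dualf. Qed.

Lemma coords_dpath K : is_flag_to V K -> coords (dpath V K) = \row_t dualf t K.
Proof. by move=> hK; apply/rowP => t; rewrite !mxE lam_dpath //; exact: good_dualf. Qed.

Lemma coords_basef t : coords (dpath V (basef t)) = delta_mx 0 t.
Proof. by rewrite coords_dpath ?basef_flag_to //; apply/rowP => s; rewrite !mxE dualfD eqxx. Qed.

Lemma wt_expand x : spath [:: W] *: x = \sum_t dpath V (basef t) *~ coords x 0 t.
Proof.
elim/Delta_ind: x => [|x y IHx IHy|K hK].
- by rewrite scaler0 big1 // => t _; rewrite mxE lam0 ?mulr0z //; exact: good_dualf.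
- rewrite scalerBr IHx IHy -sumrB; apply: eq_bigr => t _.
  by rewrite coordsB !mxE mulrzBr.
rewrite scale_spath1 // coords_dpath //; case: eqP => [e|ne].
  rewrite [LHS](expand_dualf (@fs_dpath F n V)); last by rewrite -e flag_from_self.
  by apply: eq_bigr => t _; rewrite mxE.
rewrite big1 // => t _; rewrite mxE; suff -> : dualf t K = 0 by rewrite mulr0z.
by apply/eqP; apply: contraT => /dualf_head.
Qed.

Lemma coords_wt x : coords (spath [:: W] *: x) = coords x.
Proof.
rewrite wt_expand; apply/rowP => s; rewrite mxE lam_sum; last exact: good_dualf.
rewrite (bigD1 s) //= big1 => [|t ts].
  by rewrite addr0 lamMz ?lam_dpath ?basef_flag_to ?dualfD ?eqxx ?mul1r //; exact: good_dualf.
by rewrite lamMz ?lam_dpath ?basef_flag_to ?dualfD 1?eq_sym ?(negPf ts) ?mul0r //; exact: good_dualf.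
Qed.

(** Rows are indexed by the argument and columns by the test flag, so that [coords x *m gram] lists
    the values of the form on x, as in [lam_pairing]. *)
Definition gram : 'M[int]_nU := \matrix_(t, r) pairing V (basef r) (basef t).
Definition St_gram : 'M[int]_nU := \matrix_(t, r) flag_dot m V W (dualf t) (dualf r).
Definition gram_const := (q ^ (\dim V * m) * qfact F m)%N.

Lemma pairing_head K L : is_flag_to V L -> is_flag_to V K -> head 0%VS K != head 0%VS L ->
  pairing V L K = 0.
Proof.
move=> hL hK ne; rewrite -(LamS_pairing (is_flag_path hL) hK) (spath_form0 hK hL ne).
exact/LamS0/good_point_V.
Qed.

Lemma pairing_expand K L : is_flag_to V K -> is_flag_from_to V W L ->
  pairing V L K = \sum_r pairing V (basef r) K * dualf r L.
Proof.
move=> hK hL; have [hL' _] := andP hL.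
have := expand_dualf (good_pairing' hK).2 hL; rewrite /pairing' hL' => ->.
by apply: eq_bigr => r _; rewrite basef_flag_to mulrzz.
Qed.

Lemma lam_pairing x r : lam (pairing V (basef r)) x = (coords x *m gram) 0 r.
Proof.
have hg := good_pairing V (basef r).
elim/Delta_ind: x => [|x y IHx IHy|K hK].
- rewrite lam0 // mxE big1 // => t _; rewrite mxE lam0 ?mul0r //; exact: good_dualf.
- by rewrite lamB // IHx IHy coordsB mulmxBl !mxE.
rewrite lam_dpath // coords_dpath //; case: (eqVneq (head 0%VS K) W) => [e|ne].
  rewrite (expand_dualf hg.2); last by rewrite -e flag_from_self.
  by rewrite mxE; apply: eq_bigr => t _; rewrite !mxE mulrzz mulrC.
rewrite pairing_head ?basef_flag_to //; last by case/andP: (basef_flag r) => _ /eqP ->.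
rewrite mxE big1 // => t _; rewrite mxE; suff -> : dualf t K = 0 by rewrite mul0r.
by apply/eqP; apply: contraT => /dualf_head e; rewrite e eqxx in ne.
Qed.

Lemma Delta_fil_coords l i x : Delta_fil l i x -> dvdm (l ^ i)%:Z (coords x *m gram).
Proof.
by move=> /Delta_filP h a r; rewrite ord1 -lam_pairing; apply: h; apply: basef_flag_to.
Qed.

(** As a function of the test flag the form satisfies (FS), so divisibility on the big cell extends
    to all flags from W; flags starting elsewhere are orthogonal to the W-weight space. *)
Lemma coords_Delta_fil l i x : dvdm (l ^ i)%:Z (coords x *m gram) -> Delta_fil l i (spath [:: W] *: x).
Proof.
move=> h; apply/Delta_filP => L hL.
case: (eqVneq (head 0%VS L) W) => [e|ne]; last first.
  rewrite wt_expand lam_sum; last exact: good_pairing.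
  rewrite big1 ?dvdz0 // => t _; rewrite lamMz ?lam_dpath ?basef_flag_to //; try exact: good_pairing.
  rewrite pairing_head ?mul0r ?basef_flag_to //; case/andP: (basef_flag t) => _ /eqP ->.
  by rewrite eq_sym.
have hL' : is_flag_from_to V W L by rewrite -e flag_from_self.
have -> : lam (pairing V L) (spath [:: W] *: x) = \sum_r (coords x *m gram) 0 r * dualf r L.
  rewrite wt_expand -[coords x in RHS]coords_wt wt_expand; move: (coords x) => c.
  have lamT L' t : lam (pairing V L') (dpath V (basef t) *~ c 0 t) = pairing V L' (basef t) * c 0 t.
    rewrite lamMz; last exact: good_pairing.
    by rewrite (lam_dpath (good_pairing V L') (basef_flag_to t)).
  have lamS L' : lam (pairing V L') (\sum_t dpath V (basef t) *~ c 0 t) = \sum_t pairing V L' (basef t) * c 0 t.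
    by rewrite lam_sum; [apply: eq_bigr => t _; apply: lamT | exact: good_pairing].
  rewrite lamS; under [RHS]eq_bigr do rewrite -lam_pairing lamS mulr_suml.
  rewrite exchange_big; apply: eq_bigr => t _ /=.
  rewrite (pairing_expand (basef_flag_to t) hL') mulr_suml; apply: eq_bigr => r _.
  by rewrite mulrAC.
by apply: rpred_sum => r _; rewrite dvdz_mulr.
Qed.

(** The functional [dualf s] is applied to [omega] for the flag [basef t]; expanding the form in the
    dual functions turns the sum over all flags into the (t, s) entry of the product. *)
Lemma AF : gram *m St_gram = (gram_const%:Z)%:M.
Proof.
apply/matrixP => t s; rewrite !mxE.
transitivity (\sum_(K <- flagsn V m W) pairing V K (basef t) * dualf s K).
  under eq_bigr do rewrite !mxE mulr_sumr.
  rewrite exchange_big /= big_seq [RHS]big_seq; apply: eq_bigr => K.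
  rewrite mem_flagsn => /andP [hK _].
  rewrite (pairing_expand (basef_flag_to t) hK) mulr_suml; apply: eq_bigr => r _.
  by rewrite mulrA.
have := omega (basef_flag t) (quot_dim hphi) => /(congr1 (lam (dualf s))).
rewrite lam_sum; last exact: good_dualf.
rewrite lamMn ?lam_dpath ?basef_flag_to ?dualfD -/gram_const //; try exact: good_dualf.
rewrite eq_sym -[RHS]mulr_natl natz mulr_natr => <-.
rewrite big_seq [RHS]big_seq; apply: eq_bigr => K; rewrite mem_flagsn => /andP [/andP [hK _] _].
by rewrite lamMz ?lam_dpath //; [apply: mulrC | exact: good_dualf | exact: good_dualf].
Qed.

End Coordinates.

(** * The action of GL on both sides *)

Section Equivariance.
Variables (F : finFieldType) (n m : nat) (V W : subsp F n).
Variable phi : 'Hom('cV[F]_n, 'cV[F]_m).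
Hypothesis VW : (V <= W)%VS.
Hypothesis hphi : quot_iso V W phi.
Local Notation G := (GLmat F m).
Implicit Types (g h u : G).
Local Notation gflag := (gflag W phi).
Local Notation w0 := (w0 m).
Local Notation q := #|F|.
Local Notation nU := (nU F m).
Local Notation dualf := (dualf W phi).
Local Notation basef := (basef W phi).
Local Notation coords := (@coords F n m V W phi).
Local Notation gram := (gram V W phi).
Local Notation St_gram := (St_gram V W phi).
Local Notation Ug t := (unip t * GLperm F w0)%g.

(** Coordinates are row vectors and matrices act on the right, so [rho] reverses products. *)
Definition rho g : 'M[int]_nU := \matrix_(t, s) dualf s (gflag (g * Ug t)%g).

Lemma dualf_trans g h s : dualf s (gflag (g * h)%g) = \sum_t dualf t (gflag h) * dualf s (gflag (g * Ug t)%g).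
Proof.
have e h' : apt W phi (unip s) (gflag (g * h')%g) = apt W phi (g^-1 * unip s)%g (gflag h').
  by rewrite -(apt_mul VW hphi (unip s)) -(apt_mul VW hphi (g^-1 * unip s)%g) invMg invgK mulgA.
rewrite dualfE e.
rewrite (expand_dualf VW hphi (fs_apt VW hphi _) (gflag_flag VW hphi h)) mulr_sumr.
by apply: eq_bigr => t _; rewrite (dualfE W phi s) e mulrzz mulrA mulrC.
Qed.

Lemma rhoM g h : rho g *m rho h = rho (h * g)%g.
Proof.
apply/matrixP => t s; rewrite !mxE -mulgA dualf_trans.
by apply: eq_bigr => r _; rewrite !mxE.
Qed.

Lemma rho1 : rho 1%g = 1%:M.
Proof.
by apply/matrixP => t s; rewrite !mxE mul1g -[gflag _]/(basef t) (dualfD VW hphi) eq_sym.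
Qed.

(** Flags are cosets of B. Passing to sums over G turns translation by g into a reindexing, from
    which [St_gram_inv] follows after cancelling |B|. *)
Lemma sum_gflag (f : seq (subsp F n) -> int) :
  \sum_h f (gflag h) = #|[pred b : G | in_B b]|%:R * \sum_(K <- flagsn V m W) f K.
Proof.
transitivity (\sum_h \sum_(K <- flagsn V m W) if K == gflag h then f K else 0).
  apply: eq_bigr => h _.
  by rewrite -big_mkcond -big_filter filter_pred1_uniq ?big_seq1 ?uniq_flagsn ?mem_gflag.
rewrite exchange_big mulr_sumr /= big_seq [RHS]big_seq; apply: eq_bigr => K.
rewrite mem_flagsn => /andP [/(gflag_surj VW hphi) [g <-] _].
rewrite -big_mkcond sumr_const -[LHS]mulr_natl; congr (_%:R * _).
rewrite -(card_imset [pred b : G | in_B b] (mulgI g)); apply: eq_card => h.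
transitivity (gflag g == gflag h); first by [].
apply/eqP/imsetP => [/(gflag_eqP VW hphi) hB|[b]].
  by exists (g^-1 * h)%g; rewrite ?inE // mulKVg.
by rewrite inE => hB ->; rewrite (gflag_mul VW hphi).
Qed.

Lemma St_gram_inv g : (rho g)^T *m St_gram *m rho g = St_gram.
Proof.
apply/matrixP => a b.
have -> : ((rho g)^T *m St_gram *m rho g) a b =
    flag_dot m V W (fun K => \sum_t dualf t K * dualf a (gflag (g * Ug t)%g))
                   (fun K => \sum_t dualf t K * dualf b (gflag (g * Ug t)%g)).
  rewrite mxE; under eq_bigr do rewrite mxE mulr_suml.
  rewrite /flag_dot; under [RHS]eq_bigr do rewrite mulr_sumr.
  rewrite [RHS]exchange_big; apply: eq_bigr => s _.
  under [RHS]eq_bigr do rewrite mulr_suml.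
  rewrite [RHS]exchange_big; apply: eq_bigr => t _.
  rewrite !mxE /flag_dot mulr_sumr mulr_suml; apply: eq_bigr => K _ /=.
  move: (dualf t K) (dualf s K) (dualf a _) (dualf b _) => x y z z'.
  by rewrite -!mulrA mulrCA.
rewrite mxE; have cB : #|[pred b : G | in_B b]|%:R != 0 :> int.
  rewrite pnatr_eq0 -lt0n; apply/card_gt0P; exists 1%g.
  by have := group1 (B_group F m); rewrite !inE.
apply: (mulfI cB); rewrite /flag_dot.
rewrite -(sum_gflag (fun K => (\sum_t dualf t K * dualf a (gflag (g * Ug t)%g)) * (\sum_t dualf t K * dualf b (gflag (g * Ug t)%g)))).
rewrite -(sum_gflag (fun K => dualf a K * dualf b K)).
rewrite [RHS](reindex_inj (mulgI g)) /=; apply: eq_bigr => h _.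
by rewrite !dualf_trans.
Qed.

Lemma St_gram_sym : St_gram^T = St_gram.
Proof. by apply/matrixP => a b; rewrite !mxE; apply: eq_bigr => K _; apply: mulrC. Qed.

Lemma gram_const_gt0 : (0 < gram_const m V)%N.
Proof.
have q0 : (0 < q)%N by apply/card_gt0P; exists 0.
rewrite /gram_const muln_gt0 expn_gt0 q0 /=.
by elim: (m) => //= j IH; rewrite muln_gt0 IH.
Qed.

(** A is inverse to G up to a nonzero integer, so it inherits the invariance of G. The factor G is
    cancelled by multiplying with the transpose of A, since G is symmetric. *)
Lemma rho_gram g : rho g *m gram = gram *m (rho g^-1%g)^T.
Proof.
have FA : St_gram *m gram^T = (gram_const m V)%:Z%:M.
  by rewrite -{1}St_gram_sym -trmx_mul (AF VW hphi) tr_scalar_mx.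
have e1 : (rho g^-1%g)^T *m St_gram = St_gram *m rho g.
  by rewrite -[in RHS](St_gram_inv g^-1%g) -[RHS]mulmxA rhoM mulgV rho1 mulmx1.
have e2 : (rho g *m gram - gram *m (rho g^-1%g)^T) *m St_gram = 0.
  by rewrite mulmxBl -[X in X - _]mulmxA (AF VW hphi) -[X in _ - X]mulmxA e1 mulmxA (AF VW hphi) scalar_mxC subrr.
apply/eqP; rewrite -subr_eq0; apply/eqP.
have := congr1 (fun M => M *m gram^T) e2; rewrite -mulmxA FA mul0mx mul_mx_scalar.
move/matrixP => h; apply/matrixP => i j; have := h i j; rewrite mxE [RHS]mxE => /eqP.
rewrite mulf_eq0 => /orP [|/eqP -> //]; last by rewrite mxE.
by move=> e; have := gram_const_gt0; rewrite lt0n => /negP; case; rewrite -eqz_nat.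
Qed.

Lemma Delta_eq x y : spath [:: W] *: x = x -> spath [:: W] *: y = y ->
  coords x = coords y -> x = y.
Proof. by move=> <- <-; rewrite !(coords_wt VW hphi) !(wt_expand VW hphi) => ->. Qed.

Lemma wt_gflag g : spath [:: W] *: dpath V (gflag g) = dpath V (gflag g).
Proof.
have /andP [h /eqP e] := gflag_flag VW hphi g.
by rewrite scale_spath1 // e eqxx.
Qed.

(** The action is prescribed on the basis of big-cell flags only, hence well defined; [rhoD_gflag]
    shows that it permutes all flags from W to V. *)
Definition rhoD g (x : Delta V) : Delta V := \sum_t dpath V (gflag (g * Ug t)%g) *~ coords x 0 t.

Lemma wt_sum (f : 'I_nU -> Delta V) : (forall t, spath [:: W] *: f t = f t) ->
  spath [:: W] *: (\sum_t f t) = \sum_t f t.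
Proof. by move=> h; rewrite scaler_sumr; apply: eq_bigr. Qed.

Lemma wt_rhoD g x : spath [:: W] *: rhoD g x = rhoD g x.
Proof. by apply: wt_sum => t; rewrite -scalerMzr wt_gflag. Qed.

Lemma coords_gflag g : coords (dpath V (gflag g)) = \row_t dualf t (gflag g).
Proof. by apply: (coords_dpath VW hphi); have /andP [] := gflag_flag VW hphi g. Qed.

Lemma coords_rhoD g x : coords (rhoD g x) = coords x *m rho g.
Proof.
apply/rowP => s; rewrite mxE lam_sum; last exact: good_dualf.
rewrite mxE; apply: eq_bigr => t _; rewrite lamMz; last exact: good_dualf.
rewrite lam_dpath; [|exact: good_dualf|by have /andP [] := gflag_flag VW hphi (g * Ug t)%g].
by rewrite [in RHS]mxE mulrC; congr (_ * _); rewrite mxE.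
Qed.

Lemma rhoD_gflag g h : rhoD g (dpath V (gflag h)) = dpath V (gflag (g * h)%g).
Proof.
apply: Delta_eq; rewrite ?wt_rhoD ?wt_gflag //.
rewrite coords_rhoD !coords_gflag; apply/rowP => s; rewrite !mxE dualf_trans.
by apply: eq_bigr => t _; rewrite !mxE.
Qed.

Section Rows.
Variable R : comNzRingType.
Implicit Types x y : grp_alg F m R.

Definition St_row x : 'rV[R]_nU := \row_t x (Ug t).
Definition row_St (a : 'rV[R]_nU) : grp_alg F m R :=
  [ffun h => \sum_t a 0 t * (dualf t (gflag h))%:~R].

Lemma St_row_St a : St F m R (row_St a).
Proof.
pose b u : R := if [pick t | unip t == u] is Some t then a 0 t else 0.
suff -> : row_St a = [ffun h => \sum_(u | in_U u) b u * (apt' W phi u (gflag h))%:~R].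
  exact: (St_fun VW hphi).
apply/ffunP => h; rewrite !ffunE (big_ut (fun u => b u * (apt' W phi u (gflag h))%:~R)).
apply: eq_bigr => t _; congr (_ * _); rewrite /b; case: pickP => [s /eqP /unip_inj -> //|].
by move/(_ t); rewrite eqxx.
Qed.

Lemma St_rowK a : St_row (row_St a) = a.
Proof.
apply/rowP => s; rewrite mxE ffunE (bigD1 s) //= -[gflag _]/(basef s) (dualfD VW hphi) eqxx mulr1.
by rewrite big1 ?addr0 // => t ts; rewrite (dualfD VW hphi) (negPf ts) mulr0.
Qed.

Lemma row_StK x : St F m R x -> row_St (St_row x) = x.
Proof.
move=> hx; apply/ffunP => h; rewrite ffunE (St_expand VW hphi h hx).
rewrite (big_ut (fun u => x (u * GLperm F w0)%g * (apt' W phi u (gflag h))%:~R)).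
by apply: eq_bigr => t _; rewrite mxE.
Qed.

Lemma row_St_lin (c : R) a b : row_St (c *: a + b) = c *: row_St a + row_St b.
Proof.
apply/ffunP => h; rewrite !ffunE /GRing.scale /= mulr_sumr -big_split /=.
by apply: eq_bigr => t _; rewrite !mxE mulrDl mulrA.
Qed.

Lemma row_St0 : row_St 0 = 0.
Proof.
by apply/ffunP => h; rewrite !ffunE big1 // => t _; rewrite mxE mul0r.
Qed.

Lemma St_row_lin (c : R) x y : St_row (c *: x + y) = c *: St_row x + St_row y.
Proof. by apply/rowP => t; rewrite !mxE !ffunE. Qed.

Lemma St_row_act g x : St F m R x ->
  St_row (gmul (gelt R g) x) = St_row x *m (map_mx intr (rho g^-1%g))^T.
Proof.
move=> hx; apply/rowP => t; rewrite mxE gelt_mulE (St_expand VW hphi _ hx).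
rewrite (big_ut (fun u => x (u * GLperm F w0)%g * (apt' W phi u (gflag (g^-1 * Ug t)%g))%:~R)).
by rewrite mxE; apply: eq_bigr => s _; rewrite !mxE.
Qed.

Lemma row_St_act g a : gmul (gelt R g) (row_St a) = row_St (a *m (map_mx intr (rho g^-1%g))^T).
Proof.
by rewrite -[LHS]row_StK ?St_row_act ?St_rowK //; try apply: (St_act_closed); apply: St_row_St.
Qed.

End Rows.

Lemma Gow_form_row (x y : grp_alg F m int) : St F m int x -> St F m int y ->
  Gow_form x y = (St_row x *m St_gram *m (St_row y)^T) 0 0.
Proof.
move=> hx hy; rewrite (Gow_formE VW hphi hx hy).
rewrite (big_ut (fun u => \sum_(v | in_U v) x (u * GLperm F w0)%g * y (v * GLperm F w0)%g * flag_dot m V W (apt' W phi u) (apt' W phi v))).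
rewrite mxE; under [RHS]eq_bigr do rewrite mxE mulr_suml.
rewrite [RHS]exchange_big; apply: eq_bigr => t _ /=.
rewrite (big_ut (fun v => x (Ug t) * y (v * GLperm F w0)%g * flag_dot m V W (apt' W phi (unip t)) (apt' W phi v))).
by apply: eq_bigr => s _; rewrite !mxE mulrAC.
Qed.

Lemma Gow_ZP l j (x : grp_alg F m int) :
  Gow_Z l j x <-> St F m int x /\ dvdm (l ^ j)%:Z (St_row x *m St_gram).
Proof.
split=> -[hx h]; split=> //.
  move=> a t; rewrite ord1; have := h _ (St_row_St (delta_mx 0 t)).
  rewrite Gow_form_row ?St_rowK //; last exact: St_row_St.
  by rewrite trmx_delta -colE mxE.
move=> y hy; rewrite Gow_form_row // mxE.
by apply: rpred_sum => t _; rewrite dvdz_mulr.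
Qed.

Lemma St_red_row_St (k : fieldType) (a : 'rV[int]_nU) : St_red k (row_St a) = row_St (map_mx intr a).
Proof.
apply/ffunP => h; rewrite !ffunE rmorph_sum; apply: eq_bigr => t _.
by rewrite mxE /= rmorphM /= intz.
Qed.

End Equivariance.

Lemma row_decomp (k : fieldType) N (P : 'M[k]_N) (p : pred 'I_N) (x : 'I_N -> 'rV[k]_N) (b : 'rV[k]_N) :
  P \in unitmx -> (forall t, p t -> x t *m P = delta_mx 0 t) ->
  (forall t, ~~ p t -> (b *m P) 0 t = 0) -> b = \sum_(t | p t) (b *m P) 0 t *: x t.
Proof.
move=> uP hx hb; apply: (can_inj (mulmxK uP)); rewrite mulmx_suml.
rewrite [LHS]row_sum_delta big_mkcond [RHS]big_mkcond; apply: eq_bigr => t _ /=.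
by case: (boolP (p t)) => [pt|/hb ->]; rewrite -?scalemxAl ?hx // scale0r.
Qed.

(** * Comparison of the filtrations *)

Section OverField.
Variables (F : finFieldType) (n m : nat) (V W : subsp F n).
Variable phi : 'Hom('cV[F]_n, 'cV[F]_m).
Hypothesis VW : (V <= W)%VS.
Hypothesis hphi : quot_iso V W phi.
Variables (k : fieldType) (l : nat).
Hypothesis hl : l \in [pchar k].
Local Notation G := (GLmat F m).
Implicit Types (g h : G).
Local Notation gflag := (gflag W phi).
Local Notation w0 := (w0 m).
Local Notation nU := (nU F m).
Local Notation dualf := (dualf W phi).
Local Notation basef := (basef W phi).
Local Notation coords := (@coords F n m V W phi).
Local Notation gram := (gram V W phi).
Local Notation St_gram := (St_gram V W phi).
Local Notation Ug t := (unip t * GLperm F w0)%g.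
Local Notation rho := (rho W phi).
Local Notation row_St := (@row_St F n m W phi _).
Local Notation St_row := (@St_row F m _).
Local Notation rhok g := (map_mx (intr : int -> k) (rho g)).
Local Notation kap := (logn l (gram_const m V)).

Definition lamk t (x : Delta V) : k := (lam (dualf t) x)%:~R.

Lemma lamk_additive t : zmod_morphism (lamk t).
Proof. by move=> x y; rewrite /lamk lamB ?rmorphB //; exact: good_dualf. Qed.

Definition coordsk (u : Deltak V k) : 'rV[k]_nU := \row_t bclift (lamk t) u.

Lemma coordsk_lin a u w : coordsk (a *: u + w) = a *: coordsk u + coordsk w.
Proof. by apply/rowP => t; rewrite !mxE bclift_linear //; exact: lamk_additive. Qed.

Lemma coordsk0 : coordsk 0 = 0.
Proof. by have := coordsk_lin (-1) 0 0; rewrite scaler0 addr0 scaleN1r addNr. Qed.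

Lemma coordskD u w : coordsk (u + w) = coordsk u + coordsk w.
Proof. by have := coordsk_lin 1 u w; rewrite !scale1r. Qed.

Lemma coordsk_tens x : coordsk (tens k x) = redm k (coords x).
Proof. by apply/rowP => t; rewrite !mxE bclift_tens //; exact: lamk_additive. Qed.

Lemma wt_projP a u w U : wt_proj U (a *: u + w : Deltak V k) = a *: wt_proj U u + wt_proj U w.
Proof. exact: bcmap_linear. Qed.

Lemma wt_proj0 U : wt_proj U (0 : Deltak V k) = 0.
Proof. by have := wt_projP (-1) 0 0 U; rewrite scaler0 addr0 scaleN1r addNr. Qed.

Lemma wt_projB u w U : wt_proj U (u - w : Deltak V k) = wt_proj U u - wt_proj U w.
Proof. by rewrite addrC -scaleN1r wt_projP scaleN1r addrC. Qed.

Lemma wt_proj_tens U x : wt_proj U (tens k x : Deltak V k) = tens k (spath [:: U] *: x).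
Proof. exact: bcmap_tens. Qed.

Definition elk (a : 'rV[k]_nU) : Deltak V k := \sum_t a 0 t *: tens k (dpath V (basef t)).

Lemma elk_lin c a b : elk (c *: a + b) = c *: elk a + elk b.
Proof.
rewrite /elk scaler_sumr -big_split; apply: eq_bigr => t _ /=.
by rewrite !mxE scalerDl scalerA.
Qed.

Lemma elk0 : elk 0 = 0.
Proof. by rewrite /elk big1 // => t _; rewrite mxE scale0r. Qed.

Lemma elk_sum (I : Type) (r : seq I) (p : pred I) (f : I -> 'rV[k]_nU) :
  elk (\sum_(i <- r | p i) f i) = \sum_(i <- r | p i) elk (f i).
Proof.
apply: (big_morph elk _ elk0) => a b.
by have := elk_lin 1 a b; rewrite !scale1r.
Qed.

Lemma elkZ c a : elk (c *: a) = c *: elk a.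
Proof. by have := elk_lin c a 0; rewrite elk0 !addr0. Qed.

Lemma tensMz (x : Delta V) (z : int) : tens k (x *~ z) = z%:~R *: tens k x :> Deltak V k.
Proof. by rewrite raddfMz scaler_int. Qed.

Definition el (a : 'rV[int]_nU) : Delta V := \sum_t dpath V (basef t) *~ a 0 t.

Lemma elk_redm a : elk (redm k a) = tens k (el a).
Proof. by rewrite /el raddf_sum; apply: eq_bigr => t _; rewrite /= tensMz mxE. Qed.

Lemma wt_projE u : wt_proj W u = elk (coordsk u).
Proof.
elim/basechange_ind: u => [|a x u IH]; first by rewrite wt_proj0 coordsk0 elk0.
by rewrite wt_projP IH coordsk_lin elk_lin wt_proj_tens coordsk_tens elk_redm (wt_expand VW hphi).
Qed.

Lemma wt_el a : spath [:: W] *: el a = el a.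
Proof. by apply: wt_sum => t; rewrite -scalerMzr (wt_gflag VW hphi). Qed.

Lemma coords_el a : coords (el a) = a.
Proof.
apply/rowP => s; rewrite mxE lam_sum; last exact: good_dualf.
have e t : lam (dualf s) (dpath V (basef t) *~ a 0 t) = (s == t)%:R * a 0 t.
  rewrite lamMz; last exact: good_dualf.
  by rewrite lam_dpath ?(dualfD VW hphi) ?(basef_flag_to VW hphi) //; exact: good_dualf.
rewrite (eq_bigr _ (fun t _ => e t)) (bigD1 s) //= eqxx mul1r big1 ?addr0 // => t ts.
by rewrite eq_sym (negPf ts) mul0r.
Qed.

Lemma coordsk_elk a : coordsk (elk a) = a.
Proof.
rewrite /elk; transitivity (\sum_t a 0 t *: coordsk (tens k (dpath V (basef t)))).
  rewrite (big_morph coordsk coordskD coordsk0); apply: eq_bigr => t _.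
  by have := coordsk_lin (a 0 t) (tens k (dpath V (basef t))) 0; rewrite coordsk0 !addr0.
rewrite [RHS]row_sum_delta; apply: eq_bigr => t _; congr (_ *: _).
by rewrite coordsk_tens (coords_basef VW hphi) /redm map_delta_mx.
Qed.

Lemma coordsk_wt u : coordsk (wt_proj W u) = coordsk u.
Proof. by rewrite wt_projE coordsk_elk. Qed.

Lemma span_sub (R : pzRingType) (M : lmodType R) (A : set M) x : A x -> x \in Defs.span A.
Proof.
move=> Ax; apply/asboolP; rewrite -[x]addr0 -[x]scale1r; apply: span_set_add => //.
by constructor.
Qed.

(** The data and properties that [smith_bases] supplies for [gram] and [St_gram]. *)
Variables (P Q : 'M[k]_nU) (v : 'I_nU -> nat) (un : 'I_nU -> k).
Hypothesis uP : P \in unitmx.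
Hypothesis uQ : Q \in unitmx.
Hypothesis vk : forall t, (v t <= kap)%N.
Hypothesis un0 : forall t, un t != 0.
Hypothesis S2 : forall i (x : 'rV[int]_nU), dvdm (l ^ i)%:Z (x *m gram) ->
  forall t, (v t < i)%N -> (redm k x *m P) 0 t = 0.
Hypothesis S3 : forall i t, (i <= v t)%N -> exists x : 'rV[int]_nU,
  dvdm (l ^ i)%:Z (x *m gram) /\ redm k x *m P = delta_mx 0 t.
Hypothesis S4 : forall j (y : 'rV[int]_nU), dvdm (l ^ j)%:Z (y *m St_gram) ->
  forall t, (kap < j + v t)%N -> (redm k y *m Q) 0 t = 0.
Hypothesis S5 : forall j t, (j + v t <= kap)%N -> exists y : 'rV[int]_nU,
  dvdm (l ^ j)%:Z (y *m St_gram) /\ redm k y *m Q = delta_mx 0 t.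
Hypothesis S6 : forall i (x y : 'rV[int]_nU), x *m gram = (l ^ i)%:Z *: y -> forall t,
  (v t = i -> (redm k y *m Q) 0 t = un t * (redm k x *m P) 0 t) /\
  ((i < v t)%N -> (redm k y *m Q) 0 t = 0).

Lemma Jantzen_coordsk i u : u \in Jantzen V k l i -> forall t, (v t < i)%N -> (coordsk u *m P) 0 t = 0.
Proof.
move=> /asboolP; elim=> [|a x y [z hz <-] _ IH] t vt.
  by rewrite coordsk0 mul0mx mxE.
rewrite coordsk_lin mulmxDl -scalemxAl mxE IH // addr0 mxE coordsk_tens.
by rewrite (S2 (Delta_fil_coords VW hphi hz)) // mulr0.
Qed.

(** With [Jantzen_coordsk]: in P-coordinates the weight space of the i-th term is spanned by the
    basis vectors with v t >= i, since each of these lifts to an integral vector of Delta^i by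
    [S3]. *)
Lemma coordsk_Jantzen i u : (forall t, (v t < i)%N -> (coordsk u *m P) 0 t = 0) ->
  wt_proj W u \in Jantzen V k l i.
Proof.
move=> h; pose S t := [set x : 'rV[int]_nU | dvdm (l ^ i)%:Z (x *m gram) /\ redm k x *m P = delta_mx 0 t].
pose xx t := xget 0 (S t).
have hxx t : (i <= v t)%N -> S t (xx t).
  by move=> it; rewrite /xx; case: xgetP => // hn; have [x hx] := S3 it; case: (hn x).
rewrite wt_projE (@row_decomp _ _ P (fun t => i <= v t)%N (fun t => redm k (xx t)) (coordsk u)) //.
- rewrite elk_sum; apply: rpred_sum => t it; rewrite elkZ rpredZ // elk_redm.
  apply: span_sub; exists (el (xx t)) => //; rewrite -wt_el.
  by apply: (coords_Delta_fil VW hphi); rewrite coords_el; case: (hxx t it).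
- by move=> t it; case: (hxx t it).
- by move=> t; rewrite -ltnNge; apply: h.
Qed.

Lemma wt_Jantzen i u : u \in Jantzen V k l i -> wt_proj W u \in Jantzen V k l i.
Proof. by move=> h; apply: coordsk_Jantzen; apply: Jantzen_coordsk. Qed.

Lemma row_St_sum (I : Type) (r : seq I) (p : pred I) (f : I -> 'rV[k]_nU) :
  row_St (\sum_(i <- r | p i) f i) = \sum_(i <- r | p i) row_St (f i).
Proof.
apply: (big_morph row_St _ (row_St0 _ _ _)) => a b.
by have := row_St_lin W phi 1 a b; rewrite !scale1r.
Qed.

Lemma stkZ c (a : 'rV[k]_nU) : row_St (c *: a) = c *: row_St a.
Proof. by have := row_St_lin W phi c a 0; rewrite row_St0 !addr0. Qed.

Lemma strow0 : St_row (0 : grp_alg F m k) = 0.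
Proof. by apply/rowP => t; rewrite !mxE ffunE. Qed.

Lemma Gow_St_row j z : z \in Gow F m k l j -> St F m k z /\
  forall t, (kap < j + v t)%N -> (St_row z *m Q) 0 t = 0.
Proof.
move=> /asboolP; elim=> [|a x y [w hw <-] _ [IHs IH]].
  by split=> [|t _]; [apply: St0 | rewrite strow0 mul0mx mxE].
have [hs hd] := (Gow_ZP VW hphi l j w).1 hw.
have e : St_red k w = row_St (redm k (St_row w)) by rewrite -(St_red_row_St W phi) (row_StK VW hphi).
split; first by apply: St_lin => //; rewrite e; exact: (St_row_St VW hphi).
move=> t ht; rewrite St_row_lin mulmxDl -scalemxAl mxE IH // addr0 mxE.
by rewrite e (St_rowK VW hphi) (S4 hd) // mulr0.
Qed.

(** The counterpart of [coordsk_Jantzen]: Gow's j-th term is spanned by the Q-basis vectors with v t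
    <= kap - j, so the order of the basis is reversed. *)
Lemma St_row_Gow j z : St F m k z -> (forall t, (kap < j + v t)%N -> (St_row z *m Q) 0 t = 0) ->
  z \in Gow F m k l j.
Proof.
move=> hz h; pose S t := [set y : 'rV[int]_nU | dvdm (l ^ j)%:Z (y *m St_gram) /\ redm k y *m Q = delta_mx 0 t].
pose xx t := xget 0 (S t).
have hxx t : (j + v t <= kap)%N -> S t (xx t).
  by move=> it; rewrite /xx; case: xgetP => // hn; have [x hx] := S5 it; case: (hn x).
rewrite -(row_StK VW hphi hz) (@row_decomp _ _ Q (fun t => j + v t <= kap)%N (fun t => redm k (xx t)) (St_row z)) //.
- rewrite row_St_sum; apply: rpred_sum => t it; rewrite stkZ rpredZ //.
  apply: span_sub; exists (row_St (xx t)); last exact: St_red_row_St.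
  apply/(Gow_ZP VW hphi); rewrite (St_rowK VW hphi); split; first exact: (St_row_St VW hphi).
  by case: (hxx t it).
- by move=> t it; case: (hxx t it).
- by move=> t; rewrite -ltnNge; apply: h.
Qed.

Lemma redmT a b (M : 'M[int]_(a, b)) : redm k M^T = (redm k M)^T.
Proof. by rewrite /redm map_trmx. Qed.

Lemma Gow_act j g z : z \in Gow F m k l j -> gmul (gelt k g) z \in Gow F m k l j.
Proof.
move=> /asboolP; elim=> [|a x y [w hw <-] _ IH].
  suff -> : gmul (gelt k g) 0 = 0 by exact: rpred0.
  by apply/ffunP => h; rewrite gelt_mulE !ffunE.
rewrite gmul_linr rpredD // rpredZ //; apply: span_sub.
have [hs hd] := (Gow_ZP VW hphi l j w).1 hw.
exists (gmul (gelt int g) w); last first.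
  by apply/ffunP => h; rewrite [LHS]ffunE [RHS]gelt_mulE [RHS]ffunE gelt_mulE.
apply/(Gow_ZP VW hphi); split; first exact: St_act_closed.
rewrite (St_row_act VW hphi) // map_mx_id; last exact: intz.
have -> : St_row w *m (rho g^-1%g)^T *m St_gram = St_row w *m St_gram *m rho g.
  by rewrite -!mulmxA -[in RHS](St_gram_inv VW hphi g^-1%g) -!mulmxA (rhoM VW hphi) mulgV (rho1 VW hphi) mulmx1.
exact: dvdm_mull.
Qed.

(* On tens (Delta^i) this is reduction modulo l of l^-i times the map defined by
   the standard form, up to the next step of Gow's filtration. *)
Definition grmx i (a : 'rV[k]_nU) : 'rV[k]_nU :=
  (\row_t (if v t == i then un t * (a *m P) 0 t else 0)) *m invmx Q.

Lemma grmxQ i a t : (grmx i a *m Q) 0 t = if v t == i then un t * (a *m P) 0 t else 0.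
Proof. by rewrite /grmx mulmxKV // mxE. Qed.

Lemma grmx_lin i c a b : grmx i (c *: a + b) = c *: grmx i a + grmx i b.
Proof.
rewrite /grmx scalemxAl -mulmxDl; congr (_ *m _); apply/rowP => t; rewrite !mxE.
case: ifP => _; last by rewrite mulr0 addr0.
rewrite mulrCA -mulrDr; congr (_ * _).
by rewrite mulr_sumr -big_split; apply: eq_bigr => s _ /=; rewrite !mxE mulrDl mulrA.
Qed.

Definition grmap i (u : Deltak V k) : grp_alg F m k := row_St (grmx i (coordsk u)).

Lemma grmap_lin i a u w : grmap i (a *: u + w) = a *: grmap i u + grmap i w.
Proof. by rewrite /grmap coordsk_lin grmx_lin row_St_lin. Qed.

Lemma hmapB i u w : grmap i (u - w) = grmap i u - grmap i w.
Proof. by rewrite addrC -scaleN1r grmap_lin scaleN1r addrC. Qed.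

Lemma grmap0 i : grmap i 0 = 0.
Proof. by rewrite -[in LHS](subrr 0) hmapB subrr. Qed.

Lemma gmul_gelt0 g : gmul (gelt k g) 0 = 0.
Proof. by apply/ffunP => h; rewrite gelt_mulE !ffunE. Qed.

Lemma gmul_geltB g (x y : grp_alg F m k) :
  gmul (gelt k g) (x - y) = gmul (gelt k g) x - gmul (gelt k g) y.
Proof. by rewrite addrC -scaleN1r gmul_linr scaleN1r addrC. Qed.

Lemma St_grmap i u : St F m k (grmap i u).
Proof. exact: (St_row_St VW hphi). Qed.

Lemma hmapQ i u t : (St_row (grmap i u) *m Q) 0 t = if v t == i then un t * (coordsk u *m P) 0 t else 0.
Proof. by rewrite /grmap (St_rowK VW hphi) grmxQ. Qed.

Lemma grmap_wt i u : grmap i (wt_proj W u) = grmap i u.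
Proof. by rewrite /grmap coordsk_wt. Qed.

Definition rhoDk g (u : Deltak V k) : Deltak V k := \sum_t coordsk u 0 t *: tens k (dpath V (gflag (g * Ug t)%g)).

Lemma rhoDk_lin g a u w : rhoDk g (a *: u + w) = a *: rhoDk g u + rhoDk g w.
Proof.
rewrite /rhoDk scaler_sumr -big_split; apply: eq_bigr => t _ /=.
by rewrite coordsk_lin !mxE scalerDl scalerA.
Qed.

Lemma rhoDk0 g : rhoDk g 0 = 0.
Proof. by have := rhoDk_lin g (-1) 0 0; rewrite scaler0 addr0 scaleN1r addNr. Qed.

Lemma rhoDkB g u w : rhoDk g (u - w) = rhoDk g u - rhoDk g w.
Proof. by rewrite addrC -scaleN1r rhoDk_lin scaleN1r addrC. Qed.

Lemma rhoDk_tens g x : rhoDk g (tens k x) = tens k (rhoD W phi g x).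
Proof.
rewrite /rhoDk /rhoD raddf_sum; apply: eq_bigr => t _ /=.
by rewrite tensMz coordsk_tens !mxE.
Qed.

Lemma rhoDk_wt g u : rhoDk g (wt_proj W u) = rhoDk g u.
Proof. by rewrite /rhoDk coordsk_wt. Qed.

Lemma wt_rhoDk g u : wt_proj W (rhoDk g u) = rhoDk g u.
Proof.
elim/basechange_ind: u => [|a x u IH]; first by rewrite rhoDk0 wt_proj0.
by rewrite rhoDk_lin wt_projP IH rhoDk_tens wt_proj_tens (wt_rhoD VW hphi).
Qed.

Lemma rhoDk_Jantzen g i u : u \in Jantzen V k l i -> rhoDk g u \in Jantzen V k l i.
Proof.
move=> /asboolP; elim=> [|a x y [z hz <-] _ IH]; first by rewrite rhoDk0 rpred0.
rewrite rhoDk_lin rpredD // rpredZ // rhoDk_tens; apply: span_sub; exists (rhoD W phi g z) => //.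
rewrite -(wt_rhoD VW hphi); apply: (coords_Delta_fil VW hphi).
rewrite (coords_rhoD VW hphi) -mulmxA (rho_gram VW hphi) mulmxA; apply: dvdm_mull.
exact: (Delta_fil_coords VW hphi).
Qed.

Lemma St_B x y : St F m k x -> St F m k y -> St F m k (x - y).
Proof. by move=> hx hy; rewrite addrC -scaleN1r; apply: St_lin. Qed.

Lemma strowB (x y : grp_alg F m k) : St_row (x - y) = St_row x - St_row y.
Proof. by rewrite addrC -scaleN1r St_row_lin scaleN1r addrC. Qed.

Lemma gap_lt i t : (i <= kap)%N -> (kap < (kap - i).+1 + v t)%N = (i <= v t)%N.
Proof. by move=> ik; rewrite addSn ltnS -leq_subLR subKn. Qed.

(** The coordinates with v t > i vanish on both sides and those with v t = i agree. Those with v t <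
    i are not controlled, but they span the step kap - i + 1 of Gow's filtration. *)
Lemma grmap_theta i x y : (i <= kap)%N -> coords x *m gram = (l ^ i)%:Z *: y ->
  grmap i (tens k x) - row_St (redm k y) \in Gow F m k l (kap - i).+1.
Proof.
move=> ik e; apply: St_row_Gow; first by apply: St_B; [apply: St_grmap | exact: (St_row_St VW hphi)].
move=> t; rewrite gap_lt // => it; rewrite strowB mulmxBl mxE hmapQ [X in _ + X]mxE.
have [h1 h2] := S6 e t; rewrite (St_rowK VW hphi) coordsk_tens.
move: it; rewrite leq_eqVlt eq_sym; case: eqP => [/h1 -> _|_ /h2 ->]; first by rewrite subrr.
by rewrite subrr.
Qed.

(** The map depends on the Smith bases, but on images of Delta^i it agrees, up to the next step of
    Gow's filtration, with the reduction of x |-> xA / l^i, which commutes with GL by [rho_gram]. *)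
Lemma grmap_equiv i g u : (i <= kap)%N -> u \in Jantzen V k l i ->
  gmul (gelt k g) (grmap i u) - grmap i (rhoDk g u) \in Gow F m k l (kap - i).+1.
Proof.
move=> ik /asboolP; elim=> [|a x u' [z hz <-] _ IH].
  by rewrite rhoDk0 grmap0 gmul_gelt0 subrr rpred0.
rewrite (grmap_lin i a (tens k z)) gmul_linr rhoDk_lin (grmap_lin i a (rhoDk g (tens k z))).
rewrite opprD addrACA -scalerBr.
apply: rpredD; last exact: IH.
apply: rpredZ => {IH}.
have hd := Delta_fil_coords VW hphi hz.
pose y : 'rV[int]_nU := map_mx (fun c => (c %/ (l ^ i)%:Z)%Z) (coords z *m gram).
have ey : coords z *m gram = (l ^ i)%:Z *: y.
  by apply/rowP => t; rewrite [RHS]mxE [y _ _]mxE mulrC divzK.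
have h1 := grmap_theta ik ey.
have ey' : coords (rhoD W phi g z) *m gram = (l ^ i)%:Z *: (y *m (rho g^-1%g)^T).
  by rewrite (coords_rhoD VW hphi) -mulmxA (rho_gram VW hphi) mulmxA ey scalemxAl.
have h2 := grmap_theta ik ey'; rewrite rhoDk_tens.
have eg : gmul (gelt k g) (row_St (redm k y)) = row_St (redm k (y *m (rho g^-1%g)^T)).
  by rewrite (row_St_act VW hphi) redmM redmT.
have -> : gmul (gelt k g) (grmap i (tens k z)) = gmul (gelt k g) (grmap i (tens k z) - row_St (redm k y))
   + row_St (redm k (y *m (rho g^-1%g)^T)).
  by rewrite gmul_geltB eg subrK.
by rewrite -addrA -[X in _ + X]opprB rpredB //; apply: Gow_act.
Qed.

Lemma grmap_Gow i u : (i <= kap)%N -> grmap i u \in Gow F m k l (kap - i).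
Proof.
move=> ik; apply: St_row_Gow; first exact: St_grmap.
move=> t ht; rewrite hmapQ; case: eqP => // e.
by rewrite e subnK // ltnn in ht.
Qed.

Lemma grmap_surj i y : (i <= kap)%N -> y \in Gow F m k l (kap - i) ->
  exists2 u, u \in Jantzen V k l i & y - grmap i u \in Gow F m k l (kap - i).+1.
Proof.
move=> ik /Gow_St_row [hy hq].
pose a : 'rV[k]_nU := (\row_t (if v t == i then (un t)^-1 * (St_row y *m Q) 0 t else 0)) *m invmx P.
have haP t : (a *m P) 0 t = if v t == i then (un t)^-1 * (St_row y *m Q) 0 t else 0.
  by rewrite /a mulmxKV // mxE.
exists (elk a).
  have -> : elk a = wt_proj W (elk a) by rewrite wt_projE coordsk_elk.
  by apply: coordsk_Jantzen => t vt; rewrite coordsk_elk haP ltn_eqF.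
apply: St_row_Gow; first by apply: St_B => //; apply: St_grmap.
move=> t; rewrite gap_lt // => it; rewrite strowB mulmxBl mxE [X in _ + X]mxE hmapQ coordsk_elk haP.
case: eqP => [_|/eqP ne]; first by rewrite mulVKf // subrr.
rewrite subr0 hq // -ltn_subLR ?leq_subr // subKn //.
by rewrite ltn_neqAle eq_sym ne.
Qed.

Lemma grmap_inj i u : (i <= kap)%N -> u \in Jantzen V k l i ->
  grmap i u \in Gow F m k l (kap - i).+1 -> wt_proj W u \in Jantzen V k l i.+1.
Proof.
move=> ik hu /Gow_St_row [_ h]; apply: coordsk_Jantzen => t; rewrite ltnS leq_eqVlt.
move=> /orP [/eqP e|]; last exact: Jantzen_coordsk.
have := h t; rewrite gap_lt // e leqnn => /(_ isT); rewrite hmapQ e eqxx => /eqP.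
by rewrite mulf_eq0 (negPf (un0 t)) => /eqP.
Qed.

Lemma grmap_ker i u : u \in Jantzen V k l i.+1 -> grmap i u = 0.
Proof.
move=> hu; rewrite /grmap (_ : grmx i _ = 0) ?row_St0 // -[LHS](mulmxK uQ).
rewrite (_ : grmx i _ *m Q = 0) ?mul0mx //; apply/rowP => t; rewrite grmxQ [RHS]mxE.
by case: eqP => // e; rewrite (Jantzen_coordsk hu) ?mulr0 // e.
Qed.

Lemma flag_comb_act g (c : seq (k * seq (subsp F n))) : all (fun t => is_flag_from_to V W t.2) c ->
  flag_comb V [seq (t.1, map (sub_act W phi g) t.2) | t <- c] = rhoDk g (flag_comb V c).
Proof.
rewrite /flag_comb big_map; elim: c => [|t c IH] /=; first by rewrite !big_nil rhoDk0.
move=> /andP [/(gflag_surj VW hphi) [h e] /IH e']; rewrite !big_cons rhoDk_lin e' /=.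
by rewrite -e (sub_act_gflag hphi) rhoDk_tens (rhoD_gflag VW hphi).
Qed.

Lemma wt_flag_comb u : exists2 c : seq (k * seq (subsp F n)),
  all (fun t => is_flag_from_to V W t.2) c & wt_proj W u = flag_comb V c.
Proof.
exists [seq (coordsk u 0 t, basef t) | t <- enum 'I_nU].
  by apply/allP => _ /mapP [t _ ->]; apply: (basef_flag VW hphi).
by rewrite wt_projE /flag_comb big_map big_enum.
Qed.

Lemma qclass_sub (R : pzRingType) (M : lmodType R) (N : submodClosed M) (x y : M) :
  qclass N x = qclass N y <-> x - y \in N.
Proof. by rewrite -qclass_eq; split=> [->//|/eqP]. Qed.

Lemma repr_qclass (R : pzRingType) (M : lmodType R) (N : submodClosed M) (x : M) :
  repr (qclass N x) - x \in N.
Proof. by rewrite -qclass_eq /qclass reprK. Qed.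

Lemma flag_actE i A g u : A (wt_proj W u) ->
  flag_act W phi A (Jantzen V k l i) g (qclass _ (wt_proj W u)) = [set qclass _ (rhoDk g u)].
Proof.
move=> hA; apply/seteqP; split=> [w [c [hc Ac e ->]]|_ ->] /=.
  rewrite (flag_comb_act g hc) -(rhoDk_wt g u); apply/qclass_sub.
  by rewrite -rhoDkB rhoDk_Jantzen //; apply/qclass_sub.
have [c hc e] := wt_flag_comb u; exists c; rewrite -e; split=> //.
by rewrite (flag_comb_act g hc) -e rhoDk_wt.
Qed.

Lemma rep_iso_gr_le i : (i <= kap)%N ->
  rep_iso
    (wt_quot W [set` Jantzen V k l i] (Jantzen V k l i.+1))
    (flag_act W phi [set` Jantzen V k l i] (Jantzen V k l i.+1))
    (Gow_quot F m k l (Posz (kap - i)))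
    (Gow_quot_act F m k l (Posz (kap - i))).
Proof.
move=> ik; pose B := Jantzen V k l i.+1; pose N := Gow F m k l (kap - i).+1.
pose f (u : quotmod B) : quotmod N := qclass N (grmap i (repr u)).
have fE z : f (qclass B z) = qclass N (grmap i z).
  by apply/qclass_sub; rewrite -hmapB grmap_ker ?rpred0 //; apply: repr_qclass.
have f_lin a x y : f (a *: x + y) = a *: f x + f y.
  case: (qclassP x) => x' ->; case: (qclassP y) => y' ->.
  by rewrite -linearP !fE grmap_lin linearP.
exists f; split.
- by move=> a x y _ _; apply: f_lin.
- split.
  + move=> _ [z hz <-]; rewrite /mkset /= fE; exists (grmap i (wt_proj W z)) => //=.
    exact: grmap_Gow.
  + move=> _ _ /set_mem [z hz <-] /set_mem [z' hz' <-].
    rewrite !fE !grmap_wt => /qclass_sub; rewrite -hmapB => h; apply/qclass_sub.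
    by rewrite -wt_projB; apply: grmap_inj => //; apply: rpredB.
  + move=> _ [y hy <-]; have [u hu hyu] := grmap_surj ik hy.
    exists (qclass B (wt_proj W u)); first by exists u.
    by rewrite fE grmap_wt; apply/qclass_sub; rewrite -opprB rpredN.
move=> g _ [z hz <-]; exists (qclass B (rhoDk g z)); split.
- by exists (rhoDk g z); [apply: rhoDk_Jantzen | rewrite wt_rhoDk].
- by apply: flag_actE; apply: wt_Jantzen.
rewrite !fE grmap_wt; apply/seteqP; split=> [w [y [hy e ->]]|_ ->] /=.
  apply/qclass_sub; rewrite -(subrK (gmul (gelt k g) (grmap i z)) (gmul (gelt k g) y)) -addrA rpredD //.
    move/qclass_sub: e; rewrite -opprB rpredN => /(Gow_act g).
    by rewrite gmul_geltB.
  exact: grmap_equiv.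
exists (grmap i z); split=> //; first exact: grmap_Gow.
by apply/qclass_sub; rewrite -opprB rpredN; apply: grmap_equiv.
Qed.

Lemma wt_Jantzen_gt i u : (kap < i)%N -> u \in Jantzen V k l i -> coordsk u = 0.
Proof.
move=> ik hu; apply: (can_inj (mulmxK uP)); rewrite mul0mx; apply/rowP => t.
by rewrite (Jantzen_coordsk hu) ?mxE // (leq_ltn_trans (vk t)).
Qed.

Lemma span_set0E (R : pzRingType) (M : lmodType R) (x : M) : x \in Defs.span (set0 : set M) -> x = 0.
Proof. by move=> /asboolP; elim. Qed.

(** No elementary divisor has valuation above kap, so the weight space of the i-th term is zero, and
    so is M at a negative index. *)
Lemma rep_iso_gr_gt i j : (kap < i)%N ->
  rep_iso
    (wt_quot W [set` Jantzen V k l i] (Jantzen V k l i.+1))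
    (flag_act W phi [set` Jantzen V k l i] (Jantzen V k l i.+1))
    (Gow_quot F m k l (Negz j))
    (Gow_quot_act F m k l (Negz j)).
Proof.
move=> ik; pose B := Jantzen V k l i.+1; pose N := Gow_den F m k l (Negz j).
have X0 x : wt_quot W [set` Jantzen V k l i] B x -> x = 0.
  by case=> z hz <-; rewrite wt_projE (wt_Jantzen_gt ik hz) elk0 raddf0.
have Y0 y : y \in Gow_num F m k l (Negz j) -> y = 0 by exact: span_set0E.
exists (fun=> 0); split.
- by move=> a x y _ _; rewrite scaler0 addr0.
- split.
  + by move=> x _; exists 0; rewrite ?raddf0 //=; apply: rpred0.
  + by move=> x y /set_mem /X0 -> /set_mem /X0 ->.
  + move=> _ [y /Y0 -> <-]; exists 0; rewrite ?raddf0 //.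
    by exists 0; rewrite ?wt_proj0 ?raddf0 //=; apply: rpred0.
move=> g x /X0 ->; exists 0; split.
- by exists 0; rewrite ?wt_proj0 ?raddf0 //=; apply: rpred0.
- have h0 : wt_proj W (0 : Deltak V k) \in Jantzen V k l i by rewrite wt_proj0 rpred0.
  have := @flag_actE i.+1 [set` Jantzen V k l i] g 0 h0.
  by rewrite wt_proj0 rhoDk0 raddf0.
apply/seteqP; split=> [w [y [/Y0 -> _ ->]]|_ ->] /=.
  by rewrite gmul_gelt0 raddf0.
exists 0; rewrite gmul_gelt0 raddf0.
by split=> //; apply: rpred0.
Qed.

(** No t has v t < 0, so in degree 0 the map is the reduction of A itself and is exactly
    equivariant. *)
Lemma grmap0_tens x : grmap 0 (tens k x) = row_St (redm k (coords x *m gram)).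
Proof.
rewrite /grmap; congr row_St; apply: (can_inj (mulmxK uQ)); apply/rowP => t.
have e : coords x *m gram = (l ^ 0)%:Z *: (coords x *m gram) by rewrite scale1r.
rewrite grmxQ coordsk_tens; have [h1 h2] := S6 e t.
by case: eqP => [/h1 -> //|/eqP]; rewrite -lt0n => /h2 ->.
Qed.

Lemma grmap0_equiv g u : gmul (gelt k g) (grmap 0 u) = grmap 0 (rhoDk g u).
Proof.
elim/basechange_ind: u => [|a x u IH]; first by rewrite rhoDk0 grmap0 gmul_gelt0.
rewrite grmap_lin gmul_linr rhoDk_lin IH grmap_lin; congr (_ *: _ + _).
rewrite rhoDk_tens !grmap0_tens (row_St_act VW hphi) (coords_rhoD VW hphi).
by rewrite -[in RHS]mulmxA (rho_gram VW hphi) mulmxA [in RHS]redmM [in RHS]redmT.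
Qed.

(** * The socle of the Steinberg module *)

Hypothesis hq : ~~ (l %| #|F|)%N.

Lemma q_neq0 e : (#|F| ^ e)%:R != 0 :> k.
Proof. by rewrite -(dvdn_pcharf hl) Euclid_dvdX ?(pcharf_prime hl) // negb_and hq. Qed.

(** The standard flag is fixed by B, so its image spans a U-invariant line. *)
Definition soc_gen : grp_alg F m k := grmap 0 (tens k (dpath V (gflag 1%g))).

Lemma grmap0_gflag g : grmap 0 (tens k (dpath V (gflag g))) = gmul (gelt k g) soc_gen.
Proof. by rewrite /soc_gen grmap0_equiv rhoDk_tens (rhoD_gflag VW hphi) mulg1. Qed.

(** The value at 1 is the form of the standard flag with itself, a power of q by [pairing_self]. *)
Lemma soc_gen_1 : soc_gen 1%g != 0.
Proof.
have hF := gflag_flag VW hphi 1%g; have /andP [hF' _] := hF.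
have -> : soc_gen 1%g = (pairing V (gflag 1%g) (gflag 1%g))%:~R.
  rewrite /soc_gen grmap0_tens ffunE (pairing_expand VW hphi hF' hF) rmorph_sum /=.
  apply: eq_bigr => r _; rewrite mxE -(lam_pairing VW hphi).
  by rewrite lam_dpath ?intrM //; apply: good_pairing.
by have [e ->] := pairing_self hF'; rewrite -pmulrn q_neq0.
Qed.

Lemma soc_gen_inv u h : in_U u -> soc_gen (u * h)%g = soc_gen h.
Proof.
move=> hu; have -> : soc_gen (u * h)%g = gmul (gelt k u^-1%g) soc_gen h.
  by rewrite gelt_mulE invgK.
rewrite -grmap0_gflag /soc_gen; congr (grmap 0 (tens k (dpath V _)) _).
by apply/esym/(gflag_eqP VW hphi); rewrite invg1 mul1g; case/in_UP: (etrans (in_UV u) hu).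
Qed.

Lemma gl_sum (N : set (grp_alg F m k)) (I : finType) (p : pred I) (f : I -> grp_alg F m k) :
  GL_submod N -> (forall i, p i -> N (f i)) -> N (\sum_(i | p i) f i).
Proof.
move=> [N0 NL _] h; elim/big_ind: _ => // x y hx hy.
by rewrite -[x]scale1r; apply: NL.
Qed.

(* Averaging an element z of N with z(1) <> 0 over U produces a nonzero U-invariant
   element of the Steinberg module, and such elements are unique up to scalars. *)
Lemma soc_gen_sub (N : set (grp_alg F m k)) z :
  GL_submod N -> N `<=` St F m k -> N z -> z <> 0 -> N soc_gen.
Proof.
move=> hN NS Nz z0; have [N0 NL NG] := hN.
have [g0 hg0] : exists g, z g != 0.
  apply/existsP; apply: contraT; rewrite negb_exists => /forallP h; case: z0.
  by apply/ffunP => g; rewrite [RHS]ffunE; have := h g; rewrite negbK => /eqP.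
pose z1 := gmul (gelt k g0^-1%g) z.
have Nz1 : N z1 by apply: NG.
have z11 : z1 1%g != 0 by rewrite /z1 gelt_mulE invgK mulg1.
pose z2 := \sum_(u | in_U u) gmul (gelt k u) z1.
have Nz2 : N z2 by apply: gl_sum => // u _; apply: NG.
have z2E h : z2 h = \sum_(u | in_U u) z1 (u^-1 * h)%g.
  by rewrite /z2 sum_ffunE; apply: eq_bigr => u _; rewrite gelt_mulE.
(* Elements of St are right B-invariant, so each summand at 1 equals z1(1) and the sum is |U|
   z1(1). *)
have z21 : z2 1%g != 0.
  rewrite z2E (eq_bigr (fun=> z1 1%g)) => [|u hu]; last first.
    rewrite mulg1; apply: (St_gflag VW hphi (NS _ Nz1)); apply/(gflag_eqP VW hphi).
    by rewrite invgK mulg1; case/in_UP: hu.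
  rewrite -big_filter big_const_seq count_predT iter_addr_0 -mulr_natr mulf_neq0 //.
  have -> : size [seq u <- index_enum (GLmat F m) | in_U u] = #|[pred u : G | in_U u]|.
    by rewrite cardE /enum_mem size_filter -size_filter.
  by rewrite card_in_U q_neq0.
have z2inv x h : in_U x -> z2 (x * h)%g = z2 h.
  move=> hx; rewrite !z2E (reindex_inj (mulgI x)) /=; apply: eq_big => u.
    by apply/idP/idP => [/(in_UM (etrans (in_UV x) hx))|]; [rewrite mulKg | apply: in_UM].
  by move=> _; rewrite invMg -mulgA mulKg.
(* U is transitive on the big cell, so a U-invariant element of St is determined by its value at w0;
   for the nonzero element [soc_gen] this value is therefore nonzero. *)
have e00 : soc_gen (GLperm F w0) != 0.
  apply: contraNneq soc_gen_1 => e; apply/eqP; suff -> : soc_gen = 0 by rewrite ffunE.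
  apply: (St_eq VW hphi) => [||u hu]; [exact: St_grmap | exact: St0 |].
  by rewrite soc_gen_inv // e [RHS]ffunE.
have ez : z2 = (z2 (GLperm F w0) / soc_gen (GLperm F w0)) *: soc_gen.
  apply: (St_eq VW hphi) => [||u hu]; first exact: NS.
    by rewrite -[_ *: _]addr0; apply: St_lin; [apply: St_grmap | apply: St0].
  by rewrite z2inv // ffunE soc_gen_inv // /GRing.scale /= divfK.
have c0 : z2 (GLperm F w0) / soc_gen (GLperm F w0) != 0.
  by apply: contraNneq z21 => c0; rewrite ez c0 scale0r ffunE.
have := NL (z2 (GLperm F w0) / soc_gen (GLperm F w0))^-1 z2 0 Nz2 N0.
by rewrite addr0 {2}ez scalerA mulVf // scale1r.
Qed.

(** The image of A modulo l, a copy of the W-weight space of L_V inside St. *)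
Definition Y0 : set (grp_alg F m k) := [set grmap 0 u | u in setT].

Lemma Y0_submod : GL_submod Y0.
Proof.
split; first by exists 0; rewrite ?grmap0.
  by move=> a _ _ [u _ <-] [u' _ <-]; exists (a *: u + u'); rewrite ?grmap_lin.
by move=> g _ [u _ <-]; exists (rhoDk g u); rewrite ?grmap0_equiv.
Qed.

(** All flags are translates of the standard one, so [soc_gen] generates [Y0], and by [soc_gen_sub]
    it lies in N. *)
Lemma Y0_sub N z : GL_submod N -> N `<=` St F m k -> N z -> z <> 0 -> Y0 `<=` N.
Proof.
move=> hN NS Nz z0 _ [u _ <-]; have Ne := soc_gen_sub hN NS Nz z0.
have [N0 NL NG] := hN.
rewrite -grmap_wt wt_projE /elk.
elim/big_ind: _ => [|x y hx hy|t _]; first by rewrite grmap0.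
  by rewrite -[x]scale1r grmap_lin; apply: NL.
by rewrite -[_ *: _]addr0 grmap_lin grmap0; apply: NL => //; rewrite grmap0_gflag; apply: NG.
Qed.

Lemma Y0_St : Y0 `<=` St F m k.
Proof. by move=> _ [u _ <-]; apply: St_grmap. Qed.

Lemma soc_gen_neq0 : soc_gen <> 0.
Proof. by move=> e; have := soc_gen_1; rewrite e ffunE eqxx. Qed.

Lemma Y0_simple : GL_simple Y0.
Proof.
split; first exact: Y0_submod.
  move=> e; have : Y0 soc_gen by exists (tens k (dpath V (gflag 1%g))).
  by rewrite e => /soc_gen_neq0.
move=> Y hY YY0; have [[z Yz z0]|nY] := pselect (exists2 z, Y z & z <> 0).
  right; apply/seteqP; split=> //; apply: (Y0_sub hY _ Yz z0).
  exact: subset_trans Y0_St.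
left; apply/seteqP; split=> [z Yz|_ ->]; last by case: hY.
by apply: contrapT => z0; apply: nY; exists z.
Qed.

Lemma socE x : x \in soc (St F m k) <-> Y0 x.
Proof.
split=> [|hx]; last first.
  by apply: span_sub; exists Y0; split; [apply: Y0_simple | apply: Y0_St |].
have [h0 hL _] := Y0_submod.
move=> /asboolP; elim=> // a {}x y [Y [[hY Yn0 Ymin] YS Yx]] _ IH; apply: hL => //.
have [z Yz z0] : exists2 z, Y z & z <> 0.
  apply: contrapT => nY; apply: Yn0; apply/seteqP; split=> [z Yz|_ ->]; last by case: hY.
  by apply: contrapT => z0; apply: nY; exists z.
have Y0Y := Y0_sub hY YS Yz z0.
case: (Ymin Y0 Y0_submod Y0Y) => [e|->//].
have : Y0 soc_gen by exists (tens k (dpath V (gflag 1%g))).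
by rewrite e => /soc_gen_neq0.
Qed.

Lemma Jantzen0 u : u \in Jantzen V k l 0.
Proof.
elim/basechange_ind: u => [|a x u IH]; first exact: rpred0.
apply: rpredD => //; apply: rpredZ; apply: span_sub; exists x => // w.
Qed.

Lemma rep_iso_soc :
  rep_iso (wt_quot W setT (Jantzen V k l 1)) (flag_act W phi setT (Jantzen V k l 1))
    [set` soc (St F m k)] (St_act F m k).
Proof.
pose B := Jantzen V k l 1.
pose f (u : quotmod B) : grp_alg F m k := grmap 0 (repr u).
have fE z : f (qclass B z) = grmap 0 z.
  by apply/eqP; rewrite -subr_eq0 -hmapB grmap_ker //; apply: repr_qclass.
exists f; split.
- move=> a x y _ _; case: (qclassP x) => x' ->; case: (qclassP y) => y' ->.
  by rewrite -linearP !fE grmap_lin.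
- split.
  + by move=> _ [z _ <-]; rewrite fE /mkset; apply/socE; exists (wt_proj W z).
  + move=> _ _ /set_mem [z _ <-] /set_mem [z' _ <-].
    rewrite !fE !grmap_wt => e; apply/qclass_sub; rewrite -wt_projB.
    apply: grmap_inj => //; first exact: Jantzen0.
    by rewrite hmapB e subrr rpred0.
  + move=> y /socE [u _ <-]; exists (qclass B (wt_proj W u)); first by exists u.
    by rewrite fE grmap_wt.
move=> g _ [z hz <-]; exists (qclass B (rhoDk g z)); split.
- by exists (rhoDk g z); rewrite ?wt_rhoDk.
- exact: flag_actE.
by rewrite !fE grmap_wt -grmap0_equiv.
Qed.

End OverField.

(** Each factor [j]_q with j > 0 is 1 plus a multiple of q. *)
Lemma qfact_mod (F : finFieldType) p m : (p %| #|F|)%N -> (qfact F m %% p = 1 %% p)%N.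
Proof.
move=> pq; have qn j : (qnum F j.+1 %% p = 1 %% p)%N.
  by rewrite /= -modnDmr -modnMml (eqP pq) mul0n mod0n addn0.
elim: m => // m IH; have -> : qfact F m.+1 = (qnum F m.+1 * qfact F m)%N by [].
by rewrite -modnMm qn IH modnMm.
Qed.

Section Quotient.
Variables (F : finFieldType) (n : nat) (V W : subsp F n).
Hypothesis VW : (V <= W)%VS.

(** In the defining characteristic no isomorphism of W/V with a coordinate space is given; the
    coordinates of the projection to a complement of V in W supply one. *)
Lemma quot_iso_exists :
  exists m, exists phi : 'Hom('cV[F]_n, 'cV[F]_m), quot_iso V W phi.
Proof.
pose C := (W :\: V)%VS; pose p := daddv_pi C V; pose b := vbasis C.
have dCV : (C :&: V = 0)%VS by apply: capv_diff.
have CV : (C + V = W)%VS by rewrite addv_diff; apply/addv_idPl.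
have CW : (C <= W)%VS by rewrite -CV addvSl.
have bC : basis_of C b := vbasisP C.
pose f (v : 'cV[F]_n) : 'cV[F]_(\dim C) := \col_(i < \dim C) coord b i (p v).
have fl : linear f.
  by move=> a u v; apply/colP => i; rewrite !mxE !linearP.
pose fL := GRing.isLinear.Build _ _ _ _ f fl.
pose ff : {linear 'cV[F]_n -> 'cV[F]_(\dim C)} := HB.pack f fL.
exists (\dim C), (linfun ff).
have phiE v : linfun ff v = f v by rewrite lfunE.
split.
  apply/eqP; rewrite eqEsubv subvf /=; apply/subvP => y _.
  pose v := \sum_(i < \dim C) y i 0 *: b`_i.
  have vC : v \in C.
    by apply: memv_suml => i _; apply: memvZ; apply: (basis_mem bC); rewrite mem_nth ?size_tuple.
  have -> : y = linfun ff v.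
    apply/colP => i; rewrite phiE mxE daddv_pi_id // coord_sum_free //; exact: basis_free bC.
  by apply: memv_img; apply: (subvP CW).
apply/vspaceP => v; rewrite memv_cap memv_ker phiE; apply/andP/idP => [[/eqP e vW]|vV].
  have pv0 : p v = 0.
    rewrite (coord_vbasis (memv_pi C V v)) big1 // => i _.
    by have /colP /(_ i) := e; rewrite !mxE => ->; rewrite scale0r.
  rewrite -(daddv_pi_add dCV (w := v)) ?CV // -/p pv0 add0r; exact: memv_pi.
split; last exact: (subvP VW).
apply/eqP/colP => i; rewrite !mxE.
have dVC : (V :&: C = 0)%VS by rewrite capvC.
have := daddv_pi_add dCV (w := v); rewrite CV => /(_ (subvP VW _ vV)).
rewrite (daddv_pi_id dVC vV) -[RHS]add0r => /addIr; rewrite -/p => ->.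
by rewrite linear0.
Qed.

End Quotient.

Section GramValuation.
Variables (F : finFieldType) (n m : nat) (V W : subsp F n) (l : nat).
Hypothesis pl : prime l.

Lemma logn_gram_const : logn l (gram_const m V) =
  (logn l #|F| * (\dim V * m) + logn l (qfact F m))%N.
Proof.
have h := gram_const_gt0 m V; rewrite /gram_const in h *.
have /andP [h1 h2] : (0 < #|F| ^ (\dim V * m))%N && (0 < qfact F m)%N.
  by rewrite -muln_gt0.
by rewrite lognM // lognX mulnC.
Qed.

Lemma logn_gram_const_coprime (phi : 'Hom('cV[F]_n, 'cV[F]_m)) :
  (V <= W)%VS -> quot_iso V W phi -> ~~ (l %| #|F|)%N ->
  logn l (gram_const m V) = logn l (nb_full_flags V W).
Proof.
move=> VW hphi hq; rewrite logn_gram_const nb_full_flagsE // (quot_dim hphi) addKn.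
by rewrite logn_coprime ?prime_coprime.
Qed.

Lemma logn_gram_const_pow s : #|F| = (l ^ s)%N -> (0 < s)%N ->
  logn l (gram_const m V) = (s * (\dim V * m))%N.
Proof.
move=> e s0; rewrite logn_gram_const e pfactorK // logn_coprime ?addn0 //.
rewrite prime_coprime // /dvdn qfact_mod ?modn_small ?prime_gt1 //.
by rewrite e dvdn_exp.
Qed.

End GramValuation.

Section CoprimeCharacteristic.
Variables (F : finFieldType) (n m : nat) (V W : subsp F n).
Variable phi : 'Hom('cV[F]_n, 'cV[F]_m).
Hypothesis VW : (V <= W)%VS.
Hypothesis hphi : quot_iso V W phi.
Variables (k : fieldType) (l : nat).
Hypothesis hl : l \in [pchar k].
Hypothesis hq : ~~ (l %| #|F|)%N.

Lemma Jantzen_Gow (kappa := logn l (nb_full_flags V W)) :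
  (forall i : nat,
    rep_iso
      (wt_quot W [set` Jantzen V k l i] (Jantzen V k l i.+1))
      (flag_act W phi [set` Jantzen V k l i] (Jantzen V k l i.+1))
      (Gow_quot F m k l (kappa%:Z - i%:Z))
      (Gow_quot_act F m k l (kappa%:Z - i%:Z)))
  /\ rep_iso
      (wt_quot W setT (Jantzen V k l 1))
      (flag_act W phi setT (Jantzen V k l 1))
      [set` soc (St F m k)]
      (St_act F m k).
Proof.
have ek := logn_gram_const_coprime (pcharf_prime hl) VW hphi hq.
have [P [Q [v [un [[uP uQ vk un0] [S2 S3 S4 S5 S6]]]]]] :=
  smith_bases hl (gram_const_gt0 m V) (AF VW hphi).
split; last exact: (rep_iso_soc VW hphi hl uP uQ un0 S2 S3 S4 S6 hq).
move=> i; rewrite /kappa -ek; have [ik|ki] := leqP i (logn l (gram_const m V)).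
  by rewrite subzn //; apply: (rep_iso_gr_le VW hphi uP uQ un0 S2 S3 S4 S5 S6).
(* [Negz j] denotes -(j + 1), whence the predecessor. *)
have -> : (logn l (gram_const m V))%:Z - i%:Z = Negz (i - logn l (gram_const m V)).-1.
  by rewrite NegzE prednK ?subn_gt0 // -subzn ?opprB // ltnW.
exact: (rep_iso_gr_gt VW hphi uP vk S2).
Qed.

End CoprimeCharacteristic.

(** * Weight space decomposition *)

Section Weights.
Variables (F : finFieldType) (n : nat) (V : subsp F n) (k : fieldType).
Implicit Types (W : subsp F n) (u : Deltak V k).

Lemma tens0 : tens k 0 = 0 :> Deltak V k.
Proof. exact: raddf0. Qed.

Lemma tensB (x y : Delta V) : tens k (x - y) = tens k x - tens k y :> Deltak V k.
Proof. exact: raddfB. Qed.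

Lemma wtK W u : wt_proj W (wt_proj W u) = wt_proj W u.
Proof.
elim/basechange_ind: u => [|a x u IH]; first by rewrite !wt_proj0.
rewrite !wt_projP IH !wt_proj_tens; congr (_ *: tens k _ + _).
elim/Delta_ind: x => [|x y IHx IHy|K hK]; first by rewrite !scaler0.
  by rewrite !scalerBr IHx IHy.
by rewrite scale_spath1 //; case: ifP => e; rewrite ?scaler0 // scale_spath1 // e.
Qed.

Lemma wt_neq W W' u : W != W' -> wt_proj W (wt_proj W' u) = 0.
Proof.
move=> ne; elim/basechange_ind: u => [|a x u IH]; first by rewrite !wt_proj0.
rewrite !wt_projP IH !wt_proj_tens addr0.
suff -> : spath [:: W] *: (spath [:: W'] *: x) = 0 by rewrite tens0 scaler0.
elim/Delta_ind: x => [|x y IHx IHy|K hK]; first by rewrite !scaler0.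
  by rewrite !scalerBr IHx IHy subr0.
rewrite [X in _ *: X]scale_spath1 //; case: eqP => e; rewrite ?scaler0 //.
by rewrite scale_spath1 // e eq_sym (negPf ne).
Qed.

Lemma wt_not_sub W u : ~~ (V <= W)%VS -> wt_proj W u = 0.
Proof.
move=> nVW; elim/basechange_ind: u => [|a x u IH]; first by rewrite !wt_proj0.
rewrite wt_projP IH wt_proj_tens addr0.
suff -> : spath [:: W] *: x = 0 by rewrite tens0 scaler0.
elim/Delta_ind: x => [|x y IHx IHy|K hK]; first by rewrite !scaler0.
  by rewrite !scalerBr IHx IHy subr0.
rewrite scale_spath1 //; case: eqP => e //; case/negP: nVW.
by rewrite -e; case: K hK {e} => // U t; apply: flag_sub.
Qed.

Lemma wt_sumE u : u = \sum_W wt_proj W u.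
Proof.
elim/basechange_ind: u => [|a x u IH].
  by rewrite big1 // => W _; rewrite wt_proj0.
rewrite [in LHS]IH [RHS](eq_bigr (fun W => a *: wt_proj W (tens k x) + wt_proj W u)) => [|W _].
  rewrite [RHS]big_split -scaler_sumr; congr (_ *: _ + _).
  elim/Delta_ind: x => [|x y IHx IHy|K hK].
  - by rewrite tens0 big1 // => W _; rewrite wt_proj0.
  - rewrite [LHS]tensB [X in X - _]IHx [X in _ - X]IHy -sumrB; apply: eq_bigr => W _.
    by rewrite !wt_proj_tens scalerBr tensB.
  rewrite (bigD1 (head 0%VS K : subsp F n)) //= [X in X + _]wt_proj_tens scale_spath1 // eqxx.
  rewrite big1 ?addr0 // => W ne.
  by rewrite wt_proj_tens scale_spath1 // eq_sym (negPf ne) tens0.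
by rewrite wt_projP.
Qed.

End Weights.

(** * The defining characteristic *)

Section DefiningCharacteristic.
Variables (F : finFieldType) (n : nat) (V : subsp F n) (k : fieldType) (l s : nat).
Hypothesis hl : l \in [pchar k].
Hypothesis hs : #|F| = (l ^ s)%N.
Implicit Types (W : subsp F n) (u : Deltak V k).

Lemma pow_gt0 : (0 < s)%N.
Proof. by rewrite lt0n; apply: contraTneq (card_finNzRing_gt1 F) => s0; rewrite hs s0. Qed.

Local Notation bound W := (s * \dim V * (\dim W - \dim V))%N.

(** The upper bound: every v t is at most the valuation of [gram_const], which is [bound W]. *)
Lemma Jantzen_wt0 W i u : (V <= W)%VS -> (bound W < i)%N ->
  u \in Jantzen V k l i -> wt_proj W u = 0.
Proof.
move=> VW hi hu; have [m [phi hphi]] := quot_iso_exists VW.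
have [P [Q [v [un [[uP uQ vk un0] [S2 S3 S4 S5 S6]]]]]] :=
  smith_bases hl (gram_const_gt0 m V) (AF VW hphi).
rewrite (wt_projE VW hphi).
suff -> : coordsk W phi u = 0 by exact: elk0.
apply: (can_inj (mulmxK uP)); rewrite mul0mx; apply/rowP => t; rewrite [RHS]mxE.
apply: (Jantzen_coordsk VW hphi S2 hu); apply: leq_ltn_trans (vk t) _.
by move: hi; rewrite (logn_gram_const_pow _ _ (pcharf_prime hl) hs pow_gt0) (quot_dim hphi) addKn mulnA.
Qed.

(** The lower bound: by [pairing_dvd] all entries of A are divisible by l to the power [bound W], so
    the lattice itself lies in the required term. *)
Lemma wt_proj_Jantzen W i u : (V <= W)%VS -> (i <= bound W)%N ->
  wt_proj W u \in Jantzen V k l i.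
Proof.
move=> VW hi; have [m [phi hphi]] := quot_iso_exists VW.
elim/basechange_ind: u => [|a x u IH]; first by rewrite wt_proj0 rpred0.
rewrite wt_projP; apply: rpredD => //; apply: rpredZ; rewrite wt_proj_tens.
apply: span_sub; exists (spath [:: W] *: x) => //.
apply: (coords_Delta_fil VW hphi) => t r.
rewrite mxE; apply: rpred_sum => j _; apply: dvdz_mull; rewrite mxE.
have [c ->] := pairing_dvd (basef_flag VW hphi j) (basef_flag VW hphi r).
apply: dvdz_mulr; have := size_flag (basef_flag VW hphi r).
rewrite (quot_dim hphi) => /addnI <-; rewrite hs -expnM mulnA.
by apply: dvdn_exp2l; move: hi; rewrite (quot_dim hphi) addKn.
Qed.

Lemma Jantzen_sum i :
  internal_direct_sum (fun W => (V <= W)%VS && (i <= bound W)%N) (wt V k)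
    [set` Jantzen V k l i].
Proof.
split=> [u|y hy e W PW].
  split=> [hu|[y hy ->]].
    exists (fun W => wt_proj W u) => [W _|]; first by exists u.
    rewrite [LHS]wt_sumE [RHS]big_mkcond; apply: eq_bigr => W _ /=.
    case: ifP => // /negbT; rewrite negb_and -ltnNge => /orP [nVW|ni].
      exact: wt_not_sub.
    by have [VW|nVW] := boolP (V <= W)%VS; [apply: (Jantzen_wt0 VW ni) | apply: wt_not_sub].
  apply: rpred_sum => W /andP [VW hi].
  by have [|w _ <-] := hy W; [apply/andP | apply: wt_proj_Jantzen].
have wtE W' : (V <= W')%VS && (i <= bound W')%N -> wt_proj W' (y W') = y W'.
  by move=> /hy [w _ <-]; rewrite wtK.
have := congr1 (wt_proj W) e; rewrite wt_proj0.
rewrite (big_morph (wt_proj W) (id1 := 0) (op1 := +%R)); last 2 first.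
- by move=> a b; have := wt_projP 1 a b W; rewrite !scale1r.
- exact: wt_proj0.
rewrite (bigD1 W) //= wtE // big1 ?addr0 // => W' /andP [PW' ne].
by rewrite -wtE // wt_neq // eq_sym.
Qed.

Lemma Jantzen1_wt0 u : u \in Jantzen V k l 1 -> wt_proj V u = 0.
Proof. by move=> hu; apply: (Jantzen_wt0 _ _ hu); rewrite ?subnn ?muln0. Qed.

Lemma wt_V_line u : exists a, wt_proj V u = a *: tens k (dpath V [:: V]).
Proof.
elim/basechange_ind: u => [|a x u [b IH]]; first by exists 0; rewrite wt_proj0 scale0r.
suff [c e] : exists c : int, spath [:: V] *: x = dpath V [:: V] *~ c.
  by exists (a * c%:~R + b); rewrite wt_projP IH wt_proj_tens e tensMz scalerA scalerDl.
elim/Delta_ind: x => [|x y [c IHx] [d IHy]|K hK]; first by exists 0; rewrite scaler0.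
  by exists (c - d); rewrite scalerBr IHx IHy mulrzBr.
rewrite scale_spath1 //; case: eqP => [e|_]; last by exists 0.
by exists 1; rewrite (@flag_from_V _ _ V K) // /is_flag_from_to hK e /=.
Qed.

Lemma wt_V_tens : wt_proj V (tens k (dpath V [:: V])) = tens k (dpath V [:: V]).
Proof. by rewrite wt_proj_tens scale_spath1 /= ?eqxx. Qed.

(** The functional of [point_V] takes the value 1 there. *)
Lemma tens_V_neq0 : tens k (dpath V [:: V]) != 0 :> Deltak V k.
Proof.
pose f (x : Delta V) : k := (lam (point_V V) x)%:~R.
have fB : zmod_morphism f by move=> x y; rewrite /f lamB ?rmorphB //; exact: good_point_V.
apply/eqP => /(congr1 (bclift f)); rewrite bclift_tens //.
have -> : bclift f 0 = 0 by have := bclift_linear (-1) 0 0 fB; rewrite scaler0 addr0 mulN1r addNr.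
rewrite /f lam_dpath ?/point_V /= ?eqxx //; last exact: good_point_V.
by move/eqP; rewrite oner_eq0.
Qed.

Lemma wt_V_one : one_dimensional (wt V k V).
Proof.
exists (tens k (dpath V [:: V])); split; first by exists (tens k (dpath V [:: V])); rewrite ?wt_V_tens.
  exact: tens_V_neq0.
by move=> _ [u _ <-]; apply: wt_V_line.
Qed.

(** For V nonzero and W strictly above V, [bound W] is at least 1, so that weight space lies in the
    first filtration term; the V-weight space meets this term trivially because [bound V] is 0. *)
Lemma to_Lk_bij : V <> 0%VS -> set_bij (wt V k V) [set: Lk V k l] (to_Lk V k l).
Proof.
move=> V0; split=> //.
  move=> _ _ /set_mem [u _ <-] /set_mem [w _ <-] /eqP; rewrite qclass_eq => /Jantzen1_wt0.
  by rewrite wt_projB !wtK => /eqP; rewrite subr_eq0 => /eqP.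
move=> y _; case: (qclassP y) => u ->; exists (wt_proj V u); first by exists u.
apply/eqP; rewrite eq_sym qclass_eq {1}[u]wt_sumE (bigD1 V isT) addrAC subrr add0r.
apply: rpred_sum => W ne; have [VW|nVW] := boolP (V <= W)%VS; last first.
  by rewrite wt_not_sub ?rpred0.
apply: wt_proj_Jantzen => //; rewrite !muln_gt0 pow_gt0 lt0n dimv_eq0 subn_gt0 /=.
rewrite (introN eqP V0) /=; rewrite ltn_neqAle dimvS // andbT.
by apply: contra ne => /eqP e; rewrite eq_sym eqEdim VW e leqnn.
Qed.

Lemma Lk_one : V <> 0%VS -> one_dimensional [set: Lk V k l].
Proof.
move=> V0; have [_ inj sur] := to_Lk_bij V0.
have [v [hv v0 hspan]] := wt_V_one; exists (to_Lk V k l v); split=> //.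
  apply/eqP => e; case/eqP: v0; apply: inj; rewrite ?inE //.
    by exists 0; rewrite ?wt_proj0.
  by rewrite e /to_Lk linear0.
move=> y _; have [x hx <-] := sur y I; have [a ->] := hspan x hx.
by exists a; rewrite /to_Lk linearZ.
Qed.

End DefiningCharacteristic.

(** For V = 0 the bound s dim V dim W/V is 0 for every W, so all weight spaces of the first
    filtration term vanish. *)
Lemma to_L0_bij (F : finFieldType) n (k : fieldType) (l s : nat) :
  l \in [pchar k] -> #|F| = (l ^ s)%N -> bijective (to_Lk (0%VS : subsp F n) k l).
Proof.
move=> hl hs; exists (fun u => repr u) => [u|u]; last by case: (qclassP u) => x ->; rewrite /to_Lk /qclass reprK.
apply/eqP; rewrite -subr_eq0; apply/eqP; rewrite [LHS]wt_sumE big1 // => W _.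
apply: (Jantzen_wt0 hl hs (i := 1)); first exact: sub0v.
  by rewrite dimv0 muln0.
by rewrite -qclass_eq /to_Lk /qclass reprK.
Qed.

Theorem corollary4p9 (k : fieldType) (l : nat) (F : finFieldType) (n : nat)
    (hl : l \in [pchar k]) :
  (forall s : nat, #|F| = (l ^ s)%N ->
    bijective (to_Lk (0%VS : subsp F n) k l)
    /\ forall V : subsp F n, V <> 0%VS ->
      [/\ forall i : nat,
            internal_direct_sum
              (fun W : subsp F n =>
                 (V <= W)%VS && (i <= s * \dim V * (\dim W - \dim V))%N)
              (wt V k) [set` Jantzen V k l i],
          set_bij (wt V k V) [set: Lk V k l] (to_Lk V k l),
          one_dimensional (wt V k V)
        & one_dimensional [set: Lk V k l]])
  /\
  (~~ (l %| #|F|)%N ->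
    forall (V W : subsp F n), (V <= W)%VS ->
    forall (m : nat) (phi : 'Hom('cV[F]_n, 'cV[F]_m)), quot_iso V W phi ->
      let kappa := logn l (nb_full_flags V W) in
      (forall i : nat,
        rep_iso
          (wt_quot W [set` Jantzen V k l i] (Jantzen V k l i.+1))
          (flag_act W phi [set` Jantzen V k l i] (Jantzen V k l i.+1))
          (Gow_quot F m k l (kappa%:Z - i%:Z))
          (Gow_quot_act F m k l (kappa%:Z - i%:Z)))
      /\ rep_iso
          (wt_quot W setT (Jantzen V k l 1))
          (flag_act W phi setT (Jantzen V k l 1))
          [set` soc (St F m k)]
          (St_act F m k)).
Proof.
split=> [s hs|hq V W VW m phi hphi]; last exact: (Jantzen_Gow VW hphi hl hq).
split=> [|V V0]; first exact: (to_L0_bij n hl hs).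
split=> [i|||].
- exact: (Jantzen_sum V hl hs).
- exact: (to_Lk_bij hl hs).
- exact: wt_V_one.
- exact: (Lk_one hl hs).
Qed.
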